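(* Let $\mathbb{X}$ be a complex analytic vector field on $(\mathbb{R}^2\setminus\mathfrak{P},J)$ with a locally finite set of incomplete real trajectories, and let $X=\mathrm{Re}(\mathbb{X})\in\mathfrak{X}^\infty(\mathbb{R}^2\setminus\mathfrak{S})$. 1) There exists a $C^\infty$ flat Riemannian metric $g_X$ on $\mathbb{R}^2\setminus\big(\mathcal{Z}(X)\cup\mathfrak{S}\cup\mathcal{A}(X)\big)$ such that $X$ is a geodesic vector field. 2) $X$ is one of the two linearly independent infinitesimal generators of a $C^\infty$ local $(\mathbb{R}^2,+)$-action on $\mathbb{R}^2\setminus\big(\mathcal{Z}(X)\cup\mathfrak{S}\cup\mathcal{A}(X)\big)$.
   Context: $\mathbb{S}^2=\mathbb{R}^2\cup\{\infty\}$. $\mathfrak{S}\subset\mathbb{R}^2$ is a set having at most a finite number of accumulation points, where the real vector field $X$ is undefined or non-$C^\infty$; $\mathcal{Z}(X)\subset\mathbb{R}^2\setminus\mathfrak{S}$ is the zero set of $X\in\mathfrak{X}^\infty(\mathbb{R}^2\setminus\mathfrak{S})$ (the $C^\infty$ vector fields); $\mathfrak{P}=\mathfrak{S}\cup\mathcal{Z}(X)$; $J$ is a complex structure such that $(\mathbb{R}^2\setminus\mathfrak{P},J)$ is a Riemann surface. If $\mathbb{X}=(u+\sqrt{-1}v)\frac{\partial}{\partial z}$ in a local complex coordinate $z=x+\sqrt{-1}y$ of $J$, then $\mathrm{Re}(\mathbb{X})=u\frac{\partial}{\partial x}+v\frac{\partial}{\partial y}$. An incomplete real trajectory of $\mathbb{X}$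 is a maximal trajectory of $\mathrm{Re}(\mathbb{X})$ not defined for all real time. Separatrices of $X$: the points of $(\mathfrak{P}\cup\{\infty\})\setminus\{\text{topological centers, sources or sinks}\}$, and the non-stationary trajectories $\zeta_\varsigma$ of $X$ that do not admit an open neighbourhood in $\mathbb{R}^2\setminus\mathfrak{P}$ filled by trajectories having the same topology. The attractors $\mathcal{A}(X)$ of $X$ are: the points $q_j\in\mathfrak{P}$ which admit topological parabolic sectors (in particular topological sources or sinks); and the periodic trajectories and polycycles (unions of separatrices $\zeta_\varsigma$ and points $q_j\in\mathfrak{P}\cup\{\infty\}$, homeomorphic to a circle) whose holonomy germ is different from the identity. *)

(* Defs.v *)
(* R^2 is 'rV[R]_2, the sphere S^2 is its one-point compactification, and C   *)
(* is R[i] seen as a normed module over itself, so that [derivable f z 1]     *)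
(* for f : C -> C is complex differentiability at z.                          *)
From mathcomp Require Import all_boot all_order all_algebra.
From mathcomp Require Import all_classical all_reals all_analysis.
From mathcomp Require Import complex.

Set Implicit Arguments.
Unset Strict Implicit.
Unset Printing Implicit Defensive.

Import Order.TTheory GRing.Theory Num.Theory.
Import numFieldNormedType.Exports.

Local Open Scope classical_set_scope.
Local Open Scope ring_scope.

Definition sphere (R : realType) := one_point_compactification 'rV[R]_2.

Definition in_sphere (R : realType) (p : 'rV[R]_2) : sphere R := Some p.

Definition cplx (R : realType) := (R[i])^o.

Definition axis (R : realType) (i : 'I_2) : 'rV[R]_2 := delta_mx 0 i.

Definition xy_of (R : realType) (z : cplx R) : 'rV[R]_2 :=
  complex.Re z *: axis R 0 + complex.Im z *: axis R 1.

Definition z_of (R : realType) (p : 'rV[R]_2) : cplx R := (p 0 0 +i* p 0 1)%C.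

Definition independent (R : realType) (u v : 'rV[R]_2) : bool :=
  row_free (col_mx u v).

(* Class C^n: all iterated directional derivatives of order at most n exist   *)
(* and are continuous at every point of U.  It is applied to open sets U      *)
(* only; the values of f outside of U are then irrelevant.                    *)
Fixpoint Cn_on (R : realType) (V W : normedModType R) (n : nat)
    (U : set V) (f : V -> W) : Prop :=
  (forall x, U x -> {for x, continuous f}) /\
  (if n is m.+1 then
     forall v : V,
       (forall x, U x -> derivable f x v) /\ Cn_on m U (fun x => 'D_v f x)
   else True).

Definition smooth_on (R : realType) (V W : normedModType R)
    (U : set V) (f : V -> W) : Prop :=
  forall n, Cn_on n U f.

Definition homeo_on (T1 T2 : topologicalType) (A : set T1) (B : set T2)
    (f : T1 -> T2) (g : T2 -> T1) : Prop :=
  [/\ {within A, continuous f}, {within B, continuous g}, f @` A = B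
    & forall x, A x -> g (f x) = x].

Definition homeomorphic (T1 T2 : topologicalType) (A : set T1) (B : set T2) :=
  exists f g, homeo_on A B f g.

Definition diffeo_on (R : realType) (A B : set 'rV[R]_2)
    (f g : 'rV[R]_2 -> 'rV[R]_2) : Prop :=
  [/\ open A, open B, smooth_on A f, smooth_on B g &
      f @` A = B /\ forall x, A x -> g (f x) = x].

Definition zeros (R : realType) (S : set 'rV[R]_2) (X : 'rV[R]_2 -> 'rV[R]_2) :
  set 'rV[R]_2 := [set p | ~ S p /\ X p = 0].

Definition singular (R : realType) (S : set 'rV[R]_2)
  (X : 'rV[R]_2 -> 'rV[R]_2) : set 'rV[R]_2 := S `|` zeros S X.

Definition integral_curve (R : realType) (U : set 'rV[R]_2)
    (X : 'rV[R]_2 -> 'rV[R]_2) (I : set R) (c : R -> 'rV[R]_2) : Prop :=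
  [/\ open I, is_interval I, I !=set0 &
      forall t, I t -> U (c t) /\ is_derive t (1 : R) c (X (c t))].

(* Maximal integral curves in U, parametrized by the open interval I. *)
Definition trajectory (R : realType) (U : set 'rV[R]_2)
    (X : 'rV[R]_2 -> 'rV[R]_2) (I : set R) (c : R -> 'rV[R]_2) : Prop :=
  integral_curve U X I c /\
  forall I' c', integral_curve U X I' c' -> I `<=` I' ->
    (forall t, I t -> c' t = c t) -> I' `<=` I.

Definition trajectory_set (R : realType) (U : set 'rV[R]_2)
    (X : 'rV[R]_2 -> 'rV[R]_2) (T : set 'rV[R]_2) : Prop :=
  exists I c, trajectory U X I c /\ T = c @` I.

Definition incomplete_trajectories (R : realType) (U : set 'rV[R]_2)
    (X : 'rV[R]_2 -> 'rV[R]_2) : set (set 'rV[R]_2) :=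
  [set T | exists I c, [/\ trajectory U X I c, I <> setT & T = c @` I]].

Definition locally_finite_in (R : realType) (U : set 'rV[R]_2)
    (F : set (set 'rV[R]_2)) : Prop :=
  forall p, U p -> exists2 N, nbhs p N &
    finite_set [set T | F T /\ T `&` N !=set0].

Definition periodic (R : realType) (I : set R) (c : R -> 'rV[R]_2) : Prop :=
  I = setT /\ exists2 tau : R, 0 < tau & forall t, c (t + tau) = c t.

Definition periodic_trajectory (R : realType) (U : set 'rV[R]_2)
    (X : 'rV[R]_2 -> 'rV[R]_2) (T : set 'rV[R]_2) : Prop :=
  exists I c, [/\ trajectory U X I c, periodic I c & T = c @` I].

Definition omega_limit (R : realType) (I : set R) (c : R -> 'rV[R]_2) :
    set (sphere R) :=
  \bigcap_(s in I)
    closure [set in_sphere (c t) | t in I `&` [set t | s <= t]].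

Definition alpha_limit (R : realType) (I : set R) (c : R -> 'rV[R]_2) :
    set (sphere R) :=
  \bigcap_(s in I)
    closure [set in_sphere (c t) | t in I `&` [set t | t <= s]].

Record chart (R : realType) := Chart {
  cdom : set 'rV[R]_2;
  zcoord : 'rV[R]_2 -> cplx R;
  coord_inv : cplx R -> 'rV[R]_2 }.

(* A local complex coordinate z = x + iy on cdom, compatible with the C^oo    *)
(* structure of R^2: (x, y) is a diffeomorphism from cdom to an open set.     *)
Definition is_chart (R : realType) (U : set 'rV[R]_2) (k : chart R) : Prop :=
  cdom k `<=` U /\
  diffeo_on (cdom k) [set xy_of (zcoord k p) | p in cdom k]
    (fun p => xy_of (zcoord k p)) (fun q => coord_inv k (z_of q)).

(* A complex structure on U, given by a holomorphic atlas. *)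
Definition complex_structure (R : realType) (U : set 'rV[R]_2)
    (J : set (chart R)) : Prop :=
  [/\ open U, (forall k, J k -> is_chart U k),
      (forall p, U p -> exists2 k, J k & cdom k p) &
      forall k l p, J k -> J l -> cdom k p -> cdom l p ->
        derivable (zcoord l \o coord_inv k : cplx R -> cplx R) (zcoord k p) 1].

(* F k is the coefficient f of f d/dz in the coordinate z = zcoord k. *)
Definition analytic_field (R : realType) (J : set (chart R))
    (F : chart R -> cplx R -> cplx R) : Prop :=
  (forall k p, J k -> cdom k p -> derivable (F k) (zcoord k p) 1) /\
  (forall k l p, J k -> J l -> cdom k p -> cdom l p ->
     F l (zcoord l p) =
     'D_1 (zcoord l \o coord_inv k : cplx R -> cplx R) (zcoord k p)
       * F k (zcoord k p)).

(* X = Re(F) = u d/dx + v d/dy wherever F = (u + iv) d/dz; the coordinate     *)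
(* vectors d/dx, d/dy of z = x + iy are the partial derivatives of the        *)
(* inverse of (x, y).                                                         *)
Definition is_real_part (R : realType) (J : set (chart R))
    (F : chart R -> cplx R -> cplx R) (X : 'rV[R]_2 -> 'rV[R]_2) : Prop :=
  forall k p, J k -> cdom k p ->
    let z := zcoord k p in
    let d i := 'D_(axis R i) (fun q => coord_inv k (z_of q)) (xy_of z) in
    X p = complex.Re (F k z) *: d 0 + complex.Im (F k z) *: d 1.

(* From here to [attracting_parabolic_sector], U is meant to be R^2 minus the  *)
(* singular set of X, so every trajectory in U is non-stationary.             *)

Definition filled_by (R : realType) (U : set 'rV[R]_2)
    (X : 'rV[R]_2 -> 'rV[R]_2) (N : set 'rV[R]_2)
    (P : set R -> (R -> 'rV[R]_2) -> Prop) : Prop :=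
  forall p, N p -> exists I c,
    [/\ trajectory U X I c, (c @` I) p, c @` I `<=` N & P I c].

Definition same_limits (R : realType) (I : set R) (c : R -> 'rV[R]_2)
    (I' : set R) (c' : R -> 'rV[R]_2) : Prop :=
  alpha_limit I' c' = alpha_limit I c /\ omega_limit I' c' = omega_limit I c.

(* N is a parallel strip in the sense of Markus and Neumann: N is foliated by *)
(* trajectories as R^2 is by horizontal lines, and the frontier of N in S^2   *)
(* consists of the limit sets of c and of exactly two trajectories having the *)
(* same limit sets as c.                                                      *)
Definition parallel_strip (R : realType) (U : set 'rV[R]_2)
    (X : 'rV[R]_2 -> 'rV[R]_2) (N : set 'rV[R]_2)
    (I : set R) (c : R -> 'rV[R]_2) : Prop :=
  (exists h k : 'rV[R]_2 -> 'rV[R]_2, homeo_on [set: 'rV[R]_2] N h k /\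
     forall y : R,
       trajectory_set U X (h @` [set p : 'rV[R]_2 | p 0 1 = y])) /\
  (exists I1 c1 I2 c2,
     [/\ trajectory U X I1 c1 /\ same_limits I c I1 c1,
         trajectory U X I2 c2 /\ same_limits I c I2 c2,
         c1 @` I1 <> c2 @` I2 &
         closure (@in_sphere R @` N) `\` (@in_sphere R @` N) =
         alpha_limit I c `|` omega_limit I c `|`
         (@in_sphere R @` (c1 @` I1)) `|` (@in_sphere R @` (c2 @` I2))]).

(* The trajectory c has an open neighbourhood filled by trajectories with the *)
(* same topology: all periodic if c is, and otherwise with the same alpha-    *)
(* and omega-limits in S^2 and forming a parallel strip.                      *)
Definition ordinary (R : realType) (U : set 'rV[R]_2)
    (X : 'rV[R]_2 -> 'rV[R]_2) (I : set R) (c : R -> 'rV[R]_2) : Prop :=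
  exists N : set 'rV[R]_2, [/\ open N, N `<=` U, c @` I `<=` N &
    (periodic I c /\ filled_by U X N (@periodic R)) \/
    (~ periodic I c /\ filled_by U X N (same_limits I c) /\
     parallel_strip U X N I c)].

Definition separatrix (R : realType) (U : set 'rV[R]_2)
    (X : 'rV[R]_2 -> 'rV[R]_2) (T : set 'rV[R]_2) : Prop :=
  exists I c, [/\ trajectory U X I c, ~ ordinary U X I c & T = c @` I].

Definition circle (R : realType) : set 'rV[R]_2 :=
  [set p | p 0 0 ^+ 2 + p 0 1 ^+ 2 = 1].

Definition polycycle (R : realType) (U : set 'rV[R]_2)
    (X : 'rV[R]_2 -> 'rV[R]_2) (G : set (sphere R)) : Prop :=
  homeomorphic (@circle R) G /\
  forall z, G z -> (~ (@in_sphere R @` U) z) \/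
    exists T, [/\ separatrix U X T, (@in_sphere R @` T) z
                & @in_sphere R @` T `<=` G].

(* A transversal s to X through the point s 0 of G; the half s(]0, 1[) lies   *)
(* on one side of G.                                                          *)
Definition transversal (R : realType) (U : set 'rV[R]_2)
    (X : 'rV[R]_2 -> 'rV[R]_2) (G : set (sphere R)) (s : R -> 'rV[R]_2) :
    Prop :=
  [/\ smooth_on [set x : R | -1 < x < 1] s,
      (forall x y, -1 < x < 1 -> -1 < y < 1 -> s x = s y -> x = y),
      (forall x, -1 < x < 1 -> U (s x) /\ independent (X (s x)) ('D_1 s x)),
      G (in_sphere (s 0)) &
      forall x, 0 < x < 1 -> ~ G (in_sphere (s x))].

(* h, on ]0, d[, represents the germ at 0 of the one-sided holonomy of G: the *)
(* trajectory c x of s x follows G closely and first returns to the half      *)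
(* transversal s([0, 1[) at time tau x, at the point s (h x).  A periodic     *)
(* trajectory has two one-sided holonomies, whose germs are the restrictions  *)
(* of its Poincare map; a polycycle may have none.                            *)
Definition holonomy (R : realType) (U : set 'rV[R]_2)
    (X : 'rV[R]_2 -> 'rV[R]_2) (G : set (sphere R)) (s : R -> 'rV[R]_2)
    (d : R) (h : R -> R) : Prop :=
  [/\ 0 < d <= 1,
      (forall x, 0 < x < d -> 0 < h x < 1 /\ {for x, continuous h}),
      h x @[x --> 0^'+] --> (0 : R) &
      exists (c : R -> R -> 'rV[R]_2) (tau : R -> R),
        (forall x, 0 < x < d ->
           0 < tau x /\
           (exists I, [/\ trajectory U X I (c x), I 0 & I (tau x)]) /\
           [/\ c x 0 = s x, c x (tau x) = s (h x) &
               forall t y, 0 < t < tau x -> 0 <= y < 1 -> c x t <> s y]) /\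
        (forall N, open N -> G `<=` N ->
           \forall x \near (0 : R)^'+,
             forall t, 0 <= t <= tau x -> N (in_sphere (c x t)))].

Definition nontrivial_holonomy (R : realType) (U : set 'rV[R]_2)
    (X : 'rV[R]_2 -> 'rV[R]_2) (G : set (sphere R)) : Prop :=
  exists s d h, [/\ transversal U X G s, holonomy U X G s d h &
    ~ (\forall x \near (0 : R)^'+, h x = x)].

Definition closed_sector (R : realType) : set 'rV[R]_2 :=
  [set p | [/\ 0 <= p 0 0, 0 <= p 0 1 & p 0 0 ^+ 2 + p 0 1 ^+ 2 <= 1]].

(* A closed sector with vertex q, topologically equivalent to a sector of the *)
(* inward radial field: its radii are positive half-trajectories tending to q.*)
Definition attracting_parabolic_sector (R : realType) (U : set 'rV[R]_2)
    (X : 'rV[R]_2 -> 'rV[R]_2) (q : 'rV[R]_2) : Prop :=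
  exists h k : 'rV[R]_2 -> 'rV[R]_2,
  [/\ homeo_on (@closed_sector R) (h @` @closed_sector R) h k,
    h 0 = q &
    forall u, closed_sector u -> circle u ->
      exists (I : set R) c, [/\ trajectory U X I c, I 0, c 0 = h u,
        c @` (I `&` [set t | 0 <= t]) =
          [set h (r *: u) | r in [set r : R | 0 < r <= 1]] &
        forall N, nbhs q N -> exists2 t0, I t0 &
          forall t, I t -> t0 <= t -> N (c t)]].

Definition parabolic_sector (R : realType) (U : set 'rV[R]_2)
    (X : 'rV[R]_2 -> 'rV[R]_2) (q : 'rV[R]_2) : Prop :=
  attracting_parabolic_sector U X q \/
  attracting_parabolic_sector U (fun p => - X p) q.

(* The trace on R^2 of the union of all attractors of X (polycycles may pass  *)
(* through the point at infinity).                                            *)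
Definition attractors (R : realType) (S : set 'rV[R]_2)
    (X : 'rV[R]_2 -> 'rV[R]_2) : set 'rV[R]_2 :=
  let U := ~` singular S X in
  [set q | singular S X q /\ parabolic_sector U X q] `|`
  [set p | exists T, [/\ periodic_trajectory U X T,
             nontrivial_holonomy U X (@in_sphere R @` T) & T p]] `|`
  [set p | exists G, [/\ polycycle U X G, nontrivial_holonomy U X G
                       & G (in_sphere p)]].

Definition riemannian_metric (R : realType) (D : set 'rV[R]_2)
    (g : 'rV[R]_2 -> 'M[R]_2) : Prop :=
  [/\ open D, smooth_on D g,
      (forall p, D p -> (g p)^T = g p) &
      forall p (v : 'rV[R]_2), D p -> v != 0 -> 0 < (v *m g p *m v^T) 0 0].

(* Flat: locally isometric to the Euclidean plane. *)
Definition flat_metric (R : realType) (D : set 'rV[R]_2)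
    (g : 'rV[R]_2 -> 'M[R]_2) : Prop :=
  forall p, D p -> exists (W W' : set 'rV[R]_2) (f f' : 'rV[R]_2 -> 'rV[R]_2),
    [/\ W p, W `<=` D, diffeo_on W W' f f' &
        forall x u v, W x -> u *m g x *m v^T = 'D_u f x *m ('D_v f x)^T].

Definition christoffel (R : realType) (g : 'rV[R]_2 -> 'M[R]_2)
    (p : 'rV[R]_2) (k i j : 'I_2) : R :=
  2^-1 * \sum_(l < 2) invmx (g p) k l *
    ('D_(axis R i) (fun q => g q j l) p + 'D_(axis R j) (fun q => g q i l) p
     - 'D_(axis R l) (fun q => g q i j) p).

(* The Levi-Civita covariant derivative of Y in the direction X. *)
Definition covariant_derivative (R : realType) (g : 'rV[R]_2 -> 'M[R]_2)
    (X Y : 'rV[R]_2 -> 'rV[R]_2) (p : 'rV[R]_2) : 'rV[R]_2 :=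
  'D_(X p) Y p +
  \row_(k < 2) \sum_(i < 2) \sum_(j < 2)
     christoffel g p k i j * X p 0 i * Y p 0 j.

Definition geodesic_field (R : realType) (D : set 'rV[R]_2)
    (g : 'rV[R]_2 -> 'M[R]_2) (X : 'rV[R]_2 -> 'rV[R]_2) : Prop :=
  forall p, D p -> covariant_derivative g X X p = 0.

Definition local_action (R : realType) (D : set 'rV[R]_2)
    (Om : set ('rV[R]_2 * 'rV[R]_2)) (Phi : 'rV[R]_2 * 'rV[R]_2 -> 'rV[R]_2) :
    Prop :=
  [/\ open Om /\ smooth_on Om Phi,
      (forall t p, Om (t, p) -> D p /\ D (Phi (t, p))),
      (forall p, D p -> Om (0, p) /\ Phi (0, p) = p),
      (forall s t p, Om (t, p) -> Om (s, Phi (t, p)) -> Om (s + t, p) ->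
         Phi (s, Phi (t, p)) = Phi (s + t, p)) &
      (forall t p, Om (t, p) ->
         Om (- t, Phi (t, p)) /\ Phi (- t, Phi (t, p)) = p)].

Definition generator (R : realType)
    (Phi : 'rV[R]_2 * 'rV[R]_2 -> 'rV[R]_2) (v : 'rV[R]_2) (p : 'rV[R]_2) :
    'rV[R]_2 :=
  'D_1 (fun t : R => Phi (t *: v, p)) 0.

(* Main.v *)
From HB Require Import structures.
Require Import Defs.
From mathcomp Require Import all_boot all_order all_algebra.
From mathcomp Require Import all_classical all_reals all_analysis.
From mathcomp Require Import complex.
From mathcomp Require Import ring lra.

Set Implicit Arguments.
Unset Strict Implicit.
Unset Printing Implicit Defensive.

Import Order.TTheory GRing.Theory Num.Theory.
Import numFieldNormedType.Exports.

Local Open Scope classical_set_scope.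
Local Open Scope ring_scope.

(** Write U for the plane minus the singular set of X.

    On U the field X does not vanish, and it is the first row of a smooth frame M
    whose second row is Re (i F) (flat_frame): the image of the complex number F
    under multiplication by i is another real field, defined independently of the
    chart by the rule of change of coordinates of a holomorphic field.  A primitive
    of dz/F, the complex time, is a local coordinate system in which the frame
    becomes the coordinate frame of R^2.  It exists because the real and imaginary
    parts of dz/F are closed forms, by the Cauchy-Riemann equations
    (closed_form_exact, time_coordinate), and it is a local diffeomorphism by the
    inverse function theorem (local_inverse, chart_flat_box).  Such a coordinate
    system is called a flat box; two flat boxes differ locally by a translation.

    Both parts follow on U.  The metric for which M is orthonormal is the pullback
    of the Euclidean metric by the flat boxes, hence is flat, and X, being constant
    in the boxes, is geodesic (frame_metric_flat, frame_metric_geodesic).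
    Translations in the flat boxes are the local action of (R^2, +)
    (flow_local_action); its domain consists of the pairs (w, p) such that p and
    p + w both lie deep inside a common box, so that the composition law can be
    checked inside a single box.

    It remains to see that no point of U lies on an attractor.  Points with a
    parabolic sector are singular by definition, and the holonomy germs of periodic
    trajectories and polycycles are all trivial (holonomy_trivial).  Indeed the
    coframe component omega that vanishes on X is closed and nonzero on a
    transversal s, so its integral sigma is an injective coordinate on s
    (transverse_coordinate).  A trajectory starting near s x0 is a translate of the
    trajectory of s x0, by a vector whose second coordinate is the difference of
    sigma; it meets s again with the same difference
    (first_return_locally_constant).  Thus sigma (h x) - sigma x is locally
    constant in x for the first return map h, and it tends to 0 with x: it is zero,
    and h x = x. *)

(** * Calculus along lines *)

Lemma rV2E (R : realType) (v : 'rV[R]_2) :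
  v = v 0 0 *: axis R 0 + v 0 1 *: axis R 1.
Proof.
rewrite {1}(row_sum_delta v) big_ord_recl big_ord1 /axis.
by congr (_ *: delta_mx _ _ + v 0 _ *: delta_mx _ _); apply/val_inj.
Qed.

Lemma row2P (R : realType) (v w : 'rV[R]_2) :
  v 0 0 = w 0 0 -> v 0 1 = w 0 1 -> v = w.
Proof. by move=> h0 h1; rewrite (rV2E v) (rV2E w) h0 h1. Qed.

Lemma forall_ord2 (P : 'I_2 -> Prop) : P 0 -> P 1 -> forall i, P i.
Proof.
move=> P0 P1 i; have [->//|->//] : i = 0 \/ i = 1.
by case: i => -[|[|//]] h; [left|right]; apply/val_inj.
Qed.

Lemma axisE (R : realType) (i j : 'I_2) : axis R i 0 j = (i == j)%:R.
Proof. by rewrite mxE eqxx /= eq_sym. Qed.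

Lemma ler_mx_entry (R : realType) m n (v : 'M[R]_(m, n)) i j :
  `|v i j| <= `|v|.
Proof.
rewrite [leRHS]/Num.Def.normr/= mx_normrE.
exact: (le_bigmax _ (fun k => `|v k.1 k.2|) (i, j)).
Qed.

Lemma mx_norm_le (R : realType) m n (v : 'M[R]_(m, n)) (e : R) :
  0 <= e -> (forall i j, `|v i j| <= e) -> `|v| <= e.
Proof.
by move=> e0 h; rewrite [leLHS]/Num.Def.normr/= mx_normrE; apply: bigmax_le => // -[].
Qed.

Lemma mx_norm_lt (R : realType) m n (v : 'M[R]_(m, n)) (e : R) :
  0 < e -> (forall i j, `|v i j| < e) -> `|v| < e.
Proof.
by move=> e0 h; rewrite [ltLHS]/Num.Def.normr/= mx_normrE; apply/bigmax_ltP; split=> // -[].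
Qed.

Lemma ball_rV2P (R : realType) (c x : 'rV[R]_2) (r : R) : 0 < r ->
  ball c r x <-> `|c 0 0 - x 0 0| < r /\ `|c 0 1 - x 0 1| < r.
Proof.
move=> r0; rewrite -ball_normE /ball_ /=; split.
  move=> h; split; apply: le_lt_trans h; have := ler_mx_entry (c - x) 0.
    by move=> /(_ 0); rewrite !mxE.
  by move=> /(_ 1); rewrite !mxE.
move=> [h0 h1]; apply: mx_norm_lt => // i j; rewrite ord1 !mxE.
by move: j; apply: forall_ord2.
Qed.

(** Restriction of a function to a line. *)
Lemma is_derive_line (R : realType) (V W : normedModType R) (f : V -> W)
    (x v : V) (l : W) (t : R) :
  is_derive (t *: v + x) v f l <->
  is_derive t (1 : R) (fun h : R => f (h *: v + x)) l.
Proof.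
have E : (fun h : R => h^-1 *: ((f \o shift (t *: v + x)) (h *: v) - f (t *: v + x)))
  = (fun h : R => h^-1 *: (((fun h0 : R => f (h0 *: v + x)) \o shift t) (h *: (1:R))
       - f (t *: v + x))).
  apply/funext => h /=; congr (_ *: (f _ - _)).
  by rewrite [h *: 1]mulr1 scalerDl addrA.
by split=> -[hd hv]; split; rewrite /derivable /derive ?E in hd hv *.
Qed.

Lemma is_derive_comp (R : realType) (V U W : normedModType R) (g : U -> W)
    (k : V -> U) (x v : V) (l : U) :
  is_derive x v k l -> differentiable g (k x) ->
  is_derive x v (g \o k) ('d g (k x) l).
Proof.
move=> kl dg; rewrite -[x]add0r -(scale0r v); apply/is_derive_line.
move: kl; rewrite -{1}[x]add0r -{1}(scale0r v) => /is_derive_line kl.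
have dk : differentiable (fun h : R => k (h *: v + x)) 0.
  by apply/derivable1_diffP; case: kl.
have e0 : k (0 *: v + x) = k x by rewrite scale0r add0r.
have dg' : differentiable g (k (0 *: v + x)) by rewrite e0.
have dgk : differentiable (g \o (fun h : R => k (h *: v + x))) 0.
  exact: differentiable_comp.
apply: DeriveDef; first exact/derivable1_diffP.
rewrite deriveE //.
rewrite (diff_comp dk dg') /= e0; congr ('d g _ _).
by rewrite -deriveE //; case: kl.
Qed.

Lemma is_derive_val (R : numFieldType) (V W : normedModType R)
  (f : V -> W) x v l : is_derive x v f l -> 'D_v f x = l.
Proof. by case. Qed.

Lemma is_derive_near (R : realType) (V W : normedModType R) (f g : V -> W)
    (x v : V) (l : W) :
  (\forall y \near x, f y = g y) -> is_derive x v f l -> is_derive x v g l.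
Proof.
move=> fg [df vf].
have nE : \forall h \near (0 : R)^',
    h^-1 *: ((f \o shift x) (h *: v) - f x) =
    h^-1 *: ((g \o shift x) (h *: v) - g x).
  have fgx := nbhs_singleton fg.
  have : \forall h \near (0 : R), f (h *: v + x) = g (h *: v + x).
    have : (h *: v + x) @[h --> (0 : R)] --> x.
      rewrite -[X in _ --> X]add0r -[X in _ --> X + _](scale0r v).
      by apply: cvgD; [apply: cvgZr_tmp; exact: cvg_id|exact: cvg_cst].
    by move=> /(_ _ fg).
  move=> h0; apply: nbhs_dnbhs; apply: filterS h0 => h /= ->.
  by rewrite fgx.
have cv := (cvg_trans (near_eq_cvg nE)).
have cvf : (fun h : R => h^-1 *: ((f \o shift x) (h *: v) - f x)) @ 0^' --> l.
  by rewrite -vf.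
have cvg : (fun h : R => h^-1 *: ((g \o shift x) (h *: v) - g x)) @ 0^' --> l.
  apply: cvg_trans cvf; apply: near_eq_cvg.
  by apply: filterS nE => h ->.
by split; [apply/cvg_ex; exists l|apply/cvg_lim].
Qed.

(** The mean value theorem along a segment of a line. *)
Lemma line_MVT (R : realType) (V : normedModType R) (f : V -> R) (df : V -> R)
    (x v : V) (t : R) :
  (forall s : R, 0 <= s <= 1 -> is_derive (s * t *: v + x) v f (df (s * t *: v + x))) ->
  exists2 s : R, 0 <= s <= 1 & f (t *: v + x) - f x = t * df (s * t *: v + x).
Proof.
move=> h.
have hd (s : R) : s \in `[0, 1]%R -> is_derive s (1 : R)
    (fun s : R => f (s *: (t *: v) + x)) (t * df (s * t *: v + x)).
  rewrite in_itv /= => s01.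
  have /is_derive_line hs := h s s01.
  have -> : (fun h0 : R => f (h0 *: (t *: v) + x)) =
     (fun h0 : R => f (h0 *: v + x)) \o (fun s : R => s * t).
    by apply/funext => a /=; rewrite scalerA.
  have dd : is_derive s (1 : R) (fun s : R => s * t) t.
    have -> : (fun s : R => s * t) = t \*: id.
      by apply/funext => a; rewrite /= mulrC.
    by apply: is_derive_eq; rewrite [LHS]mulr1.
  have df1 : differentiable (fun h0 : R => f (h0 *: v + x)) (s * t).
    by apply/derivable1_diffP; case: hs.
  have := is_derive_comp dd df1; rewrite diff1E // derive1E.
  by case: hs => _ ->.
pose g (s : R) := f (s *: (t *: v) + x); pose dg (s : R) := t * df (s * t *: v + x).
have hoo (s : R) : s \in `]0, 1[%R -> is_derive s (1 : R) g (dg s).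
  by move=> s01; apply: hd; apply: subset_itv_oo_cc.
have gc : {within `[(0:R), 1], continuous g}.
  by apply: derivable_within_continuous => s s01; have [] := hd _ s01.
have [s s01] := MVT_segment (@ler01 R) hoo gc; rewrite /g /dg => E.
exists s; first by move: s01; rewrite in_itv.
by move: E; rewrite scale0r scale1r add0r subr0 mulr1.
Qed.

Lemma near_ball (R : realType) (V : normedModType R) (x : V) (P : set V) :
  nbhs x P -> exists2 r : R, 0 < r & forall y, ball x r y -> P y.
Proof. by move=> /nbhs_ballP[r r0 h]; exists r. Qed.

Lemma near0_norm (R : realType) (V : normedModType R) (P : set V) (r : R) :
  0 < r -> (forall h, `|h| < r -> P h) -> nbhs (0 : V) P.
Proof.
move=> r0 hP; apply/nbhs_ballP; exists r => //= h.
by rewrite -ball_normE /= sub0r normrN; exact: hP.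
Qed.

Lemma continuous_ball (R : realType) (V W : normedModType R) (f : V -> W) x :
  {for x, continuous f} ->
  forall e : R, 0 < e -> \forall y \near x, `|f y - f x| < e.
Proof.
move=> cf e e0; have /cvgrPdist_lt/(_ e e0) := cf.
by apply: filterS => y; rewrite distrC.
Qed.

Lemma ball_continuous (R : realType) (V W : normedModType R) (f : V -> W) x :
  (forall e : R, 0 < e -> \forall y \near x, `|f y - f x| <= e) ->
  {for x, continuous f}.
Proof.
move=> h; apply/cvgrPdist_le => e e0.
by apply: filterS (h e e0) => y; rewrite distrC.
Qed.

(** Differentiability, from a linear approximation with an explicit error. *)
Lemma linear_approx_differentiable (R : realType) (V W : normedModType R)
    (f : V -> W) (L : {linear V -> W}) (x : V) :
  continuous (L : V -> W) ->
  (forall e : R, 0 < e ->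
     \forall h \near (0 : V), `|f (h + x) - f x - L h| <= e * `|h|) ->
  differentiable f x /\ 'd f x = L :> (V -> W).
Proof.
move=> Lc h.
suff E : f \o shift x = cst (f x) + L +o_ 0 id.
  have dL := diff_unique Lc E; split=> //.
  by apply/diff_locallyP; rewrite dL.
apply/eqaddoP => e e0; apply: filterS (h e e0) => y.
by rewrite -[_ - _ - _]addrA -opprD.
Qed.

(** A real function with continuous partial derivatives is differentiable. *)
Lemma partials_differentiable (R : realType) (f : 'rV[R]_2 -> R)
    (D : 'I_2 -> 'rV[R]_2 -> R) (x : 'rV[R]_2) :
  (\forall y \near x, forall i, is_derive y (axis R i) f (D i y)) ->
  (forall i, {for x, continuous (D i)}) ->
  differentiable f x.
Proof.
move=> df cdf.
pose l (v : 'rV[R]_2) : R := v 0 0 * D 0 x + v 0 1 * D 1 x.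
have llin : linear l.
  move=> a u v; rewrite /l ![((_ + _) : 'rV__) _ _]mxE ![((_ *: _) : 'rV__) _ _]mxE.
   rewrite [a *: (_ : R)]mulrDr.
  by rewrite !mulrDl !mulrA addrACA.
pose L : {linear 'rV[R]_2 -> R} := HB.pack l (GRing.isLinear.Build _ _ _ _ _ llin).
have Lc : continuous (l : 'rV[R]_2 -> R).
  move=> y; apply: (@continuousD _ _ 'rV[R]_2); apply: (@continuousM _ 'rV[R]_2);
  by [exact: coord_continuous|exact: cst_continuous].
have [] // := @linear_approx_differentiable R _ R f L x Lc.
move=> e e0.
have e2 : 0 < e / 2 by rewrite divr_gt0.
have [r r0 hr] : exists2 r, 0 < r & forall y, ball x r y ->
   (forall i, is_derive y (axis R i) f (D i y)) /\
   (forall i, `|D i y - D i x| <= e / 2).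
  have c0 := continuous_ball (cdf 0) e2.
  have c1 := continuous_ball (cdf 1) e2.
  have [r r0 hr] := near_ball (filterI df (filterI c0 c1)).
  exists r => // y /hr[h1 [/ltW h2 /ltW h3]]; split=> //.
  by apply: forall_ord2.
apply: (near0_norm r0) => h hr0.
(* From x to h + x, along the first axis and then along the second. *)
set a := h 0 0; set b := h 0 1.
have ha : `|a| <= `|h| := ler_mx_entry h 0 0.
have hb : `|b| <= `|h| := ler_mx_entry h 0 1.
have inb (s t : R) : `|s| <= `|h| -> `|t| <= `|h| ->
   ball x r (s *: axis R 0 + t *: axis R 1 + x).
  move=> hs ht; rewrite addrC -ball_normE /= opprD addNKr normrN.
  apply: le_lt_trans hr0; apply: mx_norm_le => // i j; rewrite ord1.
  by move: j; apply: forall_ord2; rewrite !mxE /= ?mulr1 ?mulr0 ?addr0 ?add0r.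
have scl (s t : R) : 0 <= s <= 1 -> `|t| <= `|h| -> `|s * t| <= `|h|.
  move=> /andP[s0 s1] ht; apply: le_trans ht; rewrite normrM ger0_norm //.
  by rewrite ler_piMl.
have [s s01 Ea] : exists2 s : R, 0 <= s <= 1 &
   f (a *: axis R 0 + x) - f x = a * D 0 (s * a *: axis R 0 + x).
  apply: (@line_MVT _ _ f (D 0)) => s s01.
  have := inb (s * a) 0 (scl _ _ s01 ha); rewrite normr0 normr_ge0 scale0r addr0.
  by move=> /(_ isT) /hr[].
have [t t01 Eb] : exists2 t : R, 0 <= t <= 1 &
   f (b *: axis R 1 + (a *: axis R 0 + x)) - f (a *: axis R 0 + x)
   = b * D 1 (t * b *: axis R 1 + (a *: axis R 0 + x)).
  apply: (@line_MVT _ _ f (D 1)) => t t01.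
  have := inb a (t * b) ha (scl _ _ t01 hb); rewrite addrCA addrA.
  by move=> /hr[].
have b1 := (hr _ (inb (s * a) 0 (scl _ _ s01 ha) _)).2 0.
have b2 := (hr _ (inb a (t * b) ha (scl _ _ t01 hb))).2 1.
rewrite normr0 normr_ge0 scale0r addr0 in b1; have {}b1 := b1 isT.
rewrite -addrA addrCA in b2.
have -> : f (h + x) - f x - L h =
  a * (D 0 (s * a *: axis R 0 + x) - D 0 x) +
  b * (D 1 (t * b *: axis R 1 + (a *: axis R 0 + x)) - D 1 x).
  rewrite !mulrBr -Ea -Eb addrACA -opprD.
  rewrite -[L h]/(l h) /l -/a -/b.
  have -> : h + x = b *: axis R 1 + (a *: axis R 0 + x).
    by rewrite addrA [_ + a *: _]addrC -rV2E.
  by ring.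
apply: (le_trans (ler_normD _ _)); rewrite !normrM.
apply: (@le_trans _ _ (`|h| * (e / 2) + `|h| * (e / 2))).
  by apply: lerD; apply: ler_pM.
by rewrite -mulrDr -splitr mulrC.
Qed.

(** * Maps of class C^n *)

Lemma Cn_ext (R : realType) (V W : normedModType R) n (U : set V) (f g : V -> W) :
  open U -> (forall x, U x -> f x = g x) -> Cn_on n U f -> Cn_on n U g.
Proof.
move=> oU; elim: n f g => [|n IH] f g fg; rewrite /=.
  move=> [cf _]; split=> // x Ux; have cfx := cf x Ux.
  apply: cvg_trans; last by rewrite -(fg x Ux); exact: cfx.
  apply: near_eq_cvg; apply: filterS (open_nbhs_nbhs (conj oU Ux)) => y Uy.
  by rewrite fg.
have nfg x : U x -> \forall y \near x, f y = g y.
  by move=> Ux; apply: filterS (open_nbhs_nbhs (conj oU Ux)) => y; exact: fg.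
move=> [cf df]; split.
  move=> x Ux; have cfx := cf x Ux.
  apply: cvg_trans; last by rewrite -(fg x Ux); exact: cfx.
  by apply: near_eq_cvg; apply: filterS (nfg x Ux) => y ->.
move=> v; have [dfv Cfv] := df v.
have dE x : U x -> is_derive x v g ('D_v f x).
  by move=> Ux; apply: is_derive_near (nfg x Ux) _; apply: derivableP; exact: dfv.
split; first by move=> x /dE[].
by apply: IH Cfv => x /dE[].
Qed.

Lemma Cn_continuous (R : realType) (V W : normedModType R) n (U : set V)
  (f : V -> W) x : Cn_on n U f -> U x -> {for x, continuous f}.
Proof. by case: n => [|n] [+ _] => /[apply]. Qed.

Lemma Cn_is_derive (R : realType) (V W : normedModType R) n (U : set V)
  (f : V -> W) x v : Cn_on n.+1 U f -> U x -> is_derive x v f ('D_v f x).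
Proof. by move=> [_ /(_ v)[d _]] Ux; apply: derivableP; exact: d. Qed.

Lemma Cn_derive (R : realType) (V W : normedModType R) n (U : set V)
  (f : V -> W) v : Cn_on n.+1 U f -> Cn_on n U ('D_v f).
Proof. by move=> [_ /(_ v)[]]. Qed.

(** Introduction rule: the directional derivatives may be given by formulas that
    are only valid on U. *)
Lemma Cn_intro (R : realType) (V W : normedModType R) n (U : set V)
    (f : V -> W) (g : V -> V -> W) :
  open U -> (forall x, U x -> {for x, continuous f}) ->
  (forall v x, U x -> is_derive x v f (g v x)) ->
  (forall v, Cn_on n U (g v)) -> Cn_on n.+1 U f.
Proof.
move=> oU cf df dg; split=> // v; split; first by move=> x /(df v)[].
by apply: Cn_ext (dg v) => // x /(df v)[].
Qed.

Lemma Cn_le (R : realType) (V W : normedModType R) m n (U : set V) (f : V -> W) :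
  (m <= n)%N -> Cn_on n U f -> Cn_on m U f.
Proof.
elim: m n f => [|m IH] [|n] // f mn; first by move=> [].
move=> [cf df]; split=> // v; have [d1 d2] := df v; split=> //.
exact: IH d2.
Qed.

Lemma Cn_sub (R : realType) (V W : normedModType R) n (U U' : set V) (f : V -> W) :
  U' `<=` U -> Cn_on n U f -> Cn_on n U' f.
Proof.
move=> UU; elim: n f => [|n IH] f [cf df]; split=> //.
- by move=> x /UU; exact: cf.
- by move=> x /UU; exact: cf.
- move=> v; have [d1 d2] := df v; split; last exact: IH.
  by move=> x /UU; exact: d1.
Qed.

Lemma Cn_local (R : realType) (V W : normedModType R) n (U : set V) (f : V -> W) :
  (forall x, U x -> exists2 N : set V, N x & Cn_on n N f) -> Cn_on n U f.
Proof.
elim: n f => [|n IH] f h; split=> //.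
- by move=> x /h[N Nx /(Cn_continuous (x := x))]; exact.
- by move=> x /h[N Nx /(Cn_continuous (x := x))]; exact.
- move=> v; split; first by move=> x /h[N Nx /(Cn_is_derive v) /(_ Nx) []].
  by apply: IH => x /h[N Nx /(Cn_derive v)]; exists N.
Qed.

Lemma Cn_cst (R : realType) (V W : normedModType R) n (U : set V) (c : W) :
  open U -> Cn_on n U (fun _ : V => c).
Proof.
move=> oU; elim: n c => [|n IH] c.
  by split=> // x _; exact: cst_continuous.
apply: (@Cn_intro _ _ _ n U _ (fun _ _ => 0)) => //.
by move=> x _; exact: cst_continuous.
Qed.

Lemma Cn_linear (R : realType) (V W : normedModType R) n (U : set V)
    (L : {linear V -> W}) :
  open U -> continuous (L : V -> W) -> Cn_on n U L.
Proof.
move=> oU cL; case: n => [|n]; first by split=> // x _; exact: cL.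
apply: (@Cn_intro _ _ _ n U _ (fun v _ => L v)) => //.
- by move=> x _; exact: cL.
- move=> v x _; have dL : differentiable L x by exact: linear_differentiable.
  apply: DeriveDef; first exact: diff_derivable.
  by rewrite deriveE // diff_lin.
- by move=> v; exact: Cn_cst.
Qed.

Lemma Cn_add (R : realType) (V W : normedModType R) n (U : set V) (f g : V -> W) :
  open U -> Cn_on n U f -> Cn_on n U g -> Cn_on n U (fun x => f x + g x).
Proof.
move=> oU; elim: n f g => [|n IH] f g Cf Cg.
  split=> // x Ux; apply: continuousD.
    exact: Cn_continuous Cf Ux.
  exact: Cn_continuous Cg Ux.
apply: (@Cn_intro _ _ _ n U _ (fun v x => 'D_v f x + 'D_v g x)) => //.
- move=> x Ux; apply: continuousD.
    exact: Cn_continuous Cf Ux.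
  exact: Cn_continuous Cg Ux.
- move=> v x Ux; apply: is_deriveD.
    exact: Cn_is_derive Cf Ux.
  exact: Cn_is_derive Cg Ux.
- by move=> v; apply: IH; exact: Cn_derive.
Qed.

Lemma Cn_minus (R : realType) (V W : normedModType R) n (U : set V) (f g : V -> W) :
  open U -> Cn_on n U f -> Cn_on n U g -> Cn_on n U (fun x => f x - g x).
Proof.
move=> oU; elim: n f g => [|n IH] f g Cf Cg.
  split=> // x Ux; apply: continuousB.
    exact: Cn_continuous Cf Ux.
  exact: Cn_continuous Cg Ux.
apply: (@Cn_intro _ _ _ n U _ (fun v x => 'D_v f x - 'D_v g x)) => //.
- move=> x Ux; apply: continuousB.
    exact: Cn_continuous Cf Ux.
  exact: Cn_continuous Cg Ux.
- move=> v x Ux; apply: is_deriveB.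
    exact: Cn_is_derive Cf Ux.
  exact: Cn_is_derive Cg Ux.
- by move=> v; apply: IH; exact: Cn_derive.
Qed.

Lemma Cn_id (R : realType) (V : normedModType R) n (U : set V) :
  open U -> Cn_on n U (fun x : V => x).
Proof. by move=> oU; apply: (@Cn_linear _ _ _ n U idfun) => // x; exact: cvg_id. Qed.

Lemma Cn_mul (R : realType) (V : normedModType R) n (U : set V) (f g : V -> R) :
  open U -> Cn_on n U f -> Cn_on n U g -> Cn_on n U (fun x => f x * g x).
Proof.
move=> oU; elim: n f g => [|n IH] f g Cf Cg.
  split=> // x Ux; apply: continuousM.
    exact: Cn_continuous Cf Ux.
  exact: Cn_continuous Cg Ux.
apply: (@Cn_intro _ _ _ n U _ (fun v x => f x * 'D_v g x + g x * 'D_v f x)) => //.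
- move=> x Ux; apply: continuousM.
    exact: Cn_continuous Cf Ux.
  exact: Cn_continuous Cg Ux.
- move=> v x Ux; apply: is_deriveM.
    exact: Cn_is_derive Cf Ux.
  exact: Cn_is_derive Cg Ux.
- by move=> v; apply: Cn_add => //; apply: IH; (exact: Cn_derive || exact: Cn_le (leqnSn n) _).
Qed.

Lemma Cn_opp (R : realType) (V : normedModType R) n (U : set V) (f : V -> R) :
  open U -> Cn_on n U f -> Cn_on n U (fun x => - f x).
Proof.
move=> oU Cf; apply: Cn_ext (Cn_minus oU (Cn_cst n 0 oU) Cf) => // x _.
by rewrite sub0r.
Qed.

Lemma Cn_inv (R : realType) (V : normedModType R) n (U : set V) (f : V -> R) :
  open U -> (forall x, U x -> f x != 0) -> Cn_on n U f ->
  Cn_on n U (fun x => (f x)^-1).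
Proof.
move=> oU f0; elim: n => [|n IH] Cf.
  by split=> // x Ux; apply: continuousV; [exact: f0|exact: Cn_continuous Cf Ux].
have CV := IH (Cn_le (leqnSn n) Cf).
apply: (@Cn_intro _ _ _ n U _ (fun v x => - ((f x)^-1 * (f x)^-1 * 'D_v f x))) => //.
- by move=> x Ux; apply: continuousV; [exact: f0|exact: Cn_continuous Cf Ux].
- move=> v x Ux; have [d _] := Cn_is_derive v Cf Ux.
  apply: DeriveDef; first by apply: derivableV => //; exact: f0.
  by rewrite deriveV ?f0 // -mulNr [LHS]mulNr expr2 invfM mulNr.
- move=> v; apply: Cn_opp => //; apply: Cn_mul => //; last exact: Cn_derive.
  exact: Cn_mul.
Qed.

Lemma Cn_mxP (R : realType) (V : normedModType R) p q n (U : set V)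
    (M : V -> 'M[R]_(p, q)) : open U ->
  Cn_on n U M <-> forall i j, Cn_on n U (fun x => M x i j : R).
Proof.
move=> oU; elim: n M => [|n IH] M; split.
- move=> [cM _] i j; split=> // x Ux.
  apply: (@continuous_comp V 'M[R]_(p, q) R M (fun N => N i j)); first exact: cM.
  exact: coord_continuous.
- move=> h; split=> // x Ux; apply: ball_continuous => e e0.
  have : \forall y \near x, forall ij : 'I_p * 'I_q, `|M y ij.1 ij.2 - M x ij.1 ij.2| < e.
    apply: filter_forall => ij.
    exact: (continuous_ball (Cn_continuous (h ij.1 ij.2) Ux) e0).
  apply: filterS => y hy; apply: mx_norm_le => [|i j]; first exact: ltW.
  by rewrite !mxE ltW //; exact: (hy (i, j)).
- move=> CM i j.
  apply: (@Cn_intro _ _ _ n U _ (fun v x => 'D_v M x i j)) => //.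
  + move=> x Ux; apply: (@continuous_comp V 'M[R]_(p, q) R M (fun N => N i j)).
      exact: (Cn_continuous CM Ux).
    exact: coord_continuous.
  + move=> v x Ux; have [dM _] := Cn_is_derive v CM Ux.
    apply: DeriveDef; first exact: (derivable_mxP _ _ _).1.
    by rewrite (derive_mx dM) mxE.
  + by move=> v; apply: (IH _).1; exact: Cn_derive.
- move=> h.
  have dM v x : U x -> derivable M x v.
    move=> Ux; apply: (derivable_mxP _ _ _).2 => i j.
    by have [] := Cn_is_derive v (h i j) Ux.
  split; first by move=> x; apply: Cn_continuous; apply: (IH M).2 => i j; exact: Cn_le (h i j).
  move=> v; split; first by move=> x; exact: dM.
  apply: (IH _).2 => i j.
  apply: (@Cn_ext _ _ _ n U ('D_v (fun x => M x i j))) => //.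
    by move=> x Ux; rewrite (derive_mx (dM v x Ux)) mxE.
  exact: Cn_derive.
Qed.

Lemma Cn_sum (R : realType) (V : normedModType R) k n (U : set V)
    (f : 'I_k -> V -> R) :
  open U -> (forall i, Cn_on n U (f i)) -> Cn_on n U (fun x => \sum_(i < k) f i x).
Proof.
move=> oU h; elim: k f h => [|k IH] f h.
  apply: (@Cn_ext _ _ _ n U (fun=> 0)) => //; last exact: Cn_cst.
  by move=> x _; rewrite big_ord0.
apply: (@Cn_ext _ _ _ n U (fun x => \sum_(i < k) f (widen_ord (leqnSn k) i) x + f ord_max x)) => //.
  by move=> x _; rewrite big_ord_recr.
by apply: Cn_add => //; exact: IH.
Qed.

Lemma Cn_mulmx (R : realType) (V : normedModType R) a b c n (U : set V)
    (A : V -> 'M[R]_(a, b)) (B : V -> 'M[R]_(b, c)) :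
  open U -> Cn_on n U A -> Cn_on n U B -> Cn_on n U (fun x => A x *m B x).
Proof.
move=> oU /(Cn_mxP _ _ oU) CA /(Cn_mxP _ _ oU) CB; apply/Cn_mxP => // i j.
apply: (@Cn_ext _ _ _ n U (fun x => \sum_k A x i k * B x k j)) => //.
  by move=> x _; rewrite mxE.
by apply: Cn_sum => // k; exact: Cn_mul.
Qed.

Lemma Cn_scale (R : realType) (V : normedModType R) a b n (U : set V)
    (k : V -> R) (A : V -> 'M[R]_(a, b)) :
  open U -> Cn_on n U k -> Cn_on n U A -> Cn_on n U (fun x => k x *: A x).
Proof.
move=> oU Ck /(Cn_mxP _ _ oU) CA; apply/Cn_mxP => // i j.
apply: (@Cn_ext _ _ _ n U (fun x => k x * A x i j)) => //.
  by move=> x _; rewrite mxE.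
exact: Cn_mul.
Qed.

Lemma C1_differentiable_real (R : realType) (U : set 'rV[R]_2) (f : 'rV[R]_2 -> R) x :
  open U -> Cn_on 1 U f -> U x -> differentiable f x.
Proof.
move=> oU Cf Ux; apply: (@partials_differentiable _ f (fun i => 'D_(axis R i) f)).
  by apply: filterS (open_nbhs_nbhs (conj oU Ux)) => y Uy i; exact: Cn_is_derive Cf Uy.
by move=> i; apply: (Cn_continuous (Cn_derive _ Cf) Ux).
Qed.

Lemma differentiable_mx (R : realType) (V : normedModType R) p q
    (f : V -> 'M[R]_(p, q)) x :
  (forall i j, differentiable (fun y => f y i j : R) x) -> differentiable f x.
Proof.
move=> h.
have -> : f = \sum_(i < p) \sum_(j < q) (fun y => f y i j *: delta_mx i j).
  apply/funext => y; rewrite fct_sumE {1}(matrix_sum_delta (f y)).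
  by apply: eq_bigr => i _; rewrite fct_sumE.
by apply: differentiable_sum => i; apply: differentiable_sum => j; exact: differentiableZl.
Qed.

Lemma C1_differentiable (R : realType) p q (U : set 'rV[R]_2)
    (f : 'rV[R]_2 -> 'M[R]_(p, q)) x :
  open U -> Cn_on 1 U f -> U x -> differentiable f x.
Proof.
move=> oU /(Cn_mxP _ _ oU) Cf Ux; apply: differentiable_mx => i j.
exact: C1_differentiable_real oU (Cf i j) Ux.
Qed.

Lemma diff_axis (R : realType) (W : normedModType R) (f : 'rV[R]_2 -> W) x v :
  differentiable f x ->
  'd f x v = v 0 0 *: 'D_(axis R 0) f x + v 0 1 *: 'D_(axis R 1) f x.
Proof. by move=> df; rewrite {1}(rV2E v) linearD !linearZ /= !deriveE. Qed.

Lemma diff_is_derive (R : realType) (V W : normedModType R) (f : V -> W) x v :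
  differentiable f x -> is_derive x v f ('d f x v).
Proof. by move=> df; apply: DeriveDef; [exact: diff_derivable|rewrite deriveE]. Qed.

(** The source of g is the plane, where a function of class C^1 is differentiable;
    this gives the chain rule. *)
Lemma Cn_comp_real (R : realType) (V : normedModType R) n (U : set V)
    (A : set 'rV[R]_2) (g : 'rV[R]_2 -> R) (k : V -> 'rV[R]_2) :
  open U -> open A -> (forall x, U x -> A (k x)) ->
  Cn_on n A g -> Cn_on n U k -> Cn_on n U (g \o k).
Proof.
move=> oU oA UA; elim: n g => [|n IH] g Cg Ck.
  split=> // x Ux; apply: continuous_comp; first exact: Cn_continuous Ck Ux.
  exact: Cn_continuous Cg (UA _ Ux).
apply: (@Cn_intro _ _ _ n U _ (fun v x => 'D_v k x 0 0 * 'D_(axis R 0) g (k x)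
    + 'D_v k x 0 1 * 'D_(axis R 1) g (k x))) => //.
- move=> x Ux; apply: continuous_comp; first exact: Cn_continuous Ck Ux.
  exact: Cn_continuous Cg (UA _ Ux).
- move=> v x Ux.
  have dg := C1_differentiable_real oA (Cn_le (m := 1) (ltn0Sn n) Cg) (UA _ Ux).
  by have := is_derive_comp (Cn_is_derive v Ck Ux) dg; rewrite diff_axis.
- have Ck' := Cn_le (leqnSn n) Ck.
  move=> v; have CD := (Cn_mxP _ _ oU).1 (Cn_derive v Ck).
  have Cg' i : Cn_on n U ('D_(axis R i) g \o k) by apply: IH Ck' => //; exact: Cn_derive.
  apply: Cn_add => //; apply: Cn_mul => //; try exact: Cg'; exact: CD.
Qed.

Lemma Cn_comp (R : realType) (V : normedModType R) p q n (U : set V)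
    (A : set 'rV[R]_2) (g : 'rV[R]_2 -> 'M[R]_(p, q)) (k : V -> 'rV[R]_2) :
  open U -> open A -> (forall x, U x -> A (k x)) ->
  Cn_on n A g -> Cn_on n U k -> Cn_on n U (g \o k).
Proof.
move=> oU oA UA /(Cn_mxP _ _ oA) Cg Ck; apply/Cn_mxP => // i j.
exact: (@Cn_comp_real _ _ n U A (fun y => g y i j)).
Qed.

(** By Cramer's rule. *)
Lemma Cn_invmx (R : realType) (V : normedModType R) n (U : set V)
    (M : V -> 'M[R]_2) :
  open U -> (forall x, U x -> M x \in unitmx) -> Cn_on n U M ->
  Cn_on n U (fun x => invmx (M x)).
Proof.
move=> oU uM /(Cn_mxP _ _ oU) CM.
have Ccof i j : Cn_on n U (fun x => cofactor (M x) i j).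
  apply: (@Cn_ext _ _ _ n U (fun x => (-1) ^+ (i + j) * M x (lift i 0) (lift j 0))) => //.
    by move=> x _; rewrite /cofactor det_mx11 !mxE.
  by apply: Cn_mul => //; exact: Cn_cst.
have Cdet : Cn_on n U (fun x => \det (M x)).
  apply: (@Cn_ext _ _ _ n U (fun x => \sum_j M x 0 j * cofactor (M x) 0 j)) => //.
    by move=> x _; rewrite (expand_det_row _ 0).
  by apply: Cn_sum => // j; exact: Cn_mul.
apply: (@Cn_ext _ _ _ n U (fun x => (\det (M x))^-1 *: \adj (M x))) => //.
  by move=> x Ux; rewrite /invmx uM.
apply: Cn_scale => //.
  by apply: Cn_inv => // x Ux; have := uM x Ux; rewrite unitmxE unitfE.
apply/Cn_mxP => // i j; apply: (@Cn_ext _ _ _ n U (fun x => cofactor (M x) j i)) => //.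
by move=> x _; rewrite mxE.
Qed.

(** A real function whose partial derivatives are of class C^n is of class
    C^(n+1). *)
Lemma Cn_partials (R : realType) n (U : set 'rV[R]_2) (f : 'rV[R]_2 -> R)
    (D : 'I_2 -> 'rV[R]_2 -> R) :
  open U -> (forall i x, U x -> is_derive x (axis R i) f (D i x)) ->
  (forall i, Cn_on n U (D i)) -> Cn_on n.+1 U f.
Proof.
move=> oU df CD.
have dif x : U x -> differentiable f x.
  move=> Ux; apply: (@partials_differentiable _ f D).
    by apply: filterS (open_nbhs_nbhs (conj oU Ux)) => y Uy i; exact: df.
  by move=> i; apply: (Cn_continuous (CD i) Ux).
apply: (@Cn_intro _ _ _ n U _ (fun v x => v 0 0 * D 0 x + v 0 1 * D 1 x)) => //.
- by move=> x /dif; exact: differentiable_continuous.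
- move=> v x Ux; have := diff_is_derive v (dif x Ux).
  by rewrite (diff_axis _ (dif x Ux)) (is_derive_val (df 0 x Ux)) (is_derive_val (df 1 x Ux)).
- by move=> v; apply: Cn_add => //; apply: Cn_mul => //; exact: Cn_cst.
Qed.

(** * Mixed derivatives and mean value estimates *)

Lemma is_derive_translate (R : realType) (V W : normedModType R) (f : V -> W)
    (c y v : V) (l : W) :
  is_derive (c + y) v f l -> is_derive y v (fun z => f (c + z)) l.
Proof.
have E : (fun h : R => h^-1 *: ((f \o shift (c + y)) (h *: v) - f (c + y))) =
  (fun h : R => h^-1 *: (((fun z => f (c + z)) \o shift y) (h *: v) - f (c + y))).
  by apply/funext => h /=; congr (_ *: (f _ - _)); rewrite addrCA.
by move=> [hd hv]; split; rewrite /derivable /derive -?E in hd hv *.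
Qed.

(** The second difference of f along two directions, as a mixed derivative at an
    intermediate point. *)
Lemma second_difference (R : realType) (V : normedModType R)
    (f fu fuw : V -> R) (x u w : V) (h k : R) :
  (forall s t : R, 0 <= s <= 1 -> 0 <= t <= 1 ->
     is_derive (s * h *: u + (t * k *: w + x)) u f
       (fu (s * h *: u + (t * k *: w + x))) /\
     is_derive (s * h *: u + (t * k *: w + x)) w fu
       (fuw (s * h *: u + (t * k *: w + x)))) ->
  exists s t : R, [/\ 0 <= s <= 1, 0 <= t <= 1 &
    f (h *: u + (k *: w + x)) - f (k *: w + x) - (f (h *: u + x) - f x)
    = h * (k * fuw (s * h *: u + (t * k *: w + x)))].
Proof.
move=> df.
have H0 : 0 <= (0 : R) <= 1 by rewrite lexx ler01.
have H1 : 0 <= (1 : R) <= 1 by rewrite lexx ler01.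
have [s s01 Es] : exists2 s : R, 0 <= s <= 1 &
   (f (k *: w + (h *: u + x)) - f (h *: u + x)) - (f (k *: w + x) - f x)
   = h * (fu (k *: w + (s * h *: u + x)) - fu (s * h *: u + x)).
  apply: (@line_MVT _ _ (fun y => f (k *: w + y) - f y)
    (fun y => fu (k *: w + y) - fu y) x u h) => s s01.
  apply: is_deriveB.
    apply: is_derive_translate; have [] := df s 1 s01 H1.
    by rewrite mul1r addrCA.
  by have [] := df s 0 s01 H0; rewrite mul0r scale0r add0r.
have [t t01 Et] : exists2 t : R, 0 <= t <= 1 &
   fu (k *: w + (s * h *: u + x)) - fu (s * h *: u + x)
   = k * fuw (t * k *: w + (s * h *: u + x)).
  apply: (@line_MVT _ _ fu fuw) => t t01.
  by have [_] := df s t s01 t01; rewrite addrCA.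
exists s, t; split=> //; rewrite [_ + (t * k *: w + x)]addrCA -Et -Es.
by rewrite [h *: u + (k *: w + x)]addrCA; ring.
Qed.

(** Symmetry of mixed partial derivatives. *)
Lemma mixed_derivatives_sym (R : realType) (V : normedModType R)
    (f fu fw fuw fwu : V -> R) (x u w : V) :
  (\forall y \near x, [/\ is_derive y u f (fu y), is_derive y w f (fw y),
     is_derive y w fu (fuw y) & is_derive y u fw (fwu y)]) ->
  {for x, continuous fuw} -> {for x, continuous fwu} -> fuw x = fwu x.
Proof.
move=> df cuw cwu.
apply/eqP; rewrite -subr_eq0 -normr_le0; apply/ler_addgt0Pr => e e0; rewrite add0r.
have e2 : 0 < e / 2 by rewrite divr_gt0.
have [r r0 hr] := near_ball (filterI df
  (filterI (continuous_ball cuw e2) (continuous_ball cwu e2))).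
pose N := `|u| + `|w| + 1.
have N0 : 0 < N by rewrite ltr_pwDr // addr_ge0.
have [h h0 hN] : exists2 h : R, 0 < h & h * N < r.
  exists (r / 2 / N); first by rewrite !divr_gt0.
  by rewrite divfK ?gt_eqF // ltr_pdivrMr // ltr_pMr // ltr1n.
have inb (s t : R) : 0 <= s <= 1 -> 0 <= t <= 1 ->
    ball x r (s * h *: u + (t * h *: w + x)).
  move=> /andP[s0 s1] /andP[t0 t1].
  rewrite -ball_normE /= addrA opprD addrCA subrr addr0 normrN.
  apply: (@le_lt_trans _ _ (h * (`|u| + `|w|))).
    rewrite mulrDr; apply: (le_trans (ler_normD _ _)); rewrite !normrZ.
    rewrite (ger0_norm s0) (ger0_norm t0) (gtr0_norm h0).
    by apply: lerD; apply: ler_wpM2r => //; rewrite ler_piMl // ltW.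
  by apply: le_lt_trans hN; rewrite ler_pM2l // /N lerDl.
have [s [t [s01 t01 E1]]] := @second_difference _ _ f fu fuw x u w h h
  (fun a b ha hb => let: And4 p _ q _ := (hr _ (inb a b ha hb)).1 in conj p q).
have inb' (a b : R) : 0 <= a <= 1 -> 0 <= b <= 1 ->
    ball x r (a * h *: w + (b * h *: u + x)).
  by move=> hs ht; rewrite addrCA; exact: inb.
have [s' [t' [s'01 t'01 E2]]] := @second_difference _ _ f fw fwu x w u h h
  (fun a b ha hb => let: And4 _ p _ q := (hr _ (inb' a b ha hb)).1 in conj p q).
have E : fuw (s * h *: u + (t * h *: w + x)) = fwu (s' * h *: w + (t' * h *: u + x)).
  have hn : h != 0 by rewrite gt_eqF.
  apply: (mulfI hn); apply: (mulfI hn); rewrite -E1 -E2.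
  by rewrite [h *: w + (h *: u + x)]addrCA; ring.
have a1 := (hr _ (inb s t s01 t01)).2.1.
have a2 := (hr _ (inb' s' t' s'01 t'01)).2.2.
have -> : fuw x - fwu x =
   - (fuw (s * h *: u + (t * h *: w + x)) - fuw x)
   + (fwu (s' * h *: w + (t' * h *: u + x)) - fwu x) by rewrite E; ring.
rewrite [e]splitr; apply: (le_trans (ler_normD _ _)); rewrite normrN.
by apply: lerD; apply: ltW.
Qed.

Lemma interval_MVT (R : realType) (f df : R -> R) (a b : R) :
  (forall s : R, 0 <= s <= 1 ->
     is_derive (s * (b - a) + a) (1 : R) f (df (s * (b - a) + a))) ->
  exists2 s : R, 0 <= s <= 1 & f b - f a = (b - a) * df (s * (b - a) + a).
Proof.
move=> h; have [|s s01] := @line_MVT R R f df a 1 (b - a).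
  by move=> s s01; rewrite [_ *: 1]mulr1; exact: h.
by rewrite ![_ *: 1]mulr1 subrK => E; exists s.
Qed.

(** A curve with constant velocity is a straight line. *)
Lemma curve_affine (R : realType) n (g : R -> 'rV[R]_n) (w : 'rV[R]_n) (a b : R) :
  (forall s : R, 0 <= s <= 1 -> is_derive (s * (b - a) + a) (1 : R) g w) ->
  g b = g a + (b - a) *: w.
Proof.
move=> h; apply/rowP => j; rewrite !mxE.
have [|s _ E] := @interval_MVT R (fun t => g t 0 j) (fun _ => w 0 j) a b.
  move=> s s01; have [dg <-] := h s s01.
  apply: DeriveDef; first exact: (derivable_mxP _ _ _).1.
  by rewrite (derive_mx dg) mxE.
by rewrite -E addrC subrK.
Qed.

(** Small partial derivatives on a ball, which is a square for the norm of R^2,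
    give a Lipschitz bound. *)
Lemma partials_lipschitz (R : realType) (f : 'rV[R]_2 -> R)
    (D : 'I_2 -> 'rV[R]_2 -> R) (c : 'rV[R]_2) (r e : R) :
  (forall i y, ball c r y -> is_derive y (axis R i) f (D i y) /\ `|D i y| <= e) ->
  forall x y, ball c r x -> ball c r y -> `|f x - f y| <= (e + e) * `|x - y|.
Proof.
move=> df x y cx cy.
have r0 : 0 < r by move: cx; rewrite -ball_normE /=; apply: le_lt_trans.
have e0 : 0 <= e by apply: le_trans (df 0 _ cx).2.
have conv (a b d s : R) : `|a - b| < r -> `|a - d| < r -> 0 <= s <= 1 ->
    `|a - (s * (b - d) + d)| < r.
  move=> hb hd /andP[s0 s1].
  have -> : a - (s * (b - d) + d) = s * (a - b) + (1 - s) * (a - d) by ring.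
  apply: (le_lt_trans (ler_normD _ _)); rewrite !normrM (ger0_norm s0).
  rewrite (ger0_norm (_ : 0 <= 1 - s)) ?subr_ge0 //.
  have [->|sp] := eqVneq s 0; first by rewrite mul0r add0r subr0 mul1r.
  have -> : r = s * r + (1 - s) * r by ring.
  apply: ltr_leD; first by rewrite ltr_pM2l // lt_def sp.
  by apply: ler_wpM2l; rewrite ?subr_ge0 // ltW.
have [cx0 cx1] := (ball_rV2P c x r0).1 cx.
have [cy0 cy1] := (ball_rV2P c y r0).1 cy.
set a := x 0 0 - y 0 0; set b := x 0 1 - y 0 1.
have ha : `|a| <= `|x - y| by have := ler_mx_entry (x - y) 0 0; rewrite !mxE.
have hb : `|b| <= `|x - y| by have := ler_mx_entry (x - y) 0 1; rewrite !mxE.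
have z s : 0 <= s <= 1 -> ball c r (s * a *: axis R 0 + y).
  move=> s01; apply/ball_rV2P => //; rewrite !mxE /= mulr1 mulr0 add0r.
  by split=> //; exact: conv.
have z' s : 0 <= s <= 1 -> ball c r (s * b *: axis R 1 + (a *: axis R 0 + y)).
  move=> s01; apply/ball_rV2P => //; rewrite !mxE /= !mulr1 !mulr0 !add0r.
  by rewrite subrK; split=> //; exact: conv.
have [s s01 Ea] := @line_MVT _ _ f (D 0) y (axis R 0) a (fun s s01 => (df 0 _ (z s s01)).1).
have [t t01 Eb] := @line_MVT _ _ f (D 1) (a *: axis R 0 + y) (axis R 1) b
  (fun s s01 => (df 1 _ (z' s s01)).1).
have Ex : b *: axis R 1 + (a *: axis R 0 + y) = x.
  by apply: row2P; rewrite !mxE /= !(mulr1, mulr0, add0r) subrK.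
rewrite Ex in Eb.
have -> : f x - f y = (f x - f (a *: axis R 0 + y)) + (f (a *: axis R 0 + y) - f y) by ring.
rewrite Ea Eb; apply: (le_trans (ler_normD _ _)); rewrite !normrM mulrDl.
have D0 := (df 0 _ (z s s01)).2; have D1 := (df 1 _ (z' t t01)).2.
by apply: lerD; rewrite mulrC; apply: ler_pM.
Qed.

(** * Local inversion *)

Lemma ball_nbhs (R : realType) (V : normedModType R) (c x : V) (r : R) :
  ball c r x -> nbhs x (ball c r).
Proof.
by move=> cx; apply: open_nbhs_nbhs; split=> //; exact: ball_open.
Qed.

Lemma continuous_idfun (T : topologicalType) : continuous (fun x : T => x).
Proof. by move=> x; exact: cvg_id. Qed.

Lemma mulmx_bounded (R : realType) m n p (A : 'M[R]_(n, p)) :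
  exists2 K : R, 0 < K & forall w : 'M[R]_(m, n), `|w *m A| <= K * `|w|.
Proof.
have K0 : 0 < n%:R * `|A| + 1 by rewrite ltr_pwDr // mulr_ge0.
exists (n%:R * `|A| + 1) => // w.
apply: mx_norm_le => [|i j]; first by rewrite mulr_ge0 // ltW.
rewrite mxE; apply: (le_trans (ler_norm_sum _ _ _)).
apply: (@le_trans _ _ (\sum_(k < n) (`|A| * `|w|))).
  apply: ler_sum => k _; rewrite normrM mulrC.
  by apply: ler_pM => //; exact: ler_mx_entry.
by rewrite sumr_const card_ord -[leLHS]mulr_natl mulrA ler_wpM2r // lerDl.
Qed.

Lemma mulmxr_continuous (R : realType) m n p (A : 'M[R]_(n, p)) :
  continuous (mulmxr A : 'M[R]_(m, n) -> 'M[R]_(m, p)).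
Proof.
move=> z; apply: ball_continuous => e e0.
have [K K0 hK] := mulmx_bounded m A.
have [r r0 hr] : exists2 r : R, 0 < r & K * r <= e.
  by exists (e / K); [rewrite divr_gt0|rewrite mulrC divfK ?gt_eqF].
apply: filterS (continuous_ball (@continuous_idfun _ z) r0) => y hy /=.
rewrite -mulmxBl; apply: (le_trans (hK _)); apply: le_trans hr.
by rewrite ler_wpM2l // ltW.
Qed.

Lemma differentiable_approx (R : realType) (V W : normedModType R) (f : V -> W) x :
  differentiable f x -> forall e : R, 0 < e ->
  \forall y \near x, `|f y - f x - 'd f x (y - x)| <= e * `|y - x|.
Proof.
move=> df e e0.
have /eqaddoP /(_ e e0) h := diff_locally df.
have [r r0 hr] := near_ball h.
apply: filterS (nbhsx_ballx x r r0) => y xy.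
have := hr (y - x); rewrite -ball_normE /= sub0r normrN distrC.
move: xy; rewrite -ball_normE /= => -> /(_ isT).
by rewrite !fctE /= subrK opprD addrA.
Qed.

Lemma continuous_closed_ball_min (R : realType) (c : 'rV[R]_2) (d : R)
    (g : 'rV[R]_2 -> R) : 0 <= d ->
  (forall x, `|c - x| <= d -> {for x, continuous g}) ->
  exists2 x, `|c - x| <= d & forall y, `|c - y| <= d -> g x <= g y.
Proof.
move=> d0 cg; pose A := [set x : 'rV[R]_2 | `|c - x| <= d].
have An : A !=set0 by exists c; rewrite /A /= subrr normr0.
have Ac : compact A.
  apply: bounded_closed_compact.
    exists (`|c| + d); split; first exact: num_real.
    move=> M hM x xA; apply: le_trans (ltW hM).
    rewrite -[x](subKr c); apply: (le_trans (ler_normB _ _)).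
    by rewrite lerD2l.
  have -> : A = (fun x : 'rV[R]_2 => `|c - x|) @^-1` [set t : R | t <= d] by [].
  apply: (continuous_closedP _).1; last exact: closed_le.
  move=> x; apply: continuous_comp; last exact: norm_continuous.
  by apply: (@continuousB _ _ 'rV[R]_2); [exact: cst_continuous|exact: continuous_idfun].
have cA : {within A, continuous g}.
  by apply: continuous_in_subspaceT => x; rewrite inE; exact: cg.
have [x xA xm] := EVT_min_rV An Ac cA.
by exists x; [move: xA; rewrite inE|move=> y yA; apply: xm; rewrite inE].
Qed.

(** The minimum of |T x - x| on the ball is 0. *)
Lemma contraction_fixed_point (R : realType) (c : 'rV[R]_2) (d : R)
    (T : 'rV[R]_2 -> 'rV[R]_2) : 0 <= d ->
  (forall x, `|c - x| <= d -> `|c - T x| <= d) ->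
  (forall x y, `|c - x| <= d -> `|c - y| <= d -> `|T x - T y| <= 2^-1 * `|x - y|) ->
  (forall x, `|c - x| <= d -> {for x, continuous T}) ->
  exists2 x, `|c - x| <= d & T x = x.
Proof.
move=> d0 Td Tl cT.
have [x xd xm] := @continuous_closed_ball_min _ c d (fun x => `|T x - x|) d0
  (fun x xd => @continuous_comp 'rV[R]_2 'rV[R]_2 R _ _ x
     (@continuousB _ _ 'rV[R]_2 _ _ x (cT x xd) (@continuous_idfun _ x)) (@norm_continuous _ _ _)).
exists x => //; apply/eqP; rewrite -subr_eq0 -normr_le0.
have h1 := xm _ (Td x xd).
have h2 := Tl _ _ (Td x xd) xd.
by have := le_trans h1 h2; lra.
Qed.

(** Inverse function theorem in the plane: f is a map of class C^1 whose
    differential at x is inverse to w |-> w *m M x. *)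
Lemma local_inverse (R : realType) (U : set 'rV[R]_2) (f : 'rV[R]_2 -> 'rV[R]_2)
    (M : 'rV[R]_2 -> 'M[R]_2) (p : 'rV[R]_2) :
  open U -> U p -> Cn_on 1 U f -> (forall x v, U x -> 'D_v f x *m M x = v) ->
  exists (W : set 'rV[R]_2) (r : R) (e : 'rV[R]_2 -> 'rV[R]_2),
  [/\ 0 < r /\ open W, W `<=` U /\ W p,
      forall x, W x -> ball (f p) r (f x) /\ e (f x) = x,
      forall y, ball (f p) r y -> W (e y) /\ f (e y) = y &
      forall y, ball (f p) r y ->
        differentiable e y /\ forall v, 'd e y v = v *m M (e y)].
Proof.
move=> oU Up Cf DM.
have dif x : U x -> differentiable f x by exact: C1_differentiable.
(* The partial derivatives D i of k vanish at p, so k is a contraction near p. *)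
pose k x := x - f x *m M p.
have [Df [dfD CDf DfM]] : exists Df : 'I_2 -> 'rV[R]_2 -> 'rV[R]_2,
    [/\ forall i x, U x -> is_derive x (axis R i) f (Df i x),
        forall i, Cn_on 0 U (Df i) & forall i x, U x -> Df i x *m M x = axis R i].
  exists (fun i => 'D_(axis R i) f); split=> i.
  - by move=> x Ux; exact: (Cn_is_derive (axis R i) Cf Ux).
  - exact: (Cn_derive (axis R i) Cf).
  - by move=> x Ux; exact: DM.
pose D i x := axis R i - Df i x *m M p.
have kD i x : U x -> is_derive x (axis R i) k (D i x).
  move=> Ux.
  have cL := @mulmxr_continuous R 1 2 2 (M p).
  have dL : differentiable (mulmxr (M p) : 'rV[R]_2 -> 'rV[R]_2) (f x).
    exact: linear_differentiable.
  have E := is_derive_comp (dfD i x Ux) dL; rewrite diff_lin // in E.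
  exact: (is_deriveB (is_derive_id x (axis R i)) E).
have CD i : Cn_on 0 U (D i).
  exact: (Cn_minus oU (Cn_cst 0 (axis R i) oU) (Cn_mulmx oU (CDf i) (Cn_cst 0 (M p) oU))).
have Dp i : D i p = 0 by rewrite /D DfM // subrr.
have e40 : 0 < (4^-1 : R) by rewrite invr_gt0 ltr0n.
have [r0 r00 hr0] : exists2 r0, 0 < r0 & forall x, ball p r0 x ->
    U x /\ forall i, `|D i x| <= 4^-1.
  have [r r0 hr] := near_ball (filterI (open_nbhs_nbhs (conj oU Up))
    (filterI (continuous_ball (Cn_continuous (CD 0) Up) e40)
             (continuous_ball (Cn_continuous (CD 1) Up) e40))).
  exists r => // x /hr[Ux [h0 h1]]; split=> //.
  by move: h0 h1; rewrite !Dp !subr0 => /ltW h0 /ltW h1; apply: forall_ord2.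
have klip x y : ball p r0 x -> ball p r0 y -> `|k x - k y| <= 2^-1 * `|x - y|.
  move=> bx by_; apply: mx_norm_le => [|i j]; first by rewrite mulr_ge0 // invr_ge0.
  rewrite ord1 [X in `|X|]mxE [X in _ + X]mxE.
  have -> : (2^-1 : R) = 4^-1 + 4^-1 by field.
  apply: (@partials_lipschitz _ (fun z => k z 0 j) (fun i z => D i z 0 j) p r0) => //.
  move=> l z /hr0[Uz Dz]; split; last by apply: le_trans (Dz l); exact: ler_mx_entry.
  have [dk <-] := kD l z Uz.
  apply: DeriveDef; first exact: (derivable_mxP _ _ _).1.
  by rewrite (derive_mx dk) mxE.
have [K K0 hK] := mulmx_bounded 1 (M p).
have xlip x y : ball p r0 x -> ball p r0 y -> `|x - y| <= 2 * K * `|f x - f y|.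
  move=> bx by_; have hk := klip x y bx by_.
  have h : `|x - y| <= `|k x - k y| + K * `|f x - f y|.
    have -> : x - y = (k x - k y) + (f x - f y) *m M p.
      rewrite /k mulmxBl; move: (f x *m M p) (f y *m M p) => A B.
      by apply/rowP => j; rewrite !mxE; ring.
    by apply: (le_trans (ler_normD _ _)); rewrite lerD2l.
  have {}h : `|x - y| <= 2^-1 * `|x - y| + K * `|f x - f y|.
    by apply: le_trans h _; rewrite lerD2r.
  by rewrite -mulrA; move: h; set A := `|x - y|; set B := K * _; lra.
pose d := r0 / 2.
have d0 : 0 < d by rewrite divr_gt0.
have dr0 : d < r0 by rewrite /d ltr_pdivrMr // ltr_pMr // ltr1n.
pose r := d / (2 * K).
have rp : 0 < r by rewrite divr_gt0 // mulr_gt0.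
have Mp_inj (w : 'rV[R]_2) : w *m M p = 0 -> w = 0.
  pose Jp : 'M[R]_2 := \matrix_i Df i p.
  have JM : Jp *m M p = 1%:M.
    by apply/row_matrixP => i; rewrite row_mul rowK DfM // row1.
  by move=> h; rewrite -[w]mulmx1 -(mulmx1C JM) mulmxA h mul0mx.
have solve y : ball (f p) r y -> exists x, ball p d x /\ f x = y.
  rewrite -ball_normE /= => hy.
  (* The fixed points of T are the solutions of f x = y. *)
  pose T x := k x + y *m M p.
  have inb x : `|p - x| <= d -> ball p r0 x.
    by move=> h; rewrite -ball_normE /=; apply: le_lt_trans h _.
  have pb : ball p r0 p by exact: ballxx.
  have Tstrict x : `|p - x| <= d -> `|p - T x| < d.
    move=> hx.
    have -> : p - T x = (k p - k x) + (f p - y) *m M p.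
      rewrite /T /k mulmxBl; move: (f x *m M p) (f p *m M p) (y *m M p) => A B C.
      by apply/rowP => j; rewrite !mxE; ring.
    apply: (le_lt_trans (ler_normD _ _)).
    have h1 := klip p x pb (inb x hx).
    have h2 := hK (f p - y).
    have h3 : K * `|f p - y| < d / 2.
      have -> : d / 2 = K * r by rewrite /r; field; rewrite gt_eqF.
      by rewrite ltr_pM2l.
    by lra.
  have [|||x xd Tx] := @contraction_fixed_point _ p d T (ltW d0).
  - by move=> x /Tstrict /ltW.
  - move=> x z hx hz; rewrite /T opprD addrACA subrr addr0.
    by apply: klip; exact: inb.
  - move=> x hx; have [Ux _] := hr0 _ (inb x hx).
    apply: (@continuousD _ _ 'rV[R]_2); last exact: cst_continuous.
    apply: (@Cn_continuous _ _ _ 0 U) => //.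
    exact: (Cn_minus oU (Cn_id 0 oU) (Cn_mulmx oU (Cn_le (leq0n 1) Cf) (Cn_cst 0 (M p) oU))).
  exists x; split; first by rewrite /= -{1}Tx; exact: Tstrict.
  apply/eqP; rewrite -subr_eq0; apply/eqP/Mp_inj; rewrite mulmxBl.
  move: Tx; rewrite /T /k; move: (f x *m M p) (y *m M p) => A B h.
  by apply/rowP => j; have /rowP/(_ j) := h; rewrite !mxE; lra.
have [e he] : exists e, forall y, ball (f p) r y -> ball p d (e y) /\ f (e y) = y.
  have /choice[e he] : forall y, exists x, ball (f p) r y -> ball p d x /\ f x = y.
    by move=> y; have [/solve[x hx]|] := pselect (ball (f p) r y); [exists x|exists 0].
  by exists e.
have sub x : ball p d x -> ball p r0 x by apply: le_ball; exact: ltW.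
pose W := ball p d `&` f @^-1` (ball (f p) r).
have oW : open W.
  rewrite openE => x [bx fx]; apply: filterI.
    exact: ball_nbhs.
  have := Cn_continuous Cf (hr0 _ (sub _ bx)).1.
  by apply; exact: ball_nbhs.
have elip y z : ball (f p) r y -> ball (f p) r z -> `|e y - e z| <= 2 * K * `|y - z|.
  move=> /he[by1 fy] /he[bz fz].
  by have := xlip _ _ (sub _ by1) (sub _ bz); rewrite fy fz.
exists W, r, e; split=> //.
- split; first by move=> x [/sub/hr0[]].
  by split; [exact: ballxx|exact: ballxx].
- move=> x [bx fx]; split=> //.
  have [b1 f1] := he _ fx; apply/eqP; rewrite -subr_eq0 -normr_le0.
  by have := xlip _ _ (sub _ b1) (sub _ bx); rewrite f1 subrr normr0 mulr0.
- by move=> y hy; have [b1 f1] := he _ hy; split=> //; split=> //=; rewrite f1.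
- move=> y hy; have [b1 f1] := he _ hy; have [Ux _] := hr0 _ (sub _ b1).
  set x := e y in b1 f1 Ux *.
  have [Kx Kx0 hKx] := mulmx_bounded 1 (M x).
  have cL := @mulmxr_continuous R 1 2 2 (M x).
  have [|de dE] := @linear_approx_differentiable R _ _ e (mulmxr (M x)) y cL; last first.
    by split=> // v; rewrite dE.
  move=> eps eps0.
  pose eta := eps / (Kx * (2 * K)).
  have eta0 : 0 < eta by rewrite divr_gt0 // !mulr_gt0.
  have [s s0 hs] := near_ball (differentiable_approx (dif x Ux) eta0).
  have [s' s'0 hs'] := near_ball (ball_nbhs hy).
  pose t := Num.min s' (s / (2 * K)).
  have t0 : 0 < t by rewrite lt_min s'0 divr_gt0 // mulr_gt0.
  apply: (near0_norm t0) => h; rewrite lt_min => /andP[hs1 hs2].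
  have bh : ball (f p) r (h + y).
    by apply: hs'; rewrite -ball_normE /= opprD addrCA subrr addr0 normrN.
  have lh : `|e (h + y) - x| <= 2 * K * `|h|.
    by have := elip _ _ bh hy; rewrite addrK.
  have := hs (e (h + y)); rewrite -ball_normE /= distrC (he _ bh).2 f1 addrK.
  have -> : `|e (h + y) - x| < s.
    by apply: (le_lt_trans lh); rewrite mulrC -ltr_pdivlMr // mulr_gt0.
  move=> /(_ isT) H.
  have -> : e (h + y) - x - h *m M x =
      - ((h - 'd f x (e (h + y) - x)) *m M x).
    rewrite mulmxBl -deriveE; last exact: dif.
    by rewrite DM // opprB.
  rewrite normrN; apply: (le_trans (hKx _)).
  apply: (@le_trans _ _ (Kx * (eta * (2 * K * `|h|)))).
    rewrite ler_pM2l //; apply: (le_trans H); rewrite ler_pM2l //.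
  rewrite le_eqVlt; apply/orP; left; apply/eqP.
  by rewrite /eta; field; rewrite !gt_eqF.
Qed.

(** * Integrals of continuous functions and closed forms *)

Lemma continuous_on_segment (R : realType) (f : R -> R) (l u : R) :
  (forall t, l <= t <= u -> {for t, continuous f}) ->
  {within `[l, u], continuous f}.
Proof.
move=> cf; apply: continuous_in_subspaceT => t; rewrite inE /= in_itv /=.
exact: cf.
Qed.

Lemma continuous_segment_integrable (R : realType) (f : R -> R) (l u : R) :
  (forall t, l <= t <= u -> {for t, continuous f}) ->
  (@lebesgue_measure R).-integrable `[l, u] (EFin \o f).
Proof.
move=> cf; apply: continuous_compact_integrable; first exact: segment_compact.
exact: continuous_on_segment.
Qed.

Lemma is_derive_integral (R : realType) (f : R -> R) (l x u : R) :
  l < x < u -> (forall t, l <= t <= u -> {for t, continuous f}) ->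
  is_derive x (1 : R) (fun y => (\int[@lebesgue_measure R]_(t in `[l, y]) f t)%R) (f x).
Proof.
move=> /andP[lx xu] cf.
have [d dE] := continuous_FTC1_closed xu (continuous_segment_integrable cf) lx
   (cf x ltac:(by rewrite !ltW)).
by apply: DeriveDef; [exact: d|rewrite -derive1E; exact: dE].
Qed.

Lemma integral_is_derive (R : realType) (f F : R -> R) (l u : R) :
  l < u -> (forall t, l <= t <= u -> {for t, continuous f}) ->
  (forall t, l <= t <= u -> is_derive t (1 : R) F (f t)) ->
  (\int[@lebesgue_measure R]_(t in `[l, u]) f t)%R = F u - F l.
Proof.
move=> lu cf dF.
have cF t : l <= t <= u -> {for t, continuous F}.
  by move=> /dF[d _]; apply: differentiable_continuous; exact/derivable1_diffP.
rewrite /Rintegral (continuous_FTC2 lu (continuous_on_segment cf) (F := F)) //=.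
  split.
  - by move=> t; rewrite in_itv /= => /andP[h1 h2]; have [] := dF t; rewrite ?ltW.
  - by apply: cvg_at_right_filter; apply: cF; rewrite lexx ltW.
  - by apply: cvg_at_left_filter; apply: cF; rewrite lexx ltW.
move=> t; rewrite in_itv /= => /andP[h1 h2].
by rewrite derive1E; have [_ ->] := dF t ltac:(by rewrite !ltW).
Qed.

(** Differentiation of a parametric integral on a segment. *)
Lemma is_derive_under_integral (R : realType) (f f1 : R -> R -> R)
    (l u al be x K : R) :
  al < x < be ->
  (forall s t, al < s < be -> l <= t <= u ->
     [/\ {for t, continuous (f s)}, is_derive s (1 : R) (f ^~ t) (f1 s t)
       & `|f1 s t| <= K]) ->
  is_derive x (1 : R) (fun s => (\int[@lebesgue_measure R]_(t in `[l, u]) f s t)%R)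
    (\int[@lebesgue_measure R]_(t in `[l, u]) f1 x t)%R.
Proof.
move=> xI h.
have Ix : `]al, be[%classic x by rewrite /= in_itv.
have mB : measurable (`[l, u]%classic : set (measurableTypeR R)) by exact: measurable_itv.
have p1 s t : `]al, be[%classic s -> `[l, u]%classic t -> partial1of2 f s t = f1 s t.
  rewrite /= !in_itv /= => hs ht; rewrite partial1of2E.
  by have [_ [_ ->] _] := h s t hs ht.
have intf s : `]al, be[%classic s ->
    (@lebesgue_measure R).-integrable `[l, u] (EFin \o f s).
  rewrite /= in_itv /= => hs; apply: continuous_segment_integrable => t ht.
  by have [] := h s t hs ht.
have derf s t : `]al, be[%classic s -> `[l, u]%classic t -> derivable (f ^~ t) s 1.
  by rewrite /= !in_itv /= => hs ht; have [_ []] := h s t hs ht.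
have iG : (@lebesgue_measure R).-integrable `[l, u] (EFin \o (fun _ : R => `|K|)).
  by apply: continuous_segment_integrable => t _; exact: cst_continuous.
have Gub s t : `]al, be[%classic s -> `[l, u]%classic t ->
    `|partial1of2 f s t| <= `|K|.
  move=> hs ht; rewrite p1 //; move: hs ht; rewrite /= !in_itv /= => hs ht.
  by have [_ _ hK] := h s t hs ht; apply: le_trans hK (ler_norm _).
have D := @derivable_under_integral R _ _ (@lebesgue_measure R) f _ mB x al be Ix
  intf derf (fun _ => `|K|) (fun _ => normr_ge0 _) iG Gub.
have E := @differentiation_under_integral R _ _ (@lebesgue_measure R) f _ mB x al be Ix
  intf derf (fun _ => `|K|) (fun _ => normr_ge0 _) iG Gub.
apply: DeriveDef; first exact: D.
rewrite -derive1E E; apply: eq_Rintegral => t; rewrite inE => ht.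
exact: p1.
Qed.

(** A closed 1-form a dx + b dy of class C^1 is locally exact. *)
Lemma closed_form_exact (R : realType) (U : set 'rV[R]_2) (a b d : 'rV[R]_2 -> R)
    (c : 'rV[R]_2) :
  open U -> U c -> Cn_on 0 U a -> Cn_on 0 U b -> Cn_on 0 U d ->
  (forall x, U x -> is_derive x (axis R 1) a (d x) /\
                    is_derive x (axis R 0) b (d x)) ->
  exists (r : R) (P : 'rV[R]_2 -> R), [/\ 0 < r, ball c r `<=` U &
    forall x, ball c r x -> is_derive x (axis R 0) P (a x) /\
                            is_derive x (axis R 1) P (b x)].
Proof.
move=> oU Uc Ca Cb Cd dab.
have [rho rho0 hrho] := near_ball (filterI (open_nbhs_nbhs (conj oU Uc))
  (continuous_ball (Cn_continuous Cd Uc) ltr01)).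
pose r := rho / 2.
have r0 : 0 < r by rewrite divr_gt0.
have rr : r < rho by rewrite /r ltr_pdivrMr // ltr_pMr // ltr1n.
pose c0 : R := c 0 0; pose c1 : R := c 0 1.
pose l0 := c0 - r; pose l1 := c1 - r; pose u0 := c0 + r; pose u1 := c1 + r.
pose pt (s t : R) : 'rV[R]_2 := s *: axis R 0 + t *: axis R 1.
have ptC s t : pt s t = t *: axis R 1 + s *: axis R 0 by rewrite /pt addrC.
pose K := `|d c| + 1.
have inU s t : l0 <= s <= u0 -> l1 <= t <= u1 -> U (pt s t) /\ `|d (pt s t)| <= K.
  rewrite /l0 /u0 /l1 /u1 => hs ht.
  have /hrho[Upt hd] : ball c rho (pt s t).
    apply/ball_rV2P => //; rewrite !mxE /= !mulr1 !mulr0 addr0 add0r.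
    rewrite -/c0 -/c1; split; apply: le_lt_trans rr.
      by rewrite ler_norml; move: hs; lra.
    by rewrite ler_norml; move: ht; lra.
  split=> //; have -> : d (pt s t) = d c + (d (pt s t) - d c) by ring.
  by apply: (le_trans (ler_normD _ _)); rewrite lerD2l ltW.
have ax_cont i (h : R) : {for h, continuous (fun s : R => s *: axis R i)}.
  by apply: continuousZr_tmp; exact: continuous_idfun.
have hline (f : 'rV[R]_2 -> R) (s t : R) : Cn_on 0 U f -> U (pt s t) ->
    {for s, continuous (fun s => f (pt s t))}.
  move=> Cf Ux; apply: (@continuous_comp R 'rV[R]_2 R (fun s : R => pt s t) f).
    by apply: continuousD; [exact: ax_cont|exact: cst_continuous].
  exact: Cn_continuous Cf Ux.
have vline (f : 'rV[R]_2 -> R) (s t : R) : Cn_on 0 U f -> U (pt s t) ->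
    {for t, continuous (fun t => f (pt s t))}.
  move=> Cf Ux; apply: (@continuous_comp R 'rV[R]_2 R (fun t : R => pt s t) f).
    by apply: continuousD; [exact: cst_continuous|exact: ax_cont].
  exact: Cn_continuous Cf Ux.
pose mu := @lebesgue_measure R.
(* The integral of the form along a horizontal segment and then a vertical one. *)
pose P (x : 'rV[R]_2) : R := ((\int[mu]_(s in `[l0, x 0 0]) a (pt s l1))
   + (\int[mu]_(t in `[l1, x 0 1]) b (pt (x 0 0) t)))%R.
exists r, P; split=> //.
  by move=> x hx; have /hrho[] : ball c rho x by apply: le_ball hx; exact: ltW.
move=> x /(ball_rV2P c x r0); rewrite -/c0 -/c1.
set x0 : R := x 0 0; set x1 : R := x 0 1 => -[hx0 hx1].
have xE : x = pt x0 x1 by exact: rV2E.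
have {}hx0 : l0 < x0 < u0 by move: hx0; rewrite /l0 /u0 ltr_norml; lra.
have {}hx1 : l1 < x1 < u1 by move: hx1; rewrite /l1 /u1 ltr_norml; lra.
have hx0' : l0 <= x0 <= u0 by case/andP: hx0 => ? ?; rewrite !ltW.
have hx1' : l1 <= x1 <= u1 by case/andP: hx1 => ? ?; rewrite !ltW.
have hl1 : l1 <= l1 <= u1 by rewrite /l1 /u1; lra.
have Pline (s t : R) : P (pt s t) = ((\int[mu]_(s in `[l0, s]) a (pt s l1))
   + (\int[mu]_(t in `[l1, t]) b (pt s t)))%R.
  by rewrite /P /pt !mxE /= !mulr1 !mulr0 addr0 add0r.
split; rewrite {1}xE.
- rewrite /pt; apply/is_derive_line.
  have -> : (fun h : R => P (h *: axis R 0 + x1 *: axis R 1)) =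
    (fun h => \int[mu]_(s in `[l0, h]) a (pt s l1))%R +
    (fun h => \int[mu]_(t in `[l1, x1]) b (pt h t))%R.
    by apply/funext => h; rewrite -/(pt h x1) Pline.
  have -> : a x = a (pt x0 l1) + (\int[mu]_(t in `[l1, x1]) d (pt x0 t))%R.
    have -> : (\int[mu]_(t in `[l1, x1]) d (pt x0 t))%R = a (pt x0 x1) - a (pt x0 l1);
      last by rewrite addrC subrK -xE.
    apply: (@integral_is_derive _ (fun t => d (pt x0 t)) (fun t => a (pt x0 t))).
    + by case/andP: hx1.
    + move=> t ht; have [|Ut _] := inU x0 t hx0'.
        by move: ht hx1; lra.
      exact: vline.
    + move=> t ht; have [|Ut _] := inU x0 t hx0'.
        by move: ht hx1; lra.
      rewrite (_ : (fun t => a (pt x0 t)) = (fun t => a (t *: axis R 1 + x0 *: axis R 0))).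
        have H : is_derive (t *: axis R 1 + x0 *: axis R 0) (axis R 1) a (d (pt x0 t)).
          by rewrite -ptC; exact: (dab _ Ut).1.
        exact: ((is_derive_line a _ _ _ _).1 H).
      by apply/funext => z; rewrite ptC.
  apply: is_deriveD.
    apply: (@is_derive_integral _ (fun s => a (pt s l1)) _ _ u0) => // s hs.
    have [Us _] := inU s l1 hs hl1.
    exact: hline.
  apply: (@is_derive_under_integral _ (fun s t => b (pt s t)) (fun s t => d (pt s t))
    l1 x1 l0 u0 x0 K) => // s t hs ht.
  have [||Ut hK] := inU s t.
  + by case/andP: hs => ? ?; rewrite !ltW.
  + by move: ht hx1; lra.
  split=> //.
    exact: vline.
  exact: ((is_derive_line b (t *: axis R 1) (axis R 0) _ s).1 (dab _ Ut).2).
- rewrite ptC; apply/is_derive_line.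
  have -> : (fun h : R => P (h *: axis R 1 + x0 *: axis R 0)) =
    cst (\int[mu]_(s in `[l0, x0]) a (pt s l1))%R +
    (fun h => \int[mu]_(t in `[l1, h]) b (pt x0 t))%R.
    by apply/funext => h; rewrite -ptC Pline.
  rewrite -[b x]add0r; apply: is_deriveD.
  rewrite xE; apply: (@is_derive_integral _ (fun t => b (pt x0 t)) _ _ u1) => // t ht.
  have [Ut _] := inU x0 t hx0' ht.
  exact: vline.
Qed.

(** * Complex multiplication and complex derivatives in the plane *)

Lemma xy_of0 (R : realType) (z : cplx R) : xy_of z 0 0 = complex.Re z.
Proof. by rewrite !mxE /= mulr1 mulr0 addr0. Qed.

Lemma xy_of1 (R : realType) (z : cplx R) : xy_of z 0 1 = complex.Im z.
Proof. by rewrite !mxE /= mulr1 mulr0 add0r. Qed.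

Lemma xy_ofK (R : realType) : cancel (@xy_of R) (@z_of R).
Proof. by move=> z; rewrite /z_of xy_of0 xy_of1; case: z. Qed.

Lemma z_ofK (R : realType) : cancel (@z_of R) (@xy_of R).
Proof. by move=> p; apply: row2P; rewrite ?xy_of0 ?xy_of1. Qed.

Lemma z_of_add (R : realType) (p q : 'rV[R]_2) : z_of (p + q) = z_of p + z_of q.
Proof. by rewrite /z_of !mxE. Qed.

Lemma z_of_sub (R : realType) (p q : 'rV[R]_2) : z_of (p - q) = z_of p - z_of q.
Proof. by rewrite /z_of !mxE. Qed.

Lemma xy_of_sub (R : realType) (z w : cplx R) : xy_of (z - w) = xy_of z - xy_of w.
Proof.
by rewrite -{1}[z]xy_ofK -{1}[w]xy_ofK -z_of_sub z_ofK.
Qed.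

(** Multiplication by a complex number, as a real endomorphism of the plane. *)
Definition cmul (R : realType) (l : cplx R) (w : 'rV[R]_2) : 'rV[R]_2 :=
  xy_of (l * z_of w).

Lemma cmulE0 (R : realType) (l : cplx R) (w : 'rV[R]_2) :
  cmul l w 0 0 = complex.Re l * w 0 0 - complex.Im l * w 0 1.
Proof. by rewrite xy_of0; case: l. Qed.

Lemma cmulE1 (R : realType) (l : cplx R) (w : 'rV[R]_2) :
  cmul l w 0 1 = complex.Re l * w 0 1 + complex.Im l * w 0 0.
Proof. by rewrite xy_of1; case: l. Qed.

Lemma cmul_is_linear (R : realType) (l : cplx R) : linear (cmul l).
Proof.
move=> a u v.
have e (p q : 'rV[R]_2) j : (a *: p + q) 0 j = a * p 0 j + q 0 j by rewrite !mxE.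
by apply: row2P; rewrite !(e, cmulE0, cmulE1); ring.
Qed.

Lemma cmul_continuous (R : realType) (l : cplx R) :
  continuous (cmul l : 'rV[R]_2 -> 'rV[R]_2).
Proof.
have oT : open [set: 'rV[R]_2] by exact: openT.
have C j : Cn_on 0 setT (fun w : 'rV[R]_2 => w 0 j : R).
  by split=> // y _; exact: coord_continuous.
have Cc (c : R) j := Cn_mul oT (Cn_cst 0 c oT) (C j).
have Cl i j : Cn_on 0 setT (fun w : 'rV[R]_2 => cmul l w i j : R).
  rewrite ord1; move: j; apply: forall_ord2.
    apply: Cn_ext oT _ (Cn_minus oT (Cc (complex.Re l) 0) (Cc (complex.Im l) 1)).
    by move=> w _; rewrite cmulE0.
  apply: Cn_ext oT _ (Cn_add oT (Cc (complex.Re l) 1) (Cc (complex.Im l) 0)).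
  by move=> w _; rewrite cmulE1.
by move=> x; exact: (Cn_continuous ((Cn_mxP 0 (cmul l) oT).2 Cl) (x := x)).
Qed.

Lemma norm_xy_of_le (R : realType) (z : cplx R) : `|xy_of z| <= Normc.normc z.
Proof.
case: z => a b; apply: mx_norm_le => [|i j]; first exact: sqrtr_ge0.
rewrite ord1; move: j; apply: forall_ord2; rewrite ?xy_of0 ?xy_of1 /=.
  by rewrite -sqrtr_sqr ler_wsqrtr // lerDl sqr_ge0.
by rewrite -sqrtr_sqr ler_wsqrtr // lerDr sqr_ge0.
Qed.

Lemma normc_le (R : realType) (z : cplx R) : Normc.normc z <= 2 * `|xy_of z|.
Proof.
have h0 := ler_mx_entry (xy_of z) 0 0; have h1 := ler_mx_entry (xy_of z) 0 1.
move: h0 h1; rewrite xy_of0 xy_of1; have := normr_ge0 (xy_of z).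
move: `|xy_of z| => m m0; case: z => a b /= ha hb.
rewrite -[leRHS]ger0_norm ?mulr_ge0 // -sqrtr_sqr ler_wsqrtr //.
rewrite -[a ^+ 2]real_normK ?num_real // -[b ^+ 2]real_normK ?num_real //.
have : `|a| ^+ 2 <= m ^+ 2 by rewrite lerXn2r ?nnegrE.
have : `|b| ^+ 2 <= m ^+ 2 by rewrite lerXn2r ?nnegrE.
have : 0 <= m ^+ 2 by rewrite sqr_ge0.
rewrite exprMn; set A := `|a| ^+ 2; set B := `|b| ^+ 2; set D := m ^+ 2.
by rewrite expr2; lra.
Qed.

(** Complex differentiability with explicit errors, in the real-valued norm of
    complex numbers. *)
Lemma complex_derivable_approx (R : realType) (G : cplx R -> cplx R) (z : cplx R) :
  derivable G z 1 -> forall e : R, 0 < e -> exists2 d : R, 0 < d &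
  forall h : cplx R, Normc.normc h < d ->
    Normc.normc (G (h + z) - G z - 'D_1 G z * h) <= e * Normc.normc h.
Proof.
move=> dG e e0.
have eC : 0 < (e%:C)%C :> R[i] by rewrite ltcR.
have := dG; rewrite /derivable => /cvgrPdist_le /(_ _ eC).
move=> /nbhs_ballP[d /= d0 hd].
move: d0; rewrite ltcE /= => /andP[/eqP dI dR].
exists (complex.Re d) => // h hlt.
have [->|hn] := eqVneq h 0; first by rewrite add0r subrr mulr0 subr0 !Normc.normc0 mulr0.
have := hd h; rewrite -ball_normE /= sub0r normrN.
have -> : (`|h| < d) = true.
  by rewrite ltcE /= dI eqxx.
move=> /(_ isT hn).
rewrite [h *: 1]mulr1.
have -> : 'D_1 G z - h^-1 *: (G (h + z) - G z) = - (h^-1 * (G (h + z) - G z - 'D_1 G z * h)).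
  rewrite [h^-1 *: _]/(h^-1 * _) [in RHS]mulrBr opprB.
  by rewrite [_ * h]mulrC mulrA mulVf // mul1r.
rewrite normrN normrM => H.
have : (Normc.normc h^-1 * Normc.normc (G (h + z) - G z - 'D_1 G z * h)) <= e.
  by move: H; rewrite -lecR rmorphM.
rewrite Normc.normcV mulrC ler_pdivrMr //.
rewrite lt_def; apply/andP; split; last by case: (h) => a b; exact: sqrtr_ge0.
by apply: contra hn => /eqP/Normc.eq0_normc ->.
Qed.

(** The complex derivative gives the real differential. *)
Lemma complex_derivable_differentiable (R : realType) (G : cplx R -> cplx R)
    (z : cplx R) : derivable G z 1 ->
  differentiable (fun q : 'rV[R]_2 => xy_of (G (z_of q))) (xy_of z) /\
  forall w, 'd (fun q : 'rV[R]_2 => xy_of (G (z_of q))) (xy_of z) w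
    = cmul ('D_1 G z) w.
Proof.
move=> dG.
pose L : {linear 'rV[R]_2 -> 'rV[R]_2} :=
  HB.pack (cmul ('D_1 G z)) (GRing.isLinear.Build _ _ _ _ _ (cmul_is_linear ('D_1 G z))).
have [|d dE] := @linear_approx_differentiable R _ _ (fun q : 'rV[R]_2 => xy_of (G (z_of q)))
  L (xy_of z) (@cmul_continuous _ _); last first.
  by split=> // w; rewrite dE.
move=> e e0.
have e2 : 0 < e / 2 by rewrite divr_gt0.
have [dl dl0 hd] := complex_derivable_approx dG e2.
have dl2 : 0 < dl / 2 by rewrite divr_gt0.
apply: (near0_norm dl2) => h hh.
have hn : Normc.normc (z_of h) <= 2 * `|h| by have := normc_le (z_of h); rewrite z_ofK.
have hlt : Normc.normc (z_of h) < dl.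
  by apply: (le_lt_trans hn); rewrite mulrC -ltr_pdivlMr.
have := hd (z_of h) hlt; rewrite z_of_add xy_ofK => H.
rewrite -[L h]/(cmul _ h) /cmul -!xy_of_sub; apply: (le_trans (norm_xy_of_le _)).
apply: (le_trans H); apply: (@le_trans _ _ (e / 2 * (2 * `|h|))).
  by rewrite ler_pM2l.
by rewrite mulrA divfK.
Qed.

(** * Flat boxes from the complex time of an analytic vector field *)

(** A flat box of the frame M on W: a coordinate system f, with inverse e defined
    on ball c r, a square for the norm of the plane, in which the rows of M are the
    coordinate vectors. *)
Definition flat_box (R : realType) (M : 'rV[R]_2 -> 'M[R]_2) (W : set 'rV[R]_2)
    (c : 'rV[R]_2) (r : R) (f e : 'rV[R]_2 -> 'rV[R]_2) : Prop :=
  [/\ open W, smooth_on W f /\ smooth_on (ball c r) e,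
      forall x, W x -> ball c r (f x) /\ e (f x) = x,
      forall y, ball c r y -> W (e y) /\ f (e y) = y &
      (forall x v, W x -> is_derive x v f (v *m invmx (M x))) /\
      (forall y v, ball c r y -> is_derive y v e (v *m M (e y)))].

Lemma diff_left_inverse (R : realType) (V V' : normedModType R) (A : set V)
    (phi : V -> V') (psi : V' -> V) (x v : V) :
  open A -> A x -> (forall y, A y -> psi (phi y) = y) ->
  differentiable phi x -> differentiable psi (phi x) ->
  'd psi (phi x) ('d phi x v) = v.
Proof.
move=> oA Ax K dphi dpsi.
have h1 := is_derive_comp (diff_is_derive v dphi) dpsi.
have nE : \forall y \near x, (psi \o phi) y = id y.
  by apply: filterS (open_nbhs_nbhs (conj oA Ax)) => y /K.
have [_ <-] := is_derive_near nE h1.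
by rewrite derive_id.
Qed.

Lemma cmulA (R : realType) (k l : cplx R) (w : 'rV[R]_2) :
  cmul k (cmul l w) = cmul (k * l) w.
Proof. by rewrite /cmul xy_ofK mulrA. Qed.

Lemma cmul1 (R : realType) (w : 'rV[R]_2) : cmul 1 w = w.
Proof. by rewrite /cmul mul1r z_ofK. Qed.

Lemma xy_of_inv (R : realType) (z : cplx R) :
  xy_of z^-1 0 0 = xy_of z 0 0 * (xy_of z 0 0 * xy_of z 0 0 + xy_of z 0 1 * xy_of z 0 1)^-1 /\
  xy_of z^-1 0 1 = - (xy_of z 0 1 * (xy_of z 0 0 * xy_of z 0 0 + xy_of z 0 1 * xy_of z 0 1)^-1).
Proof. by rewrite !xy_of0 !xy_of1; case: z => a b /=; rewrite !expr2. Qed.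

Lemma xy_of_norm_neq0 (R : realType) (z : cplx R) : z != 0 ->
  xy_of z 0 0 * xy_of z 0 0 + xy_of z 0 1 * xy_of z 0 1 != 0.
Proof.
rewrite xy_of0 xy_of1; case: z => a b /=; apply: contra.
rewrite -!expr2 paddr_eq0 ?sqr_ge0 // !sqrf_eq0 => /andP[/eqP-> /eqP->].
by [].
Qed.

Lemma smooth_inv_field (R : realType) (B : set 'rV[R]_2) (F : cplx R -> cplx R) :
  open B -> (forall q, B q -> F (z_of q) != 0) ->
  smooth_on B (fun q => xy_of (F (z_of q))) ->
  smooth_on B (fun q => xy_of (F (z_of q))^-1).
Proof.
move=> oB F0 sF n; have CF := (Cn_mxP n _ oB).1 (sF n).
have C0 := CF 0 0; have C1 := CF 0 1.
have CN := Cn_add oB (Cn_mul oB C0 C0) (Cn_mul oB C1 C1).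
have CI := Cn_inv oB (fun q Bq => xy_of_norm_neq0 (F0 q Bq)) CN.
apply/Cn_mxP => // i j; rewrite ord1; move: j; apply: forall_ord2.
  apply: Cn_ext oB _ (Cn_mul oB C0 CI) => q _.
  by rewrite (xy_of_inv _).1.
apply: Cn_ext oB _ (Cn_opp oB (Cn_mul oB C1 CI)) => q _.
by rewrite (xy_of_inv _).2.
Qed.

Lemma is_derive_oppf (R : realType) (V W : normedModType R) (f : V -> W) x v l :
  is_derive x v f l -> is_derive x v (fun y => - f y) (- l).
Proof. exact: is_deriveN. Qed.

(** A nowhere zero holomorphic function F has local time coordinates: a primitive
    of 1/F. *)
Lemma time_coordinate (R : realType) (B : set 'rV[R]_2) (F : cplx R -> cplx R)
    (q0 : 'rV[R]_2) :
  open B -> B q0 ->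
  (forall q, B q -> derivable F (z_of q) 1 /\ F (z_of q) != 0) ->
  smooth_on B (fun q => xy_of (F (z_of q))) ->
  exists (r : R) (P : 'rV[R]_2 -> 'rV[R]_2),
    [/\ 0 < r, ball q0 r `<=` B, smooth_on (ball q0 r) P &
      forall q w, ball q0 r q -> 'd P q w = cmul (F (z_of q))^-1 w].
Proof.
move=> oB Bq0 dF sF.
have sg := smooth_inv_field oB (fun q Bq => (dF q Bq).2) sF.
pose G z := (F z)^-1; pose g q := xy_of (G (z_of q)).
have dG q : B q -> derivable G (z_of q) 1.
  by move=> /dF[d n]; exact: derivableV n d.
have dg q w : B q -> is_derive q w g (cmul ('D_1 G (z_of q)) w).
  move=> Bq; have [d dE] := complex_derivable_differentiable (dG q Bq).
  by rewrite z_ofK in d dE; rewrite -dE; exact: diff_is_derive.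
(* The components gj of 1/F and their partial derivatives Dj i j along the axis i,
   which satisfy the Cauchy-Riemann equations. *)
have [gj [Dj [gjE dgj Cg CDg CR]]] : exists (gj : 'I_2 -> 'rV[R]_2 -> R)
    (Dj : 'I_2 -> 'I_2 -> 'rV[R]_2 -> R),
    [/\ forall j q, gj j q = g q 0 j,
        forall i j q, B q -> is_derive q (axis R i) (gj j) (Dj i j q),
        forall n j, Cn_on n B (gj j), forall i j, Cn_on 0 B (Dj i j) &
        forall q, Dj 1 0 q = - Dj 0 1 q /\ Dj 1 1 q = Dj 0 0 q].
  have Cg n j : Cn_on n B (fun q => g q 0 j) := (Cn_mxP n _ oB).1 (sg n) 0 j.
  have dgj i j q : B q ->
      is_derive q (axis R i) (fun q => g q 0 j) (cmul ('D_1 G (z_of q)) (axis R i) 0 j).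
    move=> Bq; have [d <-] := dg q (axis R i) Bq.
    apply: DeriveDef; first exact: (derivable_mxP _ _ _).1.
    by rewrite (derive_mx d) mxE.
  exists (fun j q => g q 0 j), (fun i j q => cmul ('D_1 G (z_of q)) (axis R i) 0 j).
  split=> //.
    move=> i j; apply: Cn_ext oB _ (Cn_derive (axis R i) (Cg 1%N j)) => q Bq.
    by have [_ ->] := dgj i j q Bq.
  move=> q; rewrite !(cmulE0, cmulE1).
  have e0 : (axis R 0) 0 0 = 1 by rewrite axisE.
  have e1 : (axis R 0) 0 1 = 0 by rewrite axisE.
  have e2 : (axis R 1) 0 0 = 0 by rewrite axisE.
  have e3 : (axis R 1) 0 1 = 1 by rewrite axisE.
  by rewrite !(e0, e1, e2, e3); split; ring.
have CR0 q : B q -> is_derive q (axis R 1) (gj 0) (Dj 1 0 q) /\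
    is_derive q (axis R 0) (fun q => - gj 1 q) (Dj 1 0 q).
  move=> Bq; split; first exact: dgj.
  by rewrite (CR q).1; apply: is_derive_oppf; exact: dgj.
have CR1 q : B q -> is_derive q (axis R 1) (gj 1) (Dj 0 0 q) /\
    is_derive q (axis R 0) (gj 0) (Dj 0 0 q).
  by move=> Bq; split; [rewrite -(CR q).2|]; exact: dgj.
(* The real and imaginary parts of dz/F are closed. *)
have [r0 [P0 [r00 B0 dP0]]] := closed_form_exact oB Bq0 (Cg 0%N 0)
  (Cn_opp oB (Cg 0%N 1)) (CDg 1 0) CR0.
have [r1 [P1 [r10 B1 dP1]]] := closed_form_exact oB Bq0 (Cg 0%N 1)
  (Cg 0%N 0) (CDg 0 0) CR1.
pose r := Num.min r0 r1.
have rp : 0 < r by rewrite lt_min r00 r10.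
have i0 q : ball q0 r q -> ball q0 r0 q.
  by apply: le_ball; rewrite ge_min lexx.
have i1 q : ball q0 r q -> ball q0 r1 q.
  by apply: le_ball; rewrite ge_min lexx orbT.
have ob : open (ball q0 r) by exact: ball_open.
have sB n (h : 'rV[R]_2 -> R) : Cn_on n B h -> Cn_on n (ball q0 r) h.
  by apply: Cn_sub => q /i0 /B0.
have C0 n : Cn_on n (ball q0 r) P0.
  apply: Cn_le (leqnSn n) _.
  apply: (@Cn_partials _ n _ P0 (fun i q => if i == 0 then gj 0 q else - gj 1 q)) => //.
    by apply: forall_ord2 => q /i0 /dP0[].
  apply: forall_ord2 => /=; apply: sB; first exact: Cg.
  exact: Cn_opp.
have C1 n : Cn_on n (ball q0 r) P1.
  apply: Cn_le (leqnSn n) _.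
  apply: (@Cn_partials _ n _ P1 (fun i q => if i == 0 then gj 1 q else gj 0 q)) => //.
    by apply: forall_ord2 => q /i1 /dP1[].
  by apply: forall_ord2 => /=; apply: sB; exact: Cg.
pose P q : 'rV[R]_2 := \row_j (if j == 0 then P0 q else P1 q).
have sP : smooth_on (ball q0 r) P.
  move=> n; apply/Cn_mxP => // i j; rewrite ord1; move: j; apply: forall_ord2.
    by apply: Cn_ext ob _ (C0 n) => q _; rewrite mxE.
  by apply: Cn_ext ob _ (C1 n) => q _; rewrite mxE.
exists r, P; split=> //; first by move=> q /i0 /B0.
move=> q w bq.
have dP := C1_differentiable ob (sP 1%N) bq.
have Dm v : 'D_v P q = \matrix_(i, j) 'D_v (fun t => P t i j) q.
  by apply: derive_mx; exact: diff_derivable.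
have PE0 : (fun x => P x 0 0) = P0 by apply/funext => x; rewrite mxE.
have PE1 : (fun x => P x 0 1) = P1 by apply/funext => x; rewrite mxE.
have [[_ d00] [_ d01]] := dP0 _ (i0 _ bq).
have [[_ d10] [_ d11]] := dP1 _ (i1 _ bq).
have dPj j : 'd P q w 0 j = w 0 0 * 'D_(axis R 0) (fun t => P t 0 j) q
    + w 0 1 * 'D_(axis R 1) (fun t => P t 0 j) q.
  by rewrite (diff_axis _ dP) !Dm [LHS]mxE [X in X + _]mxE [X in _ + X]mxE !mxE.
apply: row2P; rewrite dPj.
  by rewrite PE0 d00 d01 !gjE cmulE0 /g xy_of0 xy_of1 /G; ring.
by rewrite PE1 d10 d11 !gjE cmulE1 /g xy_of0 xy_of1 /G; ring.
Qed.

(** A map that satisfies a differential equation with smooth coefficients is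
    smooth. *)
Lemma smooth_frame_solution (R : realType) (W B : set 'rV[R]_2)
    (M : 'rV[R]_2 -> 'M[R]_2) (e : 'rV[R]_2 -> 'rV[R]_2) :
  open W -> open B -> smooth_on W M -> (forall y, B y -> W (e y)) ->
  (forall y, B y -> differentiable e y /\ forall v, 'd e y v = v *m M (e y)) ->
  smooth_on B e.
Proof.
move=> oW oB sM eW de n.
have ce y : B y -> {for y, continuous e}.
  by move=> /de[d _]; exact: differentiable_continuous.
elim: n => [|n IH]; first by split.
apply: (@Cn_intro _ _ _ n B _ (fun v y => v *m M (e y))) => //.
  by move=> v y /de[d <-]; exact: diff_is_derive.
move=> v; apply: Cn_mulmx => //; first exact: Cn_cst.
exact: (@Cn_comp _ _ _ _ n B W M e).
Qed.

(** In a complex chart with inverse psi, the frame consisting of Re F and Re (i F)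
    admits flat boxes. *)
Lemma chart_flat_box (R : realType) (A B : set 'rV[R]_2) (phi psi : 'rV[R]_2 -> 'rV[R]_2)
    (F : cplx R -> cplx R) (M : 'rV[R]_2 -> 'M[R]_2) (p : 'rV[R]_2) :
  diffeo_on A B phi psi -> A p ->
  (forall q, B q -> derivable F (z_of q) 1 /\ F (z_of q) != 0) ->
  smooth_on B (fun q => xy_of (F (z_of q))) ->
  smooth_on A M ->
  (forall x w, A x -> w *m M x = 'd psi (phi x) (cmul (F (z_of (phi x))) w)) ->
  exists W r f e, [/\ W p, W `<=` A & flat_box M W (f p) r f e].
Proof.
move=> [oA oB sphi spsi [AB K]] Ap dF sF sM ME.
have Bphi x : A x -> B (phi x) by move=> Ax; rewrite -AB; exists x.
have [r [P [r0 rB sP dP]]] := time_coordinate oB (Bphi p Ap) dF sF.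
have dphi x : A x -> differentiable phi x by exact: C1_differentiable oA (sphi 1%N).
have dpsi q : B q -> differentiable psi q by exact: C1_differentiable oB (spsi 1%N).
have ob : open (ball (phi p) r) by exact: ball_open.
pose A1 := A `&` phi @^-1` (ball (phi p) r).
have oA1 : open A1.
  rewrite openE => x [Ax bx]; apply: filterI.
    exact: open_nbhs_nbhs (conj oA Ax).
  by apply: (Cn_continuous (sphi 0%N) Ax); exact: ball_nbhs.
have A1p : A1 p by split=> //; exact: ballxx.
have A1A : A1 `<=` A by move=> x [].
(* The complex time, read on the plane. *)
pose f := P \o phi.
have sf : smooth_on A1 f.
  move=> n; apply: (@Cn_comp _ _ _ _ n A1 (ball (phi p) r)) => //.
    by move=> x [].
  exact: Cn_sub (sphi n).
have fM x v : A1 x -> 'D_v f x *m M x = v.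
  move=> [Ax bx]; have dPx := C1_differentiable ob (sP 1%N) bx.
  have := is_derive_comp (diff_is_derive v (dphi x Ax)) dPx.
  rewrite dP // => -[_ ->]; rewrite ME // cmulA divff ?cmul1; last first.
    by have [] := dF _ (Bphi x Ax).
  exact: diff_left_inverse oA Ax K (dphi x Ax) (dpsi _ (Bphi x Ax)).
have uM x : A1 x -> M x \in unitmx.
  move=> A1x; pose Jx : 'M[R]_2 := \matrix_i 'D_(axis R i) f x.
  have JM : Jx *m M x = 1%:M.
    by apply/row_matrixP => i; rewrite row_mul rowK fM // row1.
  by have [] := mulmx1_unit JM.
have [W [s [e [[s0 oW] [WA Wp] Wf We de]]]] := local_inverse oA1 A1p (sf 1%N) fM.
exists W, s, f, e; split=> //; first by move=> x /WA /A1A.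
split=> //.
- split; first by move=> n; exact: Cn_sub (sf n).
  apply: (@smooth_frame_solution _ W _ M) => //; first exact: ball_open.
    by move=> n; apply: Cn_sub (sM n) => x /WA /A1A.
  by move=> y /We[].
- split; last by move=> y v /de[d <-]; exact: diff_is_derive.
  move=> x v Wx; have A1x := WA x Wx.
  have -> : v *m invmx (M x) = 'D_v f x by rewrite -{1}(fM x v A1x) mulmxK ?uM.
  exact: Cn_is_derive (sf 1%N) A1x.
Qed.

(** * The frame of an analytic vector field *)

(** The frame of the complex field F, at p in the domain of the chart k: its rows
    are Re F and Re (i F). *)
Definition chart_frame (R : realType) (F : chart R -> cplx R -> cplx R) (k : chart R)
    (p : 'rV[R]_2) : 'M[R]_2 :=
  \matrix_i 'd (fun q => coord_inv k (z_of q)) (xy_of (zcoord k p))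
               (cmul (F k (zcoord k p)) (axis R i)).

Lemma chart_frame_mul (R : realType) (F : chart R -> cplx R -> cplx R) (k : chart R)
    (p w : 'rV[R]_2) :
  w *m chart_frame F k p = 'd (fun q => coord_inv k (z_of q)) (xy_of (zcoord k p))
               (cmul (F k (zcoord k p)) w).
Proof.
rewrite {2}(rV2E w).
have clin := cmul_is_linear (F k (zcoord k p)).
have -> : cmul (F k (zcoord k p)) (w 0 0 *: axis R 0 + w 0 1 *: axis R 1) =
   w 0 0 *: cmul (F k (zcoord k p)) (axis R 0) + w 0 1 *: cmul (F k (zcoord k p)) (axis R 1).
  have e v : cmul (F k (zcoord k p)) (w 0 1 *: v) = w 0 1 *: cmul (F k (zcoord k p)) v.
    have := clin (w 0 1) v 0; rewrite addr0 => ->.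
    by rewrite (_ : cmul _ 0 = 0) ?addr0 //; apply: row2P; rewrite ?cmulE0 ?cmulE1 !mxE; ring.
  by rewrite clin e.
rewrite linearD !linearZ /= {1}(rV2E w) mulmxDl -!scalemxAl.
by rewrite -!rowE !rowK.
Qed.

Lemma cmul_axis0 (R : realType) (l : cplx R) : cmul l (axis R 0) = xy_of l.
Proof.
apply: row2P; rewrite ?cmulE0 ?cmulE1 ?xy_of0 ?xy_of1 !axisE /=.
  by rewrite mulr1 mulr0 subr0.
by rewrite mulr1 mulr0 add0r.
Qed.

Lemma diff_comp_at (R : realType) (V V' W : normedModType R) (k : V -> V')
    (g : V' -> W) (x : V) (y : V') (v : V) :
  differentiable k x -> k x = y -> differentiable g y ->
  'd (g \o k) x v = 'd g y ('d k x v).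
Proof. by move=> dk <- dg; rewrite diff_comp. Qed.

(** The holomorphic field on U provides a smooth frame with first row X that has
    flat boxes everywhere. *)
Lemma flat_frame (R : realType) (U : set 'rV[R]_2) (X : 'rV[R]_2 -> 'rV[R]_2)
    (J : set (chart R)) (F : chart R -> cplx R -> cplx R) :
  smooth_on U X -> (forall p, U p -> X p != 0) ->
  complex_structure U J -> analytic_field J F -> is_real_part J F X ->
  exists M : 'rV[R]_2 -> 'M[R]_2,
  [/\ smooth_on U M, forall p, U p -> M p \in unitmx,
      forall p, U p -> axis R 0 *m M p = X p &
      forall p, U p -> exists W r f e, [/\ W p, W `<=` U & flat_box M W (f p) r f e]].
Proof.
move=> sX X0 [oU Jc Jcov Jtr] [Fd Ftr] FX.
pose phi (k : chart R) p := xy_of (zcoord k p).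
pose psi (k : chart R) q := coord_inv k (z_of q).
pose B (k : chart R) := [set phi k p | p in cdom k].
have dk k : J k -> cdom k `<=` U /\ diffeo_on (cdom k) (B k) (phi k) (psi k).
  exact: Jc.
have K k p : J k -> cdom k p -> psi k (phi k p) = p.
  by move=> /dk[_ [_ _ _ _ [_ h]]]; exact: h.
have oA k : J k -> open (cdom k) by move=> /dk[_ []].
have oB k : J k -> open (B k) by move=> /dk[_ []].
have dphi k p : J k -> cdom k p -> differentiable (phi k) p.
  by move=> Jk; have [_ [op _ s _ _]] := dk k Jk; exact: C1_differentiable op (s 1%N).
have dpsi k q : J k -> B k q -> differentiable (psi k) q.
  by move=> Jk; have [_ [_ op _ s _]] := dk k Jk; exact: C1_differentiable op (s 1%N).
have Bphi k p : cdom k p -> B k (phi k p) by move=> h; exists p.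
have Kd k p v : J k -> cdom k p -> 'd (psi k) (phi k p) ('d (phi k) p v) = v.
  move=> Jk kp; exact: (diff_left_inverse v (oA k Jk) kp (fun y => K k y Jk)
    (dphi k p Jk kp) (dpsi k _ Jk (Bphi k p kp))).
have Bq k q : J k -> B k q -> exists2 p, cdom k p & q = phi k p.
  by move=> Jk [p kp <-]; exists p.
have Kd' k p w : J k -> cdom k p -> 'd (phi k) p ('d (psi k) (phi k p) w) = w.
  move=> Jk kp; have dps := dpsi k _ Jk (Bphi k p kp).
  have KB q : B k q -> phi k (psi k q) = q.
    by move=> /(Bq k _ Jk)[x kx ->]; rewrite (K k x Jk kx).
  have dph := dphi k p Jk kp; rewrite -(K k p Jk kp) in dph.
  have := diff_left_inverse w (oB k Jk) (Bphi k p kp) KB dps dph.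
  by rewrite (K k p Jk kp).
(* The frame does not depend on the chart, by the transformation rules of F and of
   differentials. *)
have indep k l p : J k -> J l -> cdom k p -> cdom l p ->
    chart_frame F k p = chart_frame F l p.
  move=> Jk Jl kp lp.
  suff h (w : 'rV[R]_2) : w *m chart_frame F k p = w *m chart_frame F l p.
    by rewrite -[LHS]mul1mx -[RHS]mul1mx; apply/row_matrixP => i; rewrite !row_mul h.
  rewrite !chart_frame_mul -/(psi k) -/(psi l) -/(phi k p) -/(phi l p).
  have dT := Jtr k l p Jk Jl kp lp.
  have [dTr dTE] := complex_derivable_differentiable dT.
  have E v : 'd (phi l) p ('d (psi k) (phi k p) v)
      = cmul ('D_1 (zcoord l \o coord_inv k : cplx R -> cplx R) (zcoord k p)) v.
    have fE : phi l \o psi k =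
        (fun q => xy_of ((zcoord l \o coord_inv k) (z_of q))) by [].
    have E1 := dTE v; rewrite -fE -/(phi k p) in E1.
    rewrite -[RHS]E1; apply: esym.
    exact: (diff_comp_at v (dpsi k _ Jk (Bphi k p kp)) (K k p Jk kp) (dphi l p Jl lp)).
  apply: (etrans (esym (Kd l p _ Jl lp))); apply: f_equal.
  by rewrite E cmulA -(Ftr k l p Jk Jl kp lp).
pose M p := xget 0 [set m | exists2 k, J k /\ cdom k p & m = chart_frame F k p].
have ME k p : J k -> cdom k p -> M p = chart_frame F k p.
  move=> Jk kp; rewrite /M; case: xgetP => [m _ [l [Jl lp] ->]|h].
    exact: indep.
  by exfalso; apply: (h (chart_frame F k p)); exists k.
have FXE k p : J k -> cdom k p ->
    X p = 'd (psi k) (phi k p) (xy_of (F k (zcoord k p))).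
  move=> Jk kp; rewrite (FX k p Jk kp) (diff_axis _ (dpsi _ _ Jk (Bphi k p kp))).
  by rewrite xy_of0 xy_of1.
have F0 k p : J k -> cdom k p -> F k (zcoord k p) != 0.
  move=> Jk kp; apply/eqP => FE; have := X0 p ((dk k Jk).1 _ kp).
  rewrite (FXE k p Jk kp) FE.
  have -> : xy_of (0 : cplx R) = 0 by apply: row2P; rewrite ?xy_of0 ?xy_of1 mxE.
  by rewrite linear0 eqxx.
have zphi k p : z_of (phi k p) = zcoord k p by rewrite /phi xy_ofK.
(* F is smooth in a chart, since it is the image of the smooth field X. *)
have sF k : J k -> smooth_on (B k) (fun q => xy_of (F k (z_of q))).
  move=> Jk n; have [kU [_ _ sphi spsi _]] := dk k Jk.
  have CX := Cn_sub kU (sX n).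
  have CXj j := (Cn_mxP n X (oA k Jk)).1 CX 0 j.
  have CD i := Cn_derive (axis R i) (sphi n.+1).
  have Ch := Cn_add (oA k Jk) (Cn_scale (oA k Jk) (CXj 0) (CD 0))
                              (Cn_scale (oA k Jk) (CXj 1) (CD 1)).
  have psiA q : B k q -> cdom k (psi k q) by move=> /(Bq k _ Jk)[p kp ->]; rewrite K.
  apply: Cn_ext (oB k Jk) _ (Cn_comp (oB k Jk) (oA k Jk) psiA Ch (spsi n)) => q.
  move=> /(Bq k _ Jk)[p kp ->] /=; rewrite K // zphi.
  by rewrite -(diff_axis _ (dphi k p Jk kp)) (FXE k p Jk kp) Kd'.
have sM k : J k -> smooth_on (cdom k) M.
  move=> Jk n; have [_ [_ _ sphi spsi _]] := dk k Jk.
  have oAk := oA k Jk.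
  have Bp x : cdom k x -> B k (phi k x) by exact: Bphi.
  have Cxi := (Cn_mxP n _ oAk).1 (Cn_comp oAk (oB k Jk) Bp (sF k Jk n) (sphi n)).
  have CD i := Cn_comp oAk (oB k Jk) Bp (Cn_derive (axis R i) (spsi n.+1)) (sphi n).
  have row_smooth (u v : 'rV[R]_2 -> R) := fun Cu Cv =>
    @Cn_add _ _ _ n _ _ _ oAk (@Cn_scale _ _ _ _ n _ u _ oAk Cu (CD 0))
                              (@Cn_scale _ _ _ _ n _ v _ oAk Cv (CD 1)).
  have C0 := row_smooth _ _ (Cxi 0 0) (Cxi 0 1).
  have C1 := row_smooth _ _ (Cn_opp oAk (Cxi 0 1)) (Cxi 0 0).
  apply/Cn_mxP => //; apply: forall_ord2 => j.
    apply: Cn_ext oAk _ ((Cn_mxP n _ oAk).1 C0 0 j) => x kx.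
    rewrite (ME k x Jk kx) [RHS]mxE (diff_axis _ (dpsi _ _ Jk (Bp x kx))) /=.
    by rewrite zphi cmul_axis0.
  apply: Cn_ext oAk _ ((Cn_mxP n _ oAk).1 C1 0 j) => x kx.
  rewrite (ME k x Jk kx) [RHS]mxE (diff_axis _ (dpsi _ _ Jk (Bp x kx))) /=.
  rewrite zphi cmulE0 cmulE1 !axisE /= !mulr1 !mulr0 sub0r addr0 xy_of0 xy_of1.
  by [].
have box p : U p -> exists W r f e, [/\ W p, W `<=` U & flat_box M W (f p) r f e].
  move=> /Jcov[k Jk kp]; have [kU dif] := dk k Jk.
  have [||||W [r [f [e [Wp WA fb]]]]] := @chart_flat_box _ (cdom k) (B k) (phi k)
    (psi k) (F k) M p dif kp.
  - move=> q /(Bq k _ Jk)[x kx ->]; rewrite zphi; split; last exact: F0.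
    exact: Fd.
  - exact: sF.
  - exact: sM.
  - by move=> x w kx; rewrite (ME k x Jk kx) chart_frame_mul zphi.
  by exists W, r, f, e; split=> //; exact: subset_trans WA kU.
exists M; split=> //.
- move=> n; apply: Cn_local => p /Jcov[k Jk kp]; exists (cdom k) => //.
  exact: sM.
- move=> p /Jcov[k Jk kp].
  pose N : 'M[R]_2 := \matrix_i cmul (F k (zcoord k p))^-1 ('d (phi k) p (axis R i)).
  have NM : N *m M p = 1%:M.
    apply/row_matrixP => i; rewrite row_mul rowK (ME k p Jk kp) chart_frame_mul.
    by rewrite cmulA divff ?F0 // cmul1 -/(psi k) -/(phi k p) Kd // row1.
  by have [] := mulmx1_unit NM.
- move=> p /Jcov[k Jk kp].
  by rewrite (ME k p Jk kp) chart_frame_mul cmul_axis0 (FXE k p Jk kp).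
Qed.

(** * The flat metric *)

(** A flat structure on U: a smooth frame M of the plane over U, whose rows are
    locally the coordinate vectors of flat boxes. *)
Definition flat_structure (R : realType) (U : set 'rV[R]_2)
    (M : 'rV[R]_2 -> 'M[R]_2) : Prop :=
  [/\ open U, smooth_on U M, forall p, U p -> M p \in unitmx &
      forall p, U p -> exists W r f e, [/\ W p, W `<=` U & flat_box M W (f p) r f e]].

(** The metric for which the frame M is orthonormal. *)
Definition frame_metric (R : realType) (M : 'rV[R]_2 -> 'M[R]_2)
    (p : 'rV[R]_2) : 'M[R]_2 := invmx (M p) *m (invmx (M p))^T.

Lemma frame_metricE (R : realType) (M : 'rV[R]_2 -> 'M[R]_2) (p u v : 'rV[R]_2) :
  u *m frame_metric M p *m v^T = (u *m invmx (M p)) *m (v *m invmx (M p))^T.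
Proof. by rewrite /frame_metric trmx_mul !mulmxA. Qed.

Lemma frame_metric_riemannian (R : realType) (U : set 'rV[R]_2)
    (M : 'rV[R]_2 -> 'M[R]_2) :
  flat_structure U M -> riemannian_metric U (frame_metric M).
Proof.
move=> [oU sM uM _]; split=> //.
- move=> n; have CA := Cn_invmx oU uM (sM n).
  have CAt : Cn_on n U (fun x => (invmx (M x))^T).
    apply/Cn_mxP => // i j; apply: Cn_ext oU _ ((Cn_mxP n _ oU).1 CA j i) => x _.
    by rewrite [RHS]mxE.
  exact: Cn_mulmx oU CA CAt.
- by move=> p _; rewrite /frame_metric trmx_mul trmxK.
- move=> p v Up v0; rewrite frame_metricE.
  have : v *m invmx (M p) != 0.
    apply: contra v0 => /eqP w0.
    by rewrite -[v]mulmx1 -(mulVmx (uM p Up)) mulmxA w0 mul0mx.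
  move: (v *m invmx (M p)) => w wn.
  rewrite mxE big_ord_recl big_ord1 !mxE -!expr2.
  rewrite lt_def addr_ge0 ?sqr_ge0 // andbT paddr_eq0 ?sqr_ge0 // !sqrf_eq0.
  apply: contra wn => /andP[/eqP w0 /eqP w1]; apply/eqP; apply: row2P; rewrite [RHS]mxE //.
  have l1 : lift (0 : 'I_2) 0 = 1 by apply/val_inj.
  by rewrite l1 in w1.
Qed.

Lemma frame_metric_flat (R : realType) (U : set 'rV[R]_2)
    (M : 'rV[R]_2 -> 'M[R]_2) :
  flat_structure U M -> flat_metric U (frame_metric M).
Proof.
move=> [oU sM uM box] p /box[W [r [f [e [Wp WU [oW [sf se] Wf We [df de]]]]]]].
exists W, (ball (f p) r), f, e; split=> //.
  split=> //; first exact: ball_open.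
  split; last by move=> x /Wf[].
  apply/seteqP; split=> [_ [x Wx <-]|y /We[We1 <-]]; first by have [] := Wf x Wx.
  by exists (e y).
move=> x u v Wx; rewrite frame_metricE.
by have [_ ->] := df x u Wx; have [_ ->] := df x v Wx.
Qed.

(** The dual coframe of a flat structure is closed: it is the differential of the
    flat coordinates. *)
Lemma coframe_closed (R : realType) (U : set 'rV[R]_2) (M : 'rV[R]_2 -> 'M[R]_2)
    (p : 'rV[R]_2) (i j a : 'I_2) :
  flat_structure U M -> U p ->
  'D_(axis R i) (fun y => invmx (M y) j a) p = 'D_(axis R j) (fun y => invmx (M y) i a) p.
Proof.
move=> [oU sM uM box] Up; have [W [r [f [e [Wp WU [oW _ _ _ [df _]]]]]]] := box p Up.
have CA n := Cn_invmx oU uM (sM n).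
have CAj n k : Cn_on n U (fun y => invmx (M y) k a) := (Cn_mxP n _ oU).1 (CA n) k a.
have [A [AE CA2 dfA]] : exists A : 'I_2 -> 'rV[R]_2 -> R,
    [/\ A = fun k y => invmx (M y) k a, forall n k, Cn_on n U (A k) &
        forall y k, W y -> is_derive y (axis R k) (fun y => f y 0 a) (A k y)].
  exists (fun k y => invmx (M y) k a); split=> // y k Wy.
  have [d dE] := df y (axis R k) Wy.
  apply: DeriveDef; first exact: (derivable_mxP _ _ _).1.
  have := derive_mx d; rewrite dE => /matrixP/(_ 0 a).
  by rewrite [RHS]mxE /axis -rowE [LHS]mxE => <-.
have CD k l : Cn_on 0 U ('D_(axis R k) (A l)) by apply: Cn_derive.
have H : 'D_(axis R i) (A j) p = 'D_(axis R j) (A i) p.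
  apply: (@mixed_derivatives_sym _ 'rV[R]_2 (fun y => f y 0 a) (A j) (A i)
    ('D_(axis R i) (A j)) ('D_(axis R j) (A i)) p (axis R j) (axis R i)).
  - apply: filterS (filterI (open_nbhs_nbhs (conj oW Wp)) (open_nbhs_nbhs (conj oU Up))).
    move=> y [Wy Uy]; split; try exact: dfA.
      exact: (Cn_is_derive (axis R i) (CA2 1%N j) Uy).
    exact: (Cn_is_derive (axis R j) (CA2 1%N i) Uy).
  - exact: Cn_continuous (CD i j) Up.
  - exact: Cn_continuous (CD j i) Up.
by move: H; rewrite AE.
Qed.

(** X is the first row of the frame; in the coframe A = invmx M, the derivative of
    the constant row X *m A gives D_X X = - X *m D_X A *m M, while the Christoffel
    symbols of A *m A^T are the entries of the derivative of A, times M. *)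
Lemma frame_metric_geodesic (R : realType) (U : set 'rV[R]_2)
    (M : 'rV[R]_2 -> 'M[R]_2) (X : 'rV[R]_2 -> 'rV[R]_2) :
  flat_structure U M -> (forall p, U p -> axis R 0 *m M p = X p) ->
  geodesic_field U (frame_metric M) X.
Proof.
move=> FS XM p Up; have [oU sM uM box] := FS.
have CA n := Cn_invmx oU uM (sM n).
have nU : \forall y \near p, U y := open_nbhs_nbhs (conj oU Up).
pose A y := invmx (M y).
have [B BE] : exists B : 'I_2 -> 'I_2 -> 'I_2 -> R,
    forall i j a, is_derive p (axis R i) (fun y => A y j a) (B i j a).
  exists (fun i j a => 'D_(axis R i) (fun y => A y j a) p) => i j a.
  exact: Cn_is_derive (axis R i) ((Cn_mxP 1 _ oU).1 (CA 1%N) j a) Up.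
have Bsym i j a : B i j a = B j i a.
  by have [_ <-] := BE i j a; have [_ <-] := BE j i a; exact: coframe_closed FS Up.
pose g := frame_metric M.
have gE y i j : g y i j = A y i 0 * A y j 0 + A y i 1 * A y j 1.
  rewrite mxE big_ord_recl big_ord1 ![(_^T) _ _]mxE.
  by have -> : lift (0 : 'I_2) 0 = 1 by apply/val_inj.
have dg k i j : 'D_(axis R k) (fun y => g y i j) p =
    (A p i 0 * B k j 0 + A p j 0 * B k i 0) + (A p i 1 * B k j 1 + A p j 1 * B k i 1).
  apply: is_derive_val.
  have -> : (fun y => g y i j) = (fun y => A y i 0) * (fun y => A y j 0)
     + (fun y => A y i 1) * (fun y => A y j 1) by apply/funext => y; rewrite gE.
  by apply: is_deriveD; apply: is_deriveM; exact: BE.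
have gV : invmx (g p) = (M p)^T *m M p.
  have E : g p *m ((M p)^T *m M p) = 1%:M.
    rewrite /g /frame_metric mulmxA -(mulmxA (invmx _)) -trmx_mul mulmxV ?uM //.
    by rewrite trmx1 mulmx1 mulVmx ?uM.
  by rewrite -[RHS]mul1mx -(mulVmx (mulmx1_unit E).1) -mulmxA E mulmx1.
(* The symmetry of B cancels all but one of the terms of the Christoffel symbols. *)
have chrE k i j : christoffel g p k i j = M p 0 k * B i j 0 + M p 1 k * B i j 1.
  rewrite /christoffel.
  pose beta : 'cV[R]_2 := \col_a B i j a.
  have -> : \sum_(l < 2) invmx (g p) k l *
      ('D_(axis R i) (fun q => g q j l) p + 'D_(axis R j) (fun q => g q i l) p
       - 'D_(axis R l) (fun q => g q i j) p) =
      \sum_(l < 2) 2 * (invmx (g p) k l * (A p *m beta) l 0).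
    apply: eq_bigr => l _; rewrite !dg [(A p *m beta) l 0]mxE big_ord_recl big_ord1.
    have -> : lift (0 : 'I_2) 0 = 1 by apply/val_inj.
    rewrite ![beta _ _]mxE !(Bsym j i) !(Bsym i l) !(Bsym j l).
    by move: (invmx (g p) k l) => c; ring.
  rewrite -mulr_sumr mulKf ?pnatr_eq0 //.
  transitivity ((invmx (g p) *m (A p *m beta)) k 0); first by rewrite [RHS]mxE.
  rewrite gV -mulmxA (mulmxA (M p)) /A mulmxV ?uM // mul1mx.
  rewrite mxE big_ord_recl big_ord1 ![(_^T) _ _]mxE ![beta _ _]mxE.
  by have -> : lift (0 : 'I_2) 0 = 1 by apply/val_inj.
have sX : Cn_on 1 U X.
  apply: Cn_ext oU _ (Cn_mulmx oU (Cn_cst 1 (axis R 0) oU) (sM 1%N)) => y.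
  exact: XM.
have dX := C1_differentiable oU sX Up.
set v := X p.
have [Y YE] : exists Y : 'rV[R]_2, is_derive p v X Y by exists ('d X p v); exact: diff_is_derive.
have Yj j : is_derive p v (fun y => X y 0 j) (Y 0 j).
  have [d dE] := YE; apply: DeriveDef; first exact: (derivable_mxP _ _ _).1.
  by have := derive_mx d; rewrite dE => /matrixP/(_ 0 j); rewrite [RHS]mxE.
have Av j a : is_derive p v (fun y => A y j a) (v 0 0 * B 0 j a + v 0 1 * B 1 j a).
  have dA : differentiable (fun y => A y j a) p.
    exact: C1_differentiable_real oU ((Cn_mxP 1 _ oU).1 (CA 1%N) j a) Up.
  have := diff_is_derive v dA; rewrite (diff_axis _ dA).
  by have [_ ->] := BE 0 j a; have [_ ->] := BE 1 j a.
pose DA : 'M[R]_2 := \matrix_(j, a) (v 0 0 * B 0 j a + v 0 1 * B 1 j a).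
have rel : Y *m A p + v *m DA = 0.
  apply/rowP => a; rewrite [LHS]mxE [(Y *m A p) 0 a]mxE [(v *m DA) 0 a]mxE !big_ord_recl !big_ord0.
  have -> : lift (0 : 'I_2) 0 = 1 by apply/val_inj.
  rewrite !addr0 ![DA _ _]mxE [RHS]mxE.
  have h : is_derive p v ((fun y => X y 0 0) * (fun y => A y 0 a)
      + (fun y => X y 0 1) * (fun y => A y 1 a))
     ((v 0 0 * (v 0 0 * B 0 0 a + v 0 1 * B 1 0 a) + A p 0 a * Y 0 0) +
      (v 0 1 * (v 0 0 * B 0 1 a + v 0 1 * B 1 1 a) + A p 1 a * Y 0 1)).
    by apply: is_deriveD; apply: is_deriveM; (exact: Yj || exact: Av).
  have nE : \forall y \near p, ((fun y => X y 0 0) * (fun y => A y 0 a)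
      + (fun y => X y 0 1) * (fun y => A y 1 a)) y = cst (axis R 0 0 a : R) y.
    apply: filterS nU => y Uy; rewrite /= -[RHS]/(axis R 0 0 a).
    have : X y *m A y = axis R 0 by rewrite -XM // -mulmxA mulmxV ?uM // mulmx1.
    move=> /rowP/(_ a) <-; rewrite [RHS]mxE big_ord_recl big_ord1.
    by have -> : lift (0 : 'I_2) 0 = 1 by apply/val_inj.
  have [_] := is_derive_near nE h; rewrite derive_cst => E.
  by rewrite [RHS]E; ring.
(* Differentiating the constant row X *m A along X. *)
have YM : Y = - (v *m DA *m M p).
  have E : Y *m A p = - (v *m DA) by apply/eqP; rewrite -addr_eq0 rel.
  by rewrite -[Y]mulmx1 -(mulVmx (uM p Up)) mulmxA -/(A p) E mulNmx.
rewrite /covariant_derivative -/v (is_derive_val YE) YM.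
apply/rowP => k; rewrite [LHS]mxE [X in X + _]mxE [X in _ + X]mxE [RHS]mxE.
rewrite [(v *m DA *m M p) 0 k]mxE !big_ord_recl !big_ord0 -/g !chrE.
rewrite ![(v *m DA) 0 _]mxE !big_ord_recl !big_ord0.
have -> : lift (0 : 'I_2) 0 = 1 by apply/val_inj.
by rewrite ![DA _ _]mxE -/v; ring.
Qed.

(** * Curves of constant velocity *)

(** Induction along a real segment. *)
Lemma segment_induction (R : realType) (P : R -> Prop) (a b : R) :
  P a ->
  (forall t, a < t <= b -> (forall s, a <= s < t -> P s) -> P t) ->
  (forall t, a <= t < b -> P t -> exists2 d : R, 0 < d &
     forall s, t < s < t + d -> s <= b -> P s) ->
  forall t, a <= t <= b -> P t.
Proof.
move=> Pa left right t /andP[at_ tb].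
pose E := [set s : R | a <= s <= b /\ forall u, a <= u <= s -> P u].
have ab : a <= b by exact: le_trans tb.
have Ea : E a.
  split; first by rewrite lexx ab.
  by move=> u /andP[h1 h2]; rewrite (_ : u = a) //; apply/eqP; rewrite eq_le h1 h2.
have Eb : has_sup E.
  by split; [exists a|exists b => s [/andP[_ sb] _]].
pose s0 := sup E.
have as0 : a <= s0 by exact: ub_le_sup Eb.2 _ Ea.
have s0b : s0 <= b by apply: ge_sup; [exists a|move=> s [/andP[_ sb] _]].
have below u : a <= u < s0 -> P u.
  move=> /andP[au us].
  have us0 : 0 < s0 - u by rewrite subr_gt0.
  have [s [_ hs] us'] := sup_adherent us0 Eb.
  apply: hs; rewrite au /= ltW //.
  by move: us'; rewrite -/s0 subKr.
have Ps0 : P s0.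
  move: as0; rewrite le_eqVlt => /orP[/eqP <- //|as0].
  by apply: left => //; rewrite as0.
have upto u : a <= u <= s0 -> P u.
  move=> /andP[au]; rewrite le_eqVlt => /orP[/eqP-> //|us].
  by apply: below; rewrite au us.
suff E0 : s0 = b by apply: upto; rewrite at_ E0.
apply/eqP; rewrite eq_le s0b /= leNgt; apply/negP => s0ltb.
have [d d0 hd] := right s0 ltac:(by rewrite as0 s0ltb) Ps0.
pose s1 := Num.min b (s0 + d / 2).
have s01 : s0 < s1 by rewrite lt_min s0ltb ltrDl divr_gt0.
have Es1 : E s1.
  split; first by rewrite (le_trans as0 (ltW s01)) ge_min lexx.
  move=> u /andP[au us1]; have [us0|s0u] := leP u s0.
    by apply: upto; rewrite au us0.
  move: us1; rewrite le_min => /andP[ub us1].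
  apply: hd => //; rewrite s0u /=; apply: le_lt_trans us1 _.
  by rewrite ltrD2l ltr_pdivrMr // ltr_pMr // ltr1n.
by have := ub_le_sup Eb.2 Es1; rewrite leNgt s01.
Qed.

(** In a flat box, a curve of constant velocity with respect to the frame is a
    straight line. *)
Lemma flat_box_line (R : realType) (M : 'rV[R]_2 -> 'M[R]_2) (W : set 'rV[R]_2)
    (c : 'rV[R]_2) (r : R) (f e : 'rV[R]_2 -> 'rV[R]_2) (g : R -> 'rV[R]_2)
    (w : 'rV[R]_2) (a b : R) :
  flat_box M W c r f e ->
  (forall x, W x -> M x \in unitmx) ->
  (forall s : R, 0 <= s <= 1 -> let t := s * (b - a) + a in
     W (g t) /\ is_derive t (1 : R) g (w *m M (g t))) ->
  f (g b) = f (g a) + (b - a) *: w.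
Proof.
move=> [oW [sf _] _ _ [df _]] uM hg.
apply: (@curve_affine _ _ (f \o g)) => s s01; have [Wg dg] := hg s s01.
have dif := C1_differentiable oW (sf 1%N) Wg.
have := is_derive_comp dg dif.
have [_ E] := df _ (w *m M (g (s * (b - a) + a))) Wg.
by rewrite -deriveE // E mulmxK ?uM.
Qed.

Lemma continuous_is_derive (R : realType) (W : normedModType R) (g : R -> W) t l :
  is_derive t (1 : R) g l -> {for t, continuous g}.
Proof. by move=> [d _]; apply: differentiable_continuous; exact/derivable1_diffP. Qed.

Lemma right_segment (R : realType) (P : set R) (t : R) : nbhs t P ->
  exists2 d : R, 0 < d & forall s, t - d < s < t + d -> P s.
Proof.
move=> /near_ball[d d0 h]; exists d => // s hs; apply: h.
by rewrite -ball_normE /= ltr_norml; move: hs; lra.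
Qed.

(** Two curves with the same constant velocity coincide when they have a common
    starting point. *)
Lemma flat_curve_unique (R : realType) (U : set 'rV[R]_2) (M : 'rV[R]_2 -> 'M[R]_2)
    (g1 g2 : R -> 'rV[R]_2) (w : 'rV[R]_2) (a b : R) :
  flat_structure U M ->
  (forall t, a <= t <= b -> U (g1 t) /\ is_derive t (1 : R) g1 (w *m M (g1 t))) ->
  (forall t, a <= t <= b -> U (g2 t) /\ is_derive t (1 : R) g2 (w *m M (g2 t))) ->
  g1 a = g2 a -> forall t, a <= t <= b -> g1 t = g2 t.
Proof.
move=> [oU _ uM box] h1 h2 ga; apply: segment_induction => //.
- move=> t /andP[at_ tb] below.
  have tab : a <= t <= b by rewrite ltW.
  have c1 := continuous_is_derive (h1 t tab).2.
  have c2 := continuous_is_derive (h2 t tab).2.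
  apply/eqP; rewrite -subr_eq0 -normr_le0; apply/ler_addgt0Pr => eps e0; rewrite add0r.
  have e2 : 0 < eps / 2 by rewrite divr_gt0.
  have [d d0 hd] := right_segment (filterI (continuous_ball c1 e2) (continuous_ball c2 e2)).
  pose s := Num.max a (t - d / 2).
  have st : s < t by rewrite gt_max at_ /= ltrBlDr ltrDl divr_gt0.
  have as_ : a <= s by rewrite le_max lexx.
  have ds : t - d < s by rewrite lt_max ltrD2l ltrN2 ltr_pdivrMr // ltr_pMr // ltr1n orbT.
  have [a1 a2] := hd s ltac:(by rewrite ds /= (lt_trans st) // ltrDl).
  have E := below s ltac:(by rewrite as_ st).
  have -> : g1 t - g2 t = - (g1 s - g1 t) + (g2 s - g2 t).
    by rewrite E opprB addrA subrK.
  apply: (le_trans (ler_normD _ _)); rewrite normrN.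
  by apply: ltW; rewrite [ltRHS]splitr; exact: ltrD.
- move=> t /andP[at_ tb] E; have tab : a <= t <= b by rewrite at_ ltW.
  have [U1 d1] := h1 t tab; have [U2 d2] := h2 t tab.
  have [W [r [f [e [Wp WU fb]]]]] := box _ U1.
  have oW : open W by case: fb.
  have n1 : \forall s \near t, W (g1 s).
    by apply: (continuous_is_derive d1); exact: open_nbhs_nbhs.
  have n2 : \forall s \near t, W (g2 s).
    by apply: (continuous_is_derive d2); apply: open_nbhs_nbhs; rewrite /= -E.
  have [d d0 hd] := right_segment (filterI n1 n2).
  exists d => // s /andP[ts std] sb.
  have seg (u : R) : 0 <= u <= 1 -> t <= u * (s - t) + t <= s.
    by move=> hu; nra.
  have seg' (u : R) : 0 <= u <= 1 -> a <= u * (s - t) + t <= b.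
    by move=> /seg/andP[k1 k2]; rewrite (le_trans at_ k1) (le_trans k2 sb).
  have seg'' (u : R) : 0 <= u <= 1 -> W (g1 (u * (s - t) + t)) /\ W (g2 (u * (s - t) + t)).
    move=> /seg/andP[k1 k2]; apply: hd; rewrite (lt_le_trans _ k1) ?(le_lt_trans k2) //.
    by rewrite ltrBlDr ltrDl.
  have uW x : W x -> M x \in unitmx by move=> /WU /uM.
  have F1 := @flat_box_line _ M W _ r f e g1 w t s fb uW
    (fun u hu => conj (seg'' u hu).1 (h1 _ (seg' u hu)).2).
  have F2 := @flat_box_line _ M W _ r f e g2 w t s fb uW
    (fun u hu => conj (seg'' u hu).2 (h2 _ (seg' u hu)).2).
  have [W1 W2] := hd s ltac:(by rewrite std andbT (lt_trans _ ts) // ltrBlDr ltrDl).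
  case: fb => _ _ Wf _ _.
  by rewrite -(Wf _ W1).2 -(Wf _ W2).2 F1 F2 E.
Qed.

Lemma ball_segment (R : realType) (V : normedModType R) (c x v : V) (r s : R) :
  ball c r x -> ball c r (x + v) -> 0 <= s <= 1 -> ball c r (x + s *: v).
Proof.
rewrite -ball_normE /= => hx hv /andP[s0 s1].
have -> : c - (x + s *: v) = (1 - s) *: (c - x) + s *: (c - (x + v)).
  by rewrite !opprD !addrA [s *: (c - x - v)]scalerBr addrA -scalerDl subrK scale1r.
apply: (le_lt_trans (ler_normD _ _)); rewrite !normrZ (ger0_norm s0).
rewrite (ger0_norm (_ : 0 <= 1 - s)) ?subr_ge0 //.
have [->|sp] := eqVneq s 0; first by rewrite mul0r addr0 subr0 mul1r.
have -> : r = (1 - s) * r + s * r by ring.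
apply: ler_ltD; last by rewrite ltr_pM2l // lt_def sp.
by apply: ler_wpM2l; rewrite ?subr_ge0 // ltW.
Qed.

(** The segment of velocity w from a point of a flat box, as long as it stays in
    the box. *)
Lemma flat_box_segment (R : realType) (M : 'rV[R]_2 -> 'M[R]_2) (W : set 'rV[R]_2)
    (c : 'rV[R]_2) (r : R) (f e : 'rV[R]_2 -> 'rV[R]_2) (p w : 'rV[R]_2) (s : R) :
  flat_box M W c r f e -> W p -> ball c r (f p + w) -> 0 <= s <= 1 ->
  W (e (f p + s *: w)) /\
  is_derive s (1 : R) (fun s => e (f p + s *: w)) (w *m M (e (f p + s *: w))).
Proof.
move=> [_ _ Wf We [_ de]] Wp bw s01.
have bs := ball_segment (Wf _ Wp).1 bw s01.
split; first exact: (We _ bs).1.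
have H := de _ w bs; rewrite addrC in H.
have E : (fun s => e (f p + s *: w)) = (fun s => e (s *: w + f p)).
  by apply/funext => u; rewrite addrC.
rewrite E [f p + _]addrC; exact: ((is_derive_line e (f p) w _ s).1 H).
Qed.

Lemma flat_segment_unique (R : realType) (U : set 'rV[R]_2) (M : 'rV[R]_2 -> 'M[R]_2)
    (W W' : set 'rV[R]_2) (c c' : 'rV[R]_2) (r r' : R) (f e f' e' : 'rV[R]_2 -> 'rV[R]_2)
    (p w : 'rV[R]_2) :
  flat_structure U M -> W `<=` U -> W' `<=` U ->
  flat_box M W c r f e -> flat_box M W' c' r' f' e' ->
  W p -> W' p -> ball c r (f p + w) -> ball c' r' (f' p + w) ->
  e (f p + w) = e' (f' p + w).
Proof.
move=> FS WU WU' fb fb' Wp Wp' bw bw'.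
have := @flat_curve_unique _ U M (fun s => e (f p + s *: w))
  (fun s => e' (f' p + s *: w)) w 0 1 FS.
move=> /(_ (fun s s01 => let: conj a b := flat_box_segment fb Wp bw s01 in conj (WU _ a) b)).
move=> /(_ (fun s s01 => let: conj a b := flat_box_segment fb' Wp' bw' s01 in conj (WU' _ a) b)).
rewrite !scale0r !addr0.
have E : e (f p) = e' (f' p).
  by case: fb => _ _ /(_ _ Wp)[_ ->] _ _; case: fb' => _ _ /(_ _ Wp')[_ ->] _ _.
move=> /(_ E 1); rewrite !scale1r; apply.
by rewrite lexx ler01.
Qed.

(** * The local action by translations *)

(** q is reached from p by the segment of velocity w, which lies deep inside a flat
    box: the factor 10 makes the segments of two such consecutive arcs, and the one
    closing the triangle, fit together in the larger of their boxes. *)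
Definition short_arc (R : realType) (U : set 'rV[R]_2) (M : 'rV[R]_2 -> 'M[R]_2)
    (w p q : 'rV[R]_2) : Prop :=
  exists W c r f e, [/\ W `<=` U /\ flat_box M W c r f e, W p,
    ball c (r / 10) (f p), ball c (r / 10) (f p + w) & q = e (f p + w)].

(** The domain of the local action of (R^2, +) by translation in the flat boxes. *)
Definition flow_dom (R : realType) (U : set 'rV[R]_2) (M : 'rV[R]_2 -> 'M[R]_2) :
  set ('rV[R]_2 * 'rV[R]_2) := [set z | exists q, short_arc U M z.1 z.2 q].

(** The action itself: flow (w, p) is the endpoint of the short arc of velocity w
    from p, which is unique; the default value 0 is taken outside of flow_dom. *)
Definition flow (R : realType) (U : set 'rV[R]_2) (M : 'rV[R]_2 -> 'M[R]_2)
    (z : 'rV[R]_2 * 'rV[R]_2) : 'rV[R]_2 :=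
  xget 0 [set q | short_arc U M z.1 z.2 q].

Lemma flat_box_radius (R : realType) (M : 'rV[R]_2 -> 'M[R]_2) W c r f e x :
  flat_box M W c r f e -> W x -> 0 < r.
Proof.
by move=> [_ _ Wf _ _] /Wf[+ _]; rewrite -ball_normE /=; apply: le_lt_trans.
Qed.

Lemma ball_tenth (R : realType) (c x : 'rV[R]_2) (r : R) :
  0 < r -> ball c (r / 10) x -> ball c r x.
Proof. by move=> r0; apply: le_ball; lra. Qed.

Lemma short_arc_unique (R : realType) (U : set 'rV[R]_2) (M : 'rV[R]_2 -> 'M[R]_2)
    (w p q q' : 'rV[R]_2) :
  flat_structure U M -> short_arc U M w p q -> short_arc U M w p q' -> q = q'.
Proof.
move=> FS [W [c [r [f [e [[WU fb] Wp b1 b2 ->]]]]]].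
move=> [W' [c' [r' [f' [e' [[WU' fb'] Wp' b1' b2' ->]]]]]].
apply: (flat_segment_unique FS WU WU' fb fb' Wp Wp').
  exact: ball_tenth (flat_box_radius fb Wp) b2.
exact: ball_tenth (flat_box_radius fb' Wp') b2'.
Qed.

Lemma flowE (R : realType) (U : set 'rV[R]_2) (M : 'rV[R]_2 -> 'M[R]_2)
    (w p q : 'rV[R]_2) :
  flat_structure U M -> short_arc U M w p q -> flow U M (w, p) = q.
Proof.
move=> FS pq; rewrite /flow; case: xgetP => [q' _ pq'|/(_ q)//].
exact: short_arc_unique FS pq' pq.
Qed.

Lemma short_arc_sym (R : realType) (U : set 'rV[R]_2) (M : 'rV[R]_2 -> 'M[R]_2)
    (w p q : 'rV[R]_2) :
  short_arc U M w p q -> short_arc U M (- w) q p.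
Proof.
move=> [W [c [r [f [e [[WU fb] Wp b1 b2 ->]]]]]].
have r0 := flat_box_radius fb Wp; have [_ _ Wf We _] := fb.
have [W1 E1] := We _ (ball_tenth r0 b2).
exists W, c, r, f, e; split=> //; rewrite E1 ?addrK //.
by rewrite (Wf _ Wp).2.
Qed.

Lemma ball_two_steps (R : realType) (c x w s : 'rV[R]_2) (r r' : R) :
  ball c (r / 10) x -> `|s| < r' / 5 -> r' <= r -> 0 < r -> ball c r (x + s).
Proof.
rewrite -ball_normE /= => hx hs rr r0; rewrite opprD addrA.
by apply: (le_lt_trans (ler_normB _ _)); lra.
Qed.

Lemma ball_step (R : realType) (c x w : 'rV[R]_2) (r : R) :
  ball c (r / 10) x -> ball c (r / 10) (x + w) -> `|w| < r / 5.
Proof.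
rewrite -ball_normE /= => h1 h2.
have -> : w = (c - x) - (c - (x + w)) by rewrite opprB addrC addrA subrK addrAC subrr add0r.
by apply: (le_lt_trans (ler_normB _ _)); lra.
Qed.

(** The triangle formed by the three arcs is drawn in the larger of the boxes of the
    first two, and the curves of constant velocity are unique. *)
Lemma short_arc_add (R : realType) (U : set 'rV[R]_2) (M : 'rV[R]_2 -> 'M[R]_2)
    (t s p q x y : 'rV[R]_2) :
  flat_structure U M ->
  short_arc U M t p q -> short_arc U M s q x -> short_arc U M (s + t) p y -> x = y.
Proof.
move=> FS [W [c [r [f [e [[WU fb] Wp b1 b2 ->]]]]]].
set q0 := e _.
move=> [W' [c' [r' [f' [e' [[WU' fb'] Wq' b1' b2' ->]]]]]].
move=> [W'' [c'' [r'' [f'' [e'' [[WU'' fb''] Wp'' b1'' b2'' ->]]]]]].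
have r0 := flat_box_radius fb Wp.
have r0' := flat_box_radius fb' Wq'.
have r0'' := flat_box_radius fb'' Wp''.
have [_ _ Wf We _] := fb; have [_ _ Wf' We' _] := fb'.
have [Wq Eq] := We _ (ball_tenth r0 b2); rewrite -/q0 in Wq Eq.
have ht := ball_step b1 b2; have hs := ball_step b1' b2'.
have b3 := ball_tenth r0'' b2''.
have [rr|/ltW rr] := leP r' r.
  have bs : ball c r (f q0 + s) by rewrite Eq; exact: ball_two_steps hs rr r0.
  rewrite (flat_segment_unique FS WU' WU fb' fb Wq' Wq (ball_tenth r0' b2') bs).
  have E : f q0 + s = f p + (s + t) by rewrite Eq [s + t]addrC addrA.
  rewrite E in bs *.
  exact: (flat_segment_unique FS WU WU'' fb fb'' Wp Wp'' bs b3).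
have bt : ball c' r' (f' q0 - t).
  by apply: (ball_two_steps 0 b1' _ rr r0'); rewrite normrN.
have b1q : ball c r (f q0 - t) by rewrite Eq addrK; exact: ball_tenth.
have Ep : e' (f' q0 - t) = p.
  rewrite -(flat_segment_unique FS WU WU' fb fb' Wq Wq' b1q bt) Eq addrK.
  by rewrite (Wf _ Wp).2.
have [Wp' Ep'] := We' _ bt; rewrite Ep in Wp' Ep'.
have E : f' q0 + s = f' p + (s + t).
  by rewrite Ep' addrA [_ - t + s]addrAC subrK.
rewrite E in b2' *.
exact: (flat_segment_unique FS WU' WU'' fb' fb'' Wp' Wp'' (ball_tenth r0' b2') b3).
Qed.

Lemma short_arc_nbhs (R : realType) (U : set 'rV[R]_2) (M : 'rV[R]_2 -> 'M[R]_2)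
    (z : 'rV[R]_2 * 'rV[R]_2) :
  flat_structure U M -> flow_dom U M z ->
  exists N : set ('rV[R]_2 * 'rV[R]_2),
    [/\ open N, N z, N `<=` flow_dom U M & smooth_on N (flow U M)].
Proof.
case: z => t p FS [q [W [c [r [f [e [[WU fb] Wp b1 b2 _]]]]]]].
have [oW [sf se] _ _ _] := fb.
have r0 := flat_box_radius fb Wp.
have oT : open [set: 'rV[R]_2 * 'rV[R]_2] by exact: openT.
have c1 : continuous (fst : 'rV[R]_2 * 'rV[R]_2 -> 'rV[R]_2) by move=> x; exact: cvg_fst.
have c2 : continuous (snd : 'rV[R]_2 * 'rV[R]_2 -> 'rV[R]_2) by move=> x; exact: cvg_snd.
pose O := (snd : 'rV[R]_2 * 'rV[R]_2 -> 'rV[R]_2) @^-1` W.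
have oO : open O by apply: open_comp => // x _; exact: c2.
have Cfst n : Cn_on n O (fst : 'rV[R]_2 * 'rV[R]_2 -> 'rV[R]_2) by exact: Cn_linear.
have Csnd n : Cn_on n O (snd : 'rV[R]_2 * 'rV[R]_2 -> 'rV[R]_2) by exact: Cn_linear.
pose k1 (z : 'rV[R]_2 * 'rV[R]_2) := f z.2.
pose k2 (z : 'rV[R]_2 * 'rV[R]_2) := f z.2 + z.1.
have Ck1 n : Cn_on n O k1 by exact: (Cn_comp oO oW (fun _ h => h) (sf n) (Csnd n)).
have Ck2 n : Cn_on n O k2 by exact: (Cn_add oO (Ck1 n) (Cfst n)).
pose N := O `&` (k1 @^-1` ball c (r / 10) `&` k2 @^-1` ball c (r / 10)).
have oN : open N.
  rewrite openE => x [Ox [h1 h2]]; apply: filterI; first exact: open_nbhs_nbhs.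
  apply: filterI.
    by apply: (Cn_continuous (Ck1 0%N) Ox); exact: ball_nbhs.
  by apply: (Cn_continuous (Ck2 0%N) Ox); exact: ball_nbhs.
have arc x : N x -> short_arc U M x.1 x.2 (e (k2 x)).
  by move=> [Ox [h1 h2]]; exists W, c, r, f, e.
exists N; split=> //.
  by move=> x /arc h; exists (e (k2 x)).
have ob : open (ball c r) by exact: ball_open.
have kb x : N x -> ball c r (k2 x) by move=> [_ [_ h]]; exact: ball_tenth.
move=> n; apply: Cn_ext oN _ (Cn_comp oN ob kb (se n) (Cn_sub (@subIsetl _ _ _) (Ck2 n))).
by move=> [w x] /arc h; rewrite (flowE FS h).
Qed.

Lemma short_arc0 (R : realType) (U : set 'rV[R]_2) (M : 'rV[R]_2 -> 'M[R]_2) p :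
  flat_structure U M -> U p -> short_arc U M 0 p p.
Proof.
move=> [_ _ _ box] /box[W [r [f [e [Wp WU fb]]]]].
have r0 := flat_box_radius fb Wp; have [_ _ Wf _ _] := fb.
exists W, (f p), r, f, e; split=> //; rewrite ?addr0 ?(Wf _ Wp).2 //;
  by apply: ballxx; rewrite divr_gt0.
Qed.

Lemma flow_local_action (R : realType) (U : set 'rV[R]_2) (M : 'rV[R]_2 -> 'M[R]_2) :
  flat_structure U M -> local_action U (flow_dom U M) (flow U M).
Proof.
move=> FS; split.
- split.
    rewrite openE => z /(short_arc_nbhs FS)[N [oN Nz NO _]].
    by apply: filterS NO _; exact: open_nbhs_nbhs.
  move=> n; apply: Cn_local => z /(short_arc_nbhs FS)[N [oN Nz NO sN]].
  by exists N.
- move=> t p [q pq]; rewrite (flowE FS pq).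
  have [W [c [r [f [e [[WU fb] Wp b1 b2 ->]]]]]] := pq; split; first exact: WU.
  have r0 := flat_box_radius fb Wp; have [_ _ _ We _] := fb.
  exact: WU _ (We _ (ball_tenth r0 b2)).1.
- move=> p Up; have h := short_arc0 FS Up; split; first by exists p.
  exact: flowE.
- move=> s t p [q pq]; rewrite (flowE FS pq) => -[x qx] [y py].
  by rewrite (flowE FS qx) (flowE FS py); exact: short_arc_add FS pq qx py.
- move=> t p [q pq]; rewrite (flowE FS pq); have qp := short_arc_sym pq.
  by split; [exists p|exact: flowE].
Qed.

Lemma flow_generator (R : realType) (U : set 'rV[R]_2) (M : 'rV[R]_2 -> 'M[R]_2)
    (v p : 'rV[R]_2) :
  flat_structure U M -> U p -> generator (flow U M) v p = v *m M p.
Proof.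
move=> FS Up; have [_ _ _ box] := FS.
have [W [r [f [e [Wp WU fb]]]]] := box p Up.
have r0 := flat_box_radius fb Wp; have [_ _ Wf _ [_ de]] := fb.
have r10 : 0 < r / 10 by rewrite divr_gt0.
have bp : ball (f p) (r / 10) (f p) by exact: ballxx.
have cl : {for (0 : R), continuous (fun t : R => t *: v + f p)}.
  apply: continuousD; last exact: cst_continuous.
  by apply: continuousZr_tmp; exact: continuous_idfun.
have nb : \forall t \near (0 : R), ball (f p) (r / 10) (t *: v + f p).
  by apply: cl; rewrite /= scale0r add0r; exact: ball_nbhs.
have nE : \forall t \near (0 : R), e (t *: v + f p) = flow U M (t *: v, p).
  apply: filterS nb => t bt; apply: esym; apply: flowE => //.
  by exists W, (f p), r, f, e; split=> //; rewrite addrC.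
have H : is_derive (0 *: v + f p) v e (v *m M p).
  by rewrite scale0r add0r -{2}(Wf _ Wp).2; apply: de; exact: ball_tenth.
exact: is_derive_val (is_derive_near nE ((is_derive_line e (f p) v _ 0).1 H)).
Qed.

Lemma frame_independent (R : realType) (A : 'M[R]_2) :
  A \in unitmx -> independent (axis R 0 *m A) (axis R 1 *m A).
Proof.
move=> uA; rewrite /independent -mul_col_mx.
have -> : col_mx (axis R 0) (axis R 1) = (1%:M : 'M[R]_2).
  apply/matrixP; apply: forall_ord2 => j; rewrite !mxE; case: splitP => k;
  by rewrite [k]ord1 //= axisE.
by rewrite mul1mx row_free_unit.
Qed.

(** * Translates of a curve *)

Lemma continuous_pair (R : realType) (T : topologicalType) (V W : normedModType R)
    (g : T -> V) (h : T -> W) (x : T) :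
  {for x, continuous g} -> {for x, continuous h} ->
  {for x, continuous (fun y => (g y, h y))}.
Proof. by move=> cg ch; exact: cvg_pair. Qed.

(** While it stays in a flat box, a curve of constant velocity is a straight line
    of the box. *)
Lemma frame_curve_box (R : realType) (M : 'rV[R]_2 -> 'M[R]_2) (W : set 'rV[R]_2)
    (c : 'rV[R]_2) (r : R) (f e : 'rV[R]_2 -> 'rV[R]_2) (g : R -> 'rV[R]_2)
    (w : 'rV[R]_2) (t0 : R) :
  flat_box M W c r f e -> (forall x, W x -> M x \in unitmx) ->
  (\forall t \near t0, is_derive t (1 : R) g (w *m M (g t))) -> W (g t0) ->
  \forall t \near t0, W (g t) /\ f (g t) = f (g t0) + (t - t0) *: w.
Proof.
move=> fb uM dg Wg.
have oW : open W by case: fb.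
have nW : \forall t \near t0, W (g t).
  by apply: (continuous_is_derive (nbhs_singleton dg)); exact: open_nbhs_nbhs.
have [d d0 hd] := right_segment (filterI dg nW).
have nb : nbhs t0 (ball t0 d) by exact: nbhsx_ballx.
apply: filterS nb => t; rewrite -ball_normE /= ltr_norml => ht.
have seg (u : R) : 0 <= u <= 1 -> t0 - d < u * (t - t0) + t0 < t0 + d.
  by move=> hu; nra.
split; first by have [] := hd t ltac:(by move: ht; lra).
apply: (flat_box_line fb uM) => u hu /=.
by have [] := hd _ (seg u hu).
Qed.

(** Small translations stay in a given flat box. *)
Lemma flow_near_box (R : realType) (U : set 'rV[R]_2) (M : 'rV[R]_2 -> 'M[R]_2)
    (W : set 'rV[R]_2) (r : R) (f e : 'rV[R]_2 -> 'rV[R]_2) (q : 'rV[R]_2) :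
  flat_structure U M -> W `<=` U -> flat_box M W (f q) r f e -> W q ->
  \forall z \near ((0 : 'rV[R]_2), q),
    [/\ W z.2, short_arc U M z.1 z.2 (e (f z.2 + z.1)),
        W (flow U M z) & f (flow U M z) = f z.2 + z.1].
Proof.
move=> FS WU fb Wq; have r0 := flat_box_radius fb Wq.
have r10 : 0 < r / 10 by rewrite divr_gt0.
have [oW [sf _] _ We _] := fb.
have bq : ball (f q) (r / 10) (f q) by exact: ballxx.
have c1 : {for ((0 : 'rV[R]_2), q), continuous (fst : 'rV[R]_2 * 'rV[R]_2 -> 'rV[R]_2)}.
  exact: cvg_fst.
have c2 : {for ((0 : 'rV[R]_2), q), continuous (snd : 'rV[R]_2 * 'rV[R]_2 -> 'rV[R]_2)}.
  exact: cvg_snd.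
have n1 : \forall z \near ((0 : 'rV[R]_2), q), W z.2.
  by apply: c2; exact: open_nbhs_nbhs.
have cf : {for ((0 : 'rV[R]_2), q), continuous (fun z => f z.2)}.
  apply: continuous_comp; first exact: c2.
  exact: Cn_continuous (sf 0%N) Wq.
have n2 : \forall z \near ((0 : 'rV[R]_2), q), ball (f q) (r / 10) (f z.2).
  by apply: cf; exact: ball_nbhs.
have n3 : \forall z \near ((0 : 'rV[R]_2), q), ball (f q) (r / 10) (f z.2 + z.1).
  have cs := continuousD cf c1.
  by apply: cs; rewrite fctE /= addr0; exact: ball_nbhs.
apply: filterS (filterI n1 (filterI n2 n3)) => -[w x] /= [Wx [b1 b2]].
have arc : short_arc U M w x (e (f x + w)) by exists W, (f q), r, f, e.
have [h1 h2] := We _ (ball_tenth r0 b2).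
by rewrite (flowE FS arc).
Qed.

Lemma flow_continuous (R : realType) (U : set 'rV[R]_2) (M : 'rV[R]_2 -> 'M[R]_2) z :
  flat_structure U M -> flow_dom U M z -> {for z, continuous (flow U M)}.
Proof.
move=> FS hz; have [[_ sPhi] _ _ _ _] := flow_local_action FS.
exact: Cn_continuous (sPhi 0%N) hz.
Qed.

(** The translates of a curve of constant velocity have the same velocity. *)
Lemma flow_along (R : realType) (U : set 'rV[R]_2) (M : 'rV[R]_2 -> 'M[R]_2)
    (g : R -> 'rV[R]_2) (v w : 'rV[R]_2) (t : R) :
  flat_structure U M -> is_derive t (1 : R) g (w *m M (g t)) ->
  flow_dom U M (v, g t) ->
  U (flow U M (v, g t)) /\
  is_derive t (1 : R) (fun t => flow U M (v, g t)) (w *m M (flow U M (v, g t))).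
Proof.
move=> FS dg [q pq].
have [W [c [r [f [e [[WU fb] Wg b1 b2 qE]]]]]] := pq.
have r0 := flat_box_radius fb Wg; have [_ _ uM _] := FS.
have [oW [sf se] _ We [df de]] := fb.
have ob : open (ball c r) by exact: ball_open.
have cg := continuous_is_derive dg.
have dif := C1_differentiable oW (sf 1%N) Wg.
have dk0 : is_derive t (1 : R) (f \o g) w.
  have := is_derive_comp dg dif.
  have [_ E] := df _ (w *m M (g t)) Wg.
  by rewrite -deriveE // E mulmxK // uM //; exact: WU.
have dk : is_derive t (1 : R) (fun t => f (g t) + v) w.
  by have := is_deriveD dk0 (is_derive_cst v t 1); rewrite addr0.
have bk := ball_tenth r0 b2.
have dise := C1_differentiable ob (se 1%N) bk.
have H := is_derive_comp dk dise.
have [_ E] := de _ w bk; rewrite -deriveE // E in H.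
have ck := continuous_is_derive dk; have ck0 := continuous_is_derive dk0.
have n1 : \forall u \near t, W (g u) by apply: cg; exact: open_nbhs_nbhs.
have n2 : \forall u \near t, ball c (r / 10) (f (g u)) by apply: ck0; exact: ball_nbhs.
have n3 : \forall u \near t, ball c (r / 10) (f (g u) + v) by apply: ck; exact: ball_nbhs.
have nE : \forall u \near t, e (f (g u) + v) = flow U M (v, g u).
  apply: filterS (filterI n1 (filterI n2 n3)) => u [h1 [h2 h3]].
  by apply: esym; apply: flowE => //; exists W, c, r, f, e.
rewrite (flowE FS pq) qE; split; first exact: WU _ (We _ bk).1.
exact: is_derive_near nE H.
Qed.

(** * The transverse coordinate *)

(** A vector independent of the first row of a frame has a nonzero second
    component in it. *)
Lemma independent_coord (R : realType) (A : 'M[R]_2) (v : 'rV[R]_2) :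
  A \in unitmx -> independent (axis R 0 *m A) v -> (v *m invmx A) 0 1 != 0.
Proof.
move=> uA; apply: contraTneq => h.
have vE : v = (v *m invmx A) 0 0 *: (axis R 0 *m A).
  rewrite -[LHS]mulmx1 -(mulVmx uA) mulmxA {1}(rV2E (v *m invmx A)) h.
  by rewrite scale0r addr0 scalemxAl.
set k := (v *m invmx A) 0 0 in vE.
apply/negP => /row_free_inj /(_ (row_mx k%:M (- 1%:M)) 0).
rewrite mul_row_col mul0mx mul_scalar_mx mulNmx mul1mx -vE subrr => /(_ erefl).
move=> /matrixP/(_ 0 (rshift 1 0)); rewrite row_mxEr !mxE /= => /eqP.
by rewrite oppr_eq0 oner_eq0.
Qed.

(** The transverse coordinate sigma along a transversal: the integral of the
    coframe component that vanishes on the field.  In a flat box it is the second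
    coordinate, up to a constant.  It is defined on ]-1/2, 1[ because the integral
    needs a starting point inside the domain ]-1, 1[ of s. *)
Lemma transverse_coordinate (R : realType) (U : set 'rV[R]_2)
    (M : 'rV[R]_2 -> 'M[R]_2) (s : R -> 'rV[R]_2) :
  flat_structure U M ->
  smooth_on [set x : R | -1 < x < 1] s ->
  (forall x : R, -1 < x < 1 -> U (s x) /\ independent (axis R 0 *m M (s x)) ('D_1 s x)) ->
  exists sigma beta : R -> R,
    (forall x : R, - 2^-1 < x < 1 -> [/\ is_derive x (1 : R) sigma (beta x),
       beta x != 0 & {for x, continuous beta}]) /\
    (forall (x : R) W c r f e, - 2^-1 < x < 1 -> W `<=` U -> flat_box M W c r f e -> W (s x) ->
       \forall y \near x, [/\ W (s y), - 2^-1 < y < 1 &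
         f (s y) 0 1 - f (s x) 0 1 = sigma y - sigma x]).
Proof.
move=> FS ss sU; have [oU sM uM _] := FS.
pose I1 := [set x : R | -1 < x < 1].
have oI : open I1.
  rewrite (_ : I1 = `]-1, 1[%classic); first exact: interval_open.
  by apply/seteqP; split=> x; rewrite /= in_itv.
have sIU x : I1 x -> U (s x) by move=> /sU[].
have CA n := Cn_invmx oU uM (sM n).
have [beta [betaE Cb b0]] : exists beta : R -> R,
    [/\ forall x, I1 x -> ('D_1 s x *m invmx (M (s x))) 0 1 = beta x,
        Cn_on 0 I1 beta & forall x, I1 x -> beta x != 0].
  exists (fun x => ('D_1 s x *m invmx (M (s x))) 0 1); split=> //.
    have CAs : Cn_on 0 I1 (fun x => invmx (M (s x))).
      suff : forall i j, Cn_on 0 I1 (fun x => invmx (M (s x)) i j).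
        by move=> h; exact: ((Cn_mxP 0 _ oI).2 h).
      move=> i j; split=> // x Ix.
      apply: (@continuous_comp R 'rV[R]_2 R s (fun y => invmx (M y) i j)).
        exact: Cn_continuous (ss 0%N) Ix.
      exact: Cn_continuous ((Cn_mxP 0 _ oU).1 (CA 0%N) i j) (sIU x Ix).
    have h := (Cn_mxP 0 _ oI).1 (Cn_mulmx oI (Cn_derive (1 : R) (ss 1%N)) CAs) 0 1.
    exact h.
  by move=> x Ix; have [Us ind] := sU x Ix; exact: independent_coord (uM _ Us) ind.
have I1half (x : R) : - 2^-1 <= x < 1 -> I1 x by rewrite /I1 /=; lra.
pose sigma (x : R) : R := (\int[@lebesgue_measure R]_(t in `[- 2^-1, x]) beta t)%R.
have dsigma (x : R) : - 2^-1 < x < 1 -> is_derive x (1 : R) sigma (beta x).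
  move=> /andP[x0 x1]; apply: (@is_derive_integral _ beta _ _ ((x + 1) / 2)).
    by rewrite x0; lra.
  by move=> t ht; apply: Cn_continuous Cb _; apply: I1half; lra.
exists sigma, beta; split.
  move=> x hx; have Ix : I1 x by apply: I1half; lra.
  by split; [exact: dsigma|exact: b0|exact: Cn_continuous Cb Ix].
move=> x W c r f e hx WU fb Wx; have [oW [sf _] _ _ [df _]] := fb.
have Ix : I1 x by apply: I1half; lra.
have n1 : \forall y \near x, W (s y).
  by apply: (Cn_continuous (ss 0%N) Ix); exact: open_nbhs_nbhs.
have n2 : \forall y \near x, - 2^-1 < y < 1.
  have : nbhs x (`]- 2^-1, 1[%classic : set R).
    by apply: open_nbhs_nbhs; split; [exact: interval_open|rewrite /= in_itv].
  by apply: filterS => y; rewrite /= in_itv.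
have [d d0 hd] := right_segment (filterI n1 n2).
have nb : nbhs x (ball x d) by exact: nbhsx_ballx.
apply: filterS nb => y; rewrite -ball_normE /= ltr_norml => hy.
have [Wy Iy] := hd y ltac:(by move: hy; lra).
split=> //.
have seg (u : R) : 0 <= u <= 1 -> x - d < u * (y - x) + x < x + d.
  by move=> hu; nra.
have [|u _] := @interval_MVT R (fun z : R => f (s z) 0 1 - sigma z) (fun _ : R => 0) x y.
  move=> u hu; have [Wz Iz] := hd _ (seg u hu); move: (u * (y - x) + x) Wz Iz => z Wz Iz.
  have Iz' : I1 z by apply: I1half; lra.
  rewrite -(subrr (beta z)); apply: is_deriveB (dsigma z Iz).
  have dif := C1_differentiable oW (sf 1%N) Wz.
  have := is_derive_comp (Cn_is_derive (1 : R) (ss 1%N) Iz') dif.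
  have [_ E] := df _ ('D_1 s z) Wz; rewrite -deriveE // E => H.
  have [d1 d2] := H; rewrite -(betaE z Iz').
  apply: DeriveDef; first exact: ((derivable_mxP _ _ _).1 d1).
  by have := derive_mx d1; rewrite d2 => /matrixP/(_ 0 1); rewrite [RHS]mxE => ->.
by rewrite mulr0; move: (f (s y) 0 1) (f (s x) 0 1) => p q; lra.
Qed.

(** A function with a nonzero continuous derivative takes all the values near
    sigma x0 near x0. *)
Lemma locally_onto (R : realType) (sigma beta : R -> R) (x0 d : R) :
  0 < d ->
  (forall x : R, x0 - d < x < x0 + d -> is_derive x (1 : R) sigma (beta x)) ->
  beta x0 != 0 -> {for x0, continuous beta} ->
  \forall b \near (0 : R), exists2 y, x0 - d < y < x0 + d & sigma y - sigma x0 = b.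
Proof.
move=> d0 ds bn cb.
have bn2 : 0 < `|beta x0| by rewrite normr_gt0.
have [d1 d10 hd1] := right_segment (continuous_ball cb bn2).
pose k := Num.min (d / 2) (d1 / 2).
have k0 : 0 < k by rewrite lt_min !divr_gt0.
have kd : k < d by rewrite gt_min ltr_pdivrMr // ltr_pMr // ltr1n.
have kd1 : k < d1 by rewrite gt_min [X in _ || X]ltr_pdivrMr // ltr_pMr // ltr1n orbT.
have same (x : R) : x0 - k <= x <= x0 + k -> 0 < beta x * beta x0.
  move=> hx; have := hd1 x ltac:(by move: hx; lra).
  move: (beta x) (beta x0) bn2 => u v v0.
  rewrite ltr_norml; case: (ltrgtP v 0) v0 => [vn|vp|->]; last by rewrite normr0 ltxx.
    by rewrite ltr0_norm // => _ h; rewrite nmulr_lgt0 //; lra.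
  by rewrite gtr0_norm // => _ h; rewrite pmulr_lgt0 //; lra.
have [|u hu Eu] := @interval_MVT R sigma beta x0 (x0 + k).
  by move=> u hu; apply: ds; nra.
have [|v hv Ev] := @interval_MVT R sigma beta x0 (x0 - k).
  by move=> v hv; apply: ds; nra.
have su := same (u * (x0 + k - x0) + x0) ltac:(by nra).
have sv := same (v * (x0 - k - x0) + x0) ltac:(by nra).
have cont : {within `[x0 - k, x0 + k], continuous sigma}.
  apply: continuous_on_segment => x hx; apply: continuous_is_derive (ds x _).
  by move: hx; lra.
move: su sv Eu Ev; move: (beta (u * _ + _)) (beta (v * _ + _)) => bu bv su sv Eu Ev.
have [P PE] : exists P, P = sigma (x0 + k) - sigma x0 by eexists.
have [Q QE] : exists Q, Q = sigma (x0 - k) - sigma x0 by eexists.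
rewrite -PE addrAC subrr add0r in Eu; rewrite -QE addrAC subrr add0r in Ev.
have PQ : (Q < 0 < P) \/ (P < 0 < Q).
  have [bp|bp|b0] := ltrgtP (beta x0) 0; last by rewrite b0 eqxx in bn.
    move: su sv; rewrite !nmulr_lgt0 // => su sv.
    right; rewrite Eu Ev; apply/andP; split; first by rewrite pmulr_rlt0.
    by rewrite nmulr_rgt0 // oppr_lt0.
  move: su sv; rewrite !pmulr_lgt0 // => su sv.
  left; rewrite Eu Ev; apply/andP; split; last by rewrite pmulr_rgt0.
  by rewrite nmulr_rlt0 // oppr_lt0.
pose m := Num.min `|P| `|Q|.
have m0 : 0 < m by rewrite lt_min !normr_gt0; case: PQ => ?; apply/andP; split; apply/eqP; lra.
apply: (near0_norm m0) => b; rewrite lt_min => /andP[bP bQ].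
have [|||y hy Ey] := @IVT R sigma (x0 - k) (x0 + k) (sigma x0 + b).
- by lra.
- exact: cont.
- rewrite ge_min le_max.
  have -> : sigma (x0 - k) = Q + sigma x0 by rewrite QE subrK.
  have -> : sigma (x0 + k) = P + sigma x0 by rewrite PE subrK.
  rewrite ![_ + sigma x0]addrC !lerD2l.
  move: bP bQ; rewrite !ltr_norml.
  case: PQ => /andP[h1 h2].
    by rewrite (gtr0_norm h2) (ltr0_norm h1) => /andP[? ?] /andP[? ?];
       apply/andP; split; apply/orP; [left|right]; lra.
  by rewrite (ltr0_norm h1) (gtr0_norm h2) => /andP[? ?] /andP[? ?];
     apply/andP; split; apply/orP; [right|left]; lra.
exists y; last by rewrite Ey addrAC subrr add0r.
by move: hy; rewrite in_itv /=; lra.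
Qed.

(** * The first return map *)

Lemma trajectory_curve (R : realType) (U : set 'rV[R]_2) (X : 'rV[R]_2 -> 'rV[R]_2)
    (M : 'rV[R]_2 -> 'M[R]_2) (I : set R) (c : R -> 'rV[R]_2) (t : R) :
  (forall p, U p -> axis R 0 *m M p = X p) -> trajectory U X I c -> I t ->
  U (c t) /\ is_derive t (1 : R) c (axis R 0 *m M (c t)).
Proof. by move=> XM [[_ _ _ h] _] /h[Uc dc]; rewrite XM. Qed.

Lemma trajectory_segment (R : realType) (U : set 'rV[R]_2)
    (X : 'rV[R]_2 -> 'rV[R]_2) (I : set R) (c : R -> 'rV[R]_2) (a b : R) :
  trajectory U X I c -> I a -> I b -> forall t, a <= t <= b -> I t.
Proof. by move=> [[_ iI _ _] _] Ia Ib t; exact: iI. Qed.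

Lemma flow0 (R : realType) (U : set 'rV[R]_2) (M : 'rV[R]_2 -> 'M[R]_2) p :
  flat_structure U M -> U p -> flow U M (0, p) = p /\ flow_dom U M (0, p).
Proof.
by move=> FS Up; have h := short_arc0 FS Up; split; [exact: flowE|exists p].
Qed.

Lemma continuous_near (T T' : topologicalType) (f : T -> T') (x : T) (P : T' -> Prop) :
  {for x, continuous f} -> (\forall y \near f x, P y) -> \forall y \near x, P (f y).
Proof. by move=> cf; exact: (cf). Qed.

(** Compactness of a segment. *)
Lemma near_segment (R : realType) (a b x0 : R) (P : R -> R -> Prop) :
  (forall t, a <= t <= b -> \forall z \near (t, x0), P z.2 z.1) ->
  \forall x \near x0, forall t, a <= t <= b -> P x t.
Proof.
move=> H; have K := (compact_near_coveringP `[a, b]%classic).1 (@segment_compact R a b).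
have := K R (nbhs x0) P (nbhs_filter x0) _.
move=> cov; apply: filterS (cov _).
  by move=> x hx t ht; apply: hx; rewrite /= in_itv.
by move=> t; rewrite /= in_itv; exact: H.
Qed.

(** The first return map preserves differences of the transverse coordinate: the
    translates of the trajectory of s x0 follow it until it returns, and by
    compactness a small translate can meet the transversal near s (h x0) only where
    the coordinate is shifted by the same amount. *)
Lemma first_return_locally_constant (R : realType) (U : set 'rV[R]_2)
    (M : 'rV[R]_2 -> 'M[R]_2) (X : 'rV[R]_2 -> 'rV[R]_2) (s : R -> 'rV[R]_2)
    (sigma beta : R -> R) (d : R) (h tau : R -> R) (c : R -> R -> 'rV[R]_2) (x0 : R) :
  flat_structure U M -> (forall p, U p -> axis R 0 *m M p = X p) ->
  (forall x : R, -1 < x < 1 -> {for x, continuous s}) ->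
  (forall x : R, - 2^-1 < x < 1 -> [/\ is_derive x (1 : R) sigma (beta x),
       beta x != 0 & {for x, continuous beta}]) ->
  (forall (x : R) W c r f e, - 2^-1 < x < 1 -> W `<=` U -> flat_box M W c r f e -> W (s x) ->
       \forall y \near x, [/\ W (s y), - 2^-1 < y < 1 &
         f (s y) 0 1 - f (s x) 0 1 = sigma y - sigma x]) ->
  d <= 1 ->
  (forall x, 0 < x < d -> 0 < h x < 1 /\ {for x, continuous h}) ->
  (forall x, 0 < x < d ->
     0 < tau x /\
     (exists I, [/\ trajectory U X I (c x), I 0 & I (tau x)]) /\
     [/\ c x 0 = s x, c x (tau x) = s (h x) &
       forall t y, 0 < t < tau x -> 0 <= y < 1 -> c x t <> s y]) ->
  0 < x0 < d ->
  \forall x \near x0, sigma (h x) - sigma x = sigma (h x0) - sigma x0.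
Proof.
move=> FS XM cs ds sbox d1 hh hc hx0.
have [oU sM uM box] := FS.
have [T0 [[I [tr I0 IT]] [g0 gT ret0]]] := hc x0 hx0.
have [hy0 ch] := hh x0 hx0.
set g := c x0 in tr g0 gT ret0; set T := tau x0 in T0 IT gT ret0.
set y0 := h x0 in hy0 ch gT *.
have oI : open I by case: tr => -[].
have hg t : I t -> U (g t) /\ is_derive t (1 : R) g (axis R 0 *m M (g t)).
  by move=> It; exact: trajectory_curve XM tr It.
have ngd t : I t -> \forall u \near t, is_derive u (1 : R) g (axis R 0 *m M (g u)).
  by move=> It; apply: filterS (open_nbhs_nbhs (conj oI It)) => u /hg[].
have cg t : I t -> {for t, continuous g}.
  by move=> /hg[_]; exact: continuous_is_derive.
have [eta eta0 heta] := right_segment (open_nbhs_nbhs (conj oI IT)).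
(* The trajectory g is followed a little beyond its return time T. *)
pose T' := T + eta / 2.
have IT' : I T' by apply: heta; rewrite /T'; lra.
have I0T' t : 0 <= t <= T' -> I t by exact: trajectory_segment tr I0 IT' t.
have x0I : -1 < x0 < 1 by lra.
have x0I' : - 2^-1 < x0 < 1 by lra.
have y0I : -1 < y0 < 1 by lra.
have y0I' : - 2^-1 < y0 < 1 by lra.
have nx0 : \forall x \near x0, 0 < x < d.
  have : nbhs x0 (`]0, d[%classic : set R).
    by apply: open_nbhs_nbhs; split; [exact: interval_open|rewrite /= in_itv].
  by apply: filterS => x; rewrite /= in_itv.
(* The displacement v x of s x from s x0, in a box at s x0. *)
have Us0 : U (s x0) by rewrite -g0; exact: (hg 0 I0).1.
have [W1 [r1 [f1 [e1 [W1s W1U fb1]]]]] := box _ Us0.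
have [oW1 [sf1 _] W1f _ _] := fb1.
pose v x := f1 (s x) - f1 (s x0).
have cv : {for x0, continuous v}.
  apply: continuousB; last exact: cst_continuous.
  by apply: continuous_comp; [exact: cs|exact: Cn_continuous (sf1 0%N) W1s].
have v0 : v x0 = 0 by rewrite /v subrr.
have v1 : \forall x \near x0, v x 0 1 = sigma x - sigma x0.
  apply: filterS (sbox x0 _ _ _ _ _ x0I' W1U fb1 W1s) => x [_ _ <-].
  by rewrite /v [LHS]mxE [X in _ + X]mxE.
have sflow : \forall x \near x0, flow U M (v x, s x0) = s x.
  have c2 : {for x0, continuous (fun x => (v x, s x0))}.
    by apply: continuous_pair; [exact: cv|exact: cst_continuous].
  have n1 : \forall x \near x0, W1 (s x).
    by apply: (cs x0 x0I); exact: open_nbhs_nbhs.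
  have n2 := flow_near_box FS W1U fb1 W1s; rewrite -v0 in n2.
  apply: filterS (filterI n1 (c2 _ n2)) => x [W1x [_ /= arc _ _]].
  by rewrite (flowE FS arc) /v [f1 (s x0) + _]addrC subrK (W1f _ W1x).2.
have cswap t : I t -> {for (t, x0), continuous (fun z : R * R => (v z.2, g z.1))}.
  move=> It; apply: continuous_pair.
    by apply: continuous_comp; [exact: cvg_snd|exact: cv].
  by apply: continuous_comp; [exact: cvg_fst|exact: cg].
(* The translates of g are defined up to time T'. *)
have dom : \forall x \near x0, forall t, 0 <= t <= T' -> flow_dom U M (v x, g t).
  have [[oD _] _ _ _ _] := flow_local_action FS.
  apply: near_segment => t ht; have It := I0T' t ht.
  have nD : nbhs (v x0, g t) (flow_dom U M).
    apply: open_nbhs_nbhs; split=> //; rewrite v0.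
    exact: (flow0 FS (hg t It).1).2.
  exact: (cswap t It _ nD).
(* They are the trajectories of the points s x, as long as these do not return. *)
have agree : \forall x \near x0, forall t, 0 <= t <= T' -> t <= tau x ->
    c x t = flow U M (v x, g t).
  apply: filterS (filterI nx0 (filterI sflow dom)) => x [hx [sx dx]] t /andP[t0 tT] tt.
  have [_ [[Ix [trx Ix0 Ixt]] [cx0 _ _]]] := hc x hx.
  apply: (@flat_curve_unique _ U M (c x) (fun t => flow U M (v x, g t)) (axis R 0) 0 t FS).
  - move=> u /andP[u0 ut]; apply: (trajectory_curve XM trx).
    by apply: (trajectory_segment trx Ix0 Ixt); rewrite u0 (le_trans ut).
  - move=> u /andP[u0 ut]; have hu : 0 <= u <= T' by rewrite u0 (le_trans ut).
    apply: (flow_along FS _ (dx u hu)); exact: (hg u (I0T' u hu)).2.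
  - by rewrite cx0 g0 sx.
  - by rewrite t0 lexx.
(* A box at the endpoint s y0. *)
have Uy0 : U (s y0) by rewrite -gT; exact: (hg T IT).1.
have [W2 [r2 [f2 [e2 [W2s W2U fb2]]]]] := box _ Uy0.
have [oW2 [sf2 _] W2f _ _] := fb2.
have uM2 x : W2 x -> M x \in unitmx by move=> /W2U /uM.
have FN := flow_near_box FS W2U fb2 W2s.
have sN := sbox y0 _ _ _ _ _ y0I' W2U fb2 W2s.
(* At a time when g is at s y0, the translates of g are nearly there, and are
   straight lines in the box. *)
have GN t : I t -> g t = s y0 -> \forall z \near (t, x0),
    W2 (flow U M (v z.2, g z.1)) /\
    f2 (flow U M (v z.2, g z.1)) = f2 (s y0) + (z.1 - t) *: axis R 0 + v z.2.
  move=> It gt; have FN' := FN; rewrite -gt -v0 in FN'.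
  have W2g : W2 (g t) by rewrite gt.
  have n2 := frame_curve_box fb2 uM2 (ngd t It) W2g.
  have c1 : {for (t, x0), continuous (fst : R * R -> R)} by exact: cvg_fst.
  have A1 : \forall z \near (t, x0), W2 (flow U M (v z.2, g z.1)) /\
      f2 (flow U M (v z.2, g z.1)) = f2 (g z.1) + v z.2.
    by apply: filterS (continuous_near (cswap t It) FN') => z [].
  have A2 : \forall z \near (t, x0), f2 (g z.1) = f2 (g t) + (z.1 - t) *: axis R 0.
    by apply: filterS (continuous_near c1 n2) => z [].
  by apply: filterS (filterI A1 A2) => z [[? ->] ->]; rewrite gt.
have cy0 : {for y0, continuous (fun y => f2 (s y))}.
  by apply: continuous_comp; [exact: cs|exact: Cn_continuous (sf2 0%N) W2s].
(* The return time stays below T'. *)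
have tauT' : \forall x \near x0, tau x <= T'.
  have [rho rho0 hrho] := near_ball (GN T IT gT).
  pose k := Num.min (rho / 2) (Num.min (eta / 4) (T / 4)).
  have k0 : 0 < k by rewrite !lt_min !divr_gt0.
  have k1 : k <= rho / 2 by rewrite ge_min lexx.
  have k2 : k <= eta / 4 by rewrite !ge_min lexx orbT.
  have k3 : k <= T / 4 by rewrite !ge_min lexx !orbT.
  have ny0 : \forall y \near y0, 0 < y < 1.
    have : nbhs y0 (`]0, 1[%classic : set R).
      by apply: open_nbhs_nbhs; split; [exact: interval_open|rewrite /= in_itv].
    by apply: filterS => x; rewrite /= in_itv.
  have [dl dl0 hdl] := right_segment (filterI ny0 (filterI sN (continuous_ball cy0 k0))).
  have onto := locally_onto dl0
    (fun y hy => let: And3 p _ _ := ds y (let: conj _ (conj (And3 _ q _) _) := hdl y hy in q) in p)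
    (let: And3 _ p _ := ds y0 y0I' in p) (let: And3 _ _ p := ds y0 y0I' in p).
  have csig : {for x0, continuous (fun x => sigma x - sigma x0)}.
    apply: continuousB; last exact: cst_continuous.
    by have [dx0 _ _] := ds x0 x0I'; exact: continuous_is_derive dx0.
  rewrite -(subrr (sigma x0)) in onto.
  have n1 := continuous_near csig onto.
  have n2 := continuous_ball cv k0.
  have n3 := nbhsx_ballx x0 rho rho0.
  apply: filterS (filterI nx0 (filterI n1 (filterI n2 (filterI n3 (filterI v1 agree))))).
  move=> x [hx [[y hy Ey] [vk [bx [vx ag]]]]].
  rewrite leNgt; apply/negP => tx.
  have [hy1 [[W2y _ Esy] fk]] := hdl y hy.
  pose as_ := f2 (s y) 0 0 - f2 (s y0) 0 0; pose a := v x 0 0.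
  have ha : `|as_| < k.
    by apply: le_lt_trans fk; have := ler_mx_entry (f2 (s y) - f2 (s y0)) 0 0; rewrite [X in `|X|]mxE [X in _ + X]mxE.
  have hb : `|a| < k.
    by apply: le_lt_trans vk; rewrite v0 subr0; exact: ler_mx_entry.
  (* Otherwise the trajectory of s x would meet the transversal at s y before its
     first return: sigma gives the second flat coordinate of s y, and the time t is
     chosen to reach its first one. *)
  have [t tE] : exists t, t = T + as_ - a by eexists.
  have [t0 [tT [tt dt]]] : 0 < t /\ t <= T' /\ t < tau x /\ `|T - t| < rho.
    move: ha hb tx; rewrite tE /T' !ltr_norml.
    move: (tau x) (as_) (a) => p q r; clear - k1 k2 k3 T0 rho0 => *.
    by do !split; lra.
  have bt : ball (T, x0) rho (t, x) by split=> //=; rewrite -ball_normE.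
  have [/= Wt ft] := hrho _ bt.
  have Et : flow U M (v x, g t) = s y.
    rewrite -(W2f _ Wt).2 -(W2f _ W2y).2 ft; congr (e2 _); apply: row2P.
      rewrite [LHS]mxE [X in X + _]mxE [X in _ + X + _]mxE axisE eqxx mulr1.
      by rewrite tE /as_ -/a; ring.
    rewrite [LHS]mxE [X in X + _]mxE [X in _ + X + _]mxE axisE mulr0 addr0.
    by rewrite vx -Ey -Esy; ring.
  have [_ [_ [_ _ retx]]] := hc x hx.
  have [hy2 hy3] := andP hy1.
  apply: (retx t y); [by rewrite t0 tt|by rewrite (ltW hy2) hy3|].
  by rewrite -Et; apply: ag; [rewrite (ltW t0) tT|exact: ltW].
(* No translate meets the transversal near s y0 at another level. *)
have level : \forall x \near x0, forall t, 0 <= t <= T' ->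
    flow U M (v x, g t) = s (h x) -> sigma (h x) - sigma y0 = sigma x - sigma x0.
  apply: near_segment => t ht; have It := I0T' t ht.
  have c2 : {for (t, x0), continuous (snd : R * R -> R)} by exact: cvg_snd.
  have [gt|gt] := pselect (g t = s y0).
    have n1 : \forall x \near x0, f2 (s (h x)) 0 1 - f2 (s y0) 0 1 = sigma (h x) - sigma y0.
      by apply: filterS (continuous_near ch sN) => x [].
    apply: filterS (filterI (GN t It gt) (c2 _ (filterI n1 v1))) => -[u x] /=.
    move=> [[_ E2] [E1 E3]] E.
    rewrite -E1 -E3 -E E2 [(_ + v x) 0 1]mxE [X in X + _ - _]mxE [X in _ + X + _ - _]mxE.
    by rewrite axisE mulr0 addr0 addrAC subrr add0r.
  have cF : {for (t, x0), continuous (fun z : R * R => flow U M (v z.2, g z.1))}.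
    apply: continuous_comp; first exact: cswap.
    apply: flow_continuous => //=; rewrite v0.
    exact: (flow0 FS (hg t It).1).2.
  have csh : {for (t, x0), continuous (fun z : R * R => s (h z.2))}.
    apply: (@continuous_comp _ _ _ (snd : R * R -> R) (fun x => s (h x))); first exact: c2.
    by apply: continuous_comp; [exact: ch|exact: cs].
  have eps0 : 0 < `|g t - s y0| / 2 by rewrite divr_gt0 // normr_gt0 subr_eq0; apply/eqP.
  apply: filterS (filterI (continuous_ball cF eps0) (continuous_ball csh eps0)) => -[u x] /=.
  rewrite v0 (flow0 FS (hg t It).1).1 => -[b1 b2] E; exfalso.
  rewrite E -/y0 in b1; rewrite -/y0 in b2.
  have := ler_distD (s (h x)) (g t) (s y0).
  rewrite (distrC (g t) (s (h x))); move: b1 b2.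
  by clear; move: (`|_ - g t|) (`|_ - s y0|) (`|_ - s y0|) => p q r; lra.
apply: filterS (filterI nx0 (filterI agree (filterI tauT' level))).
move=> x [hx [ag [tT lv]]].
have [tx [_ [_ cx _]]] := hc x hx.
have ht : 0 <= tau x <= T' by rewrite ltW.
have := lv (tau x) ht; rewrite -(ag _ ht (lexx _)) cx => /(_ erefl).
by move: (sigma _) (sigma _) (sigma _) (sigma _) => p q r w; lra.
Qed.

(** * Triviality of the holonomy *)

Lemma between_segment (R : realType) (a b x y u : R) :
  a < x < b -> a < y < b -> 0 <= u <= 1 -> a < u * (y - x) + x < b.
Proof.
move=> hx hy hu; have [xy|yx] := leP x y.
  have : x <= u * (y - x) + x <= y by nra.
  by move: (u * _ + _) => z; lra.
have : y <= u * (y - x) + x <= x by nra.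
by move: (u * _ + _) => z; lra.
Qed.

(** The one-sided holonomies of a flat structure are trivial: the displacement
    of the transverse coordinate under the first return is locally constant,
    and it tends to 0. *)
Lemma holonomy_trivial (R : realType) (U : set 'rV[R]_2)
    (M : 'rV[R]_2 -> 'M[R]_2) (X : 'rV[R]_2 -> 'rV[R]_2) (G : set (sphere R))
    (s : R -> 'rV[R]_2) (d : R) (h : R -> R) :
  flat_structure U M -> (forall p, U p -> axis R 0 *m M p = X p) ->
  Defs.transversal U X G s -> holonomy U X G s d h ->
  \forall x \near (0 : R)^'+, h x = x.
Proof.
move=> FS XM [ss _ si _ _] [/andP[d0 d1] hh h0 [c [tau [hc _]]]].
have si' (x : R) : -1 < x < 1 -> U (s x) /\ independent (axis R 0 *m M (s x)) ('D_1 s x).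
  by move=> /si[Us ind]; rewrite XM.
have [sigma [beta [ds sbox]]] := transverse_coordinate FS ss si'.
have cs (x : R) : -1 < x < 1 -> {for x, continuous s}.
  by move=> hx; exact: Cn_continuous (ss 0%N) hx.
(* Constant on ]0, d[, since it is locally constant there. *)
pose phi x := sigma (h x) - sigma x.
have dphi (x : R) : 0 < x < d -> is_derive x (1 : R) phi 0.
  move=> hx; have E := first_return_locally_constant FS XM cs ds sbox d1 hh hc hx.
  apply: is_derive_near (is_derive_cst (phi x) x 1).
  by apply: filterS E => y Ey; rewrite /= /phi Ey.
have cphi (x y : R) : 0 < x < d -> 0 < y < d -> phi x = phi y.
  move=> hx hy; have [|u _] := @interval_MVT R phi (fun _ => 0) x y.
    by move=> u hu; apply: dphi; exact: between_segment.
  by rewrite mulr0 => /eqP; rewrite subr_eq0 => /eqP.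
have [csig _ _] := ds 0 ltac:(by lra).
have hd2 : 0 < d / 2 < d by lra.
have phi0 : phi (d / 2) = 0.
  have l1 : phi x @[x --> 0^'+] --> (0 : R).
    have cs0 : sigma x @[x --> (0 : R)] --> sigma 0 by exact: continuous_is_derive csig.
    have : phi x @[x --> 0^'+] --> sigma 0 - sigma 0.
      by apply: cvgB; [exact: (cvg_comp _ _ h0 cs0)|exact: (cvg_at_right_filter cs0)].
    by rewrite subrr.
  have l2 : phi x @[x --> 0^'+] --> phi (d / 2).
    apply: cvg_near_cst; near=> x; apply: cphi => //.
    by apply/andP; split; near: x; [exact: nbhs_right_gt|exact: nbhs_right_lt].
  exact: (cvg_unique _ l2 l1).
have inj (x y : R) : 0 < x < 1 -> 0 < y < 1 -> sigma x = sigma y -> x = y.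
  move=> hx hy E; have [|u hu] := @interval_MVT R sigma beta y x.
    by move=> v hv; have := between_segment hy hx hv; move: (v * _ + _) => z hz;
       have [] := ds z ltac:(by lra).
  have := between_segment hy hx hu; move: (u * _ + _) => z hz.
  have [_ bn _] := ds z ltac:(by lra).
  by rewrite E subrr => /esym/eqP; rewrite mulf_eq0 (negPf bn) orbF subr_eq0 => /eqP.
near=> x.
have hx : 0 < x < d.
  by apply/andP; split; near: x; [exact: nbhs_right_gt|exact: nbhs_right_lt].
have [hx1 _] := hh x hx; apply: inj => //; first by lra.
by apply/eqP; rewrite -subr_eq0 -/(phi x) (cphi x _ hx hd2) phi0.
Unshelve. all: by end_near. Qed.

Theorem corollary2 (R : realType)
    (S : set 'rV[R]_2) (X : 'rV[R]_2 -> 'rV[R]_2)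
    (J : set (chart R)) (F : chart R -> cplx R -> cplx R)
    (S_closed : closed S)
    (S_accumulation : finite_set (limit_point S))
    (X_smooth : smooth_on (~` S) X)
    (J_complex : complex_structure (~` singular S X) J)
    (F_analytic : analytic_field J F)
    (X_real_part : is_real_part J F X)
    (incomplete_locally_finite :
       locally_finite_in (~` singular S X)
         (incomplete_trajectories (~` singular S X) X)) :
  let D := ~` (zeros S X `|` S `|` attractors S X) in
  (exists g : 'rV[R]_2 -> 'M[R]_2,
     [/\ riemannian_metric D g, flat_metric D g & geodesic_field D g X]) /\
  (exists Om Phi,
     local_action D Om Phi /\
     forall p, D p ->
       generator Phi (axis R 0) p = X p /\
       independent (generator Phi (axis R 0) p) (generator Phi (axis R 1) p)).
Proof.
move=> D; pose U := ~` singular S X.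
have oU : open U by case: J_complex.
have sU : smooth_on U X.
  by move=> n; apply: Cn_sub (X_smooth n) => p Up Sp; apply: Up; left.
have X0 p : U p -> X p != 0.
  move=> Up; apply/eqP => Xp; apply: (Up); right; split=> // Sp.
  by apply: Up; left.
have [M [sM uM XM box]] := flat_frame sU X0 J_complex F_analytic X_real_part.
have FS : flat_structure U M by [].
have trivial G : ~ nontrivial_holonomy U X G.
  by move=> [s [d [h [tr hol]]]]; apply; exact: (holonomy_trivial FS XM tr hol).
(* The attractors are contained in the singular set. *)
have -> : D = U.
  apply/seteqP; split=> p Dp.
    by move=> [Sp|Zp]; apply: Dp; left; [right|left].
  move=> [[Zp|Sp]|[[[Sp _]|[T [_ /trivial]]]|[G [_ /trivial]]]] //; apply: Dp => //.
    by right.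
  by left.
split.
  exists (frame_metric M); split; first exact: frame_metric_riemannian.
    exact: frame_metric_flat.
  exact: frame_metric_geodesic FS XM.
exists (flow_dom U M), (flow U M); split; first exact: flow_local_action.
move=> p Up; rewrite !(flow_generator _ FS Up); split; first exact: XM.
exact: frame_independent (uM p Up).
Qed.
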